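(* Let $\lambda,\mu>0$, $k\ge1$ an integer and $\nu\in(0,1)$. For integers $n\ge1$ and $1\le s\le k$ let $p_{n,s}^\nu(t)=\mathbb{P}(Q^\nu(t)=(n,s)\mid Q^\nu(0)=(0,0))$ be the state probability of a $\nu$-fractional $M/E_k/1$ queue $Q^\nu$ and let $\pi_{n,s}^\nu(v)$ be its Laplace transform. Then $$\begin{aligned} p_{n,s}^\nu(t)&=\sum_{j=0}^{+\infty}A^{n,s}_j\,t^{\alpha_j^{n,s}-1}E^{a^{n,s}_j}_{\nu,\alpha_j^{n,s}}(-(\lambda+k\mu)t^\nu)\\ &\quad+\sum_{j=0}^{+\infty}\sum_{m=1}^{+\infty}\sum_{r=0}^{+\infty}B^{n,s}_{j,m,r}\,t^{\beta_{j,m,r}^{n,s}-1}E^{b^{n,s}_{j,m,r}}_{\nu,\beta_{j,m,r}^{n,s}}(-(\lambda+k\mu)t^\nu)\\ &\quad-\sum_{j=0}^{+\infty}\sum_{m=1}^{+\infty}\sum_{r=0}^{+\infty}C^{n,s}_{j,m,r}\,t^{\gamma_{j,m,r}^{n,s}-1}E^{c^{n,s}_{j,m,r}}_{\nu,\gamma_{j,m,r}^{n,s}}(-(\lambda+k\mu)t^\nu) \end{aligned}$$ and, for $v>0$, $$\begin{aligned} \pi_{n,s}^\nu(v)&=\sum_{j=0}^{+\infty}A^{n,s}_j\frac{v^{\nu a^{n,s}_j-\alpha^{n,s}_j}}{(\lambda+k\mu+v^\nu)^{a^{n,s}_j}} +\sum_{j=0}^{+\infty}\sum_{m=1}^{+\infty}\sum_{r=0}^{+\infty}B^{n,s}_{j,m,r}\frac{v^{\nu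 b^{n,s}_{j,m,r}-\beta^{n,s}_{j,m,r}}}{(\lambda+k\mu+v^\nu)^{b^{n,s}_{j,m,r}}}\\ &\quad-\sum_{j=0}^{+\infty}\sum_{m=1}^{+\infty}\sum_{r=0}^{+\infty}C^{n,s}_{j,m,r}\frac{v^{\nu c^{n,s}_{j,m,r}-\gamma^{n,s}_{j,m,r}}}{(\lambda+k\mu+v^\nu)^{c^{n,s}_{j,m,r}}}, \end{aligned}$$ where $$C^0_{m,r}=\frac{m}{m+r(k+1)}\binom{m+r(k+1)}{m+rk}\lambda^r(k\mu)^{m+rk-1},\qquad \delta^0_{m,r}=m+r(k+1),$$ $$A^{n,s}_{j}=\binom{n+k+kj+j-s}{n+j}\lambda^{n+j}(k\mu)^{k(j+1)-s},\quad a^{n,s}_j=n-s+(j+1)(k+1),\quad \alpha^{n,s}_j=\nu(a^{n,s}_j-1)+1,$$ $$B^{n,s}_{j,m,r}=k\mu\, C^0_{m,r}A^{n,s}_j,\qquad b^{n,s}_{j,m,r}=\delta^0_{m,r}+a^{n,s}_j,\qquad \beta^{n,s}_{j,m,r}=\nu(b^{n,s}_{j,m,r}-1)+1,$$ $$C^{n,s}_{j,m,r}=\begin{cases} k\mu\, C^0_{m,r}A^{n,s+1}_j & s\ne k\\ k\mu\, C^0_{m,r}A^{n+1,1}_j & s= k\end{cases}\qquad c^{n,s}_{j,m,r}=\begin{cases}\delta^0_{m,r}+a^{n,s+1}_j & s \ne k\\ \delta^0_{m,r}+a^{n+1,1}_j & s=k\end{cases}$$ $$\gamma^{n,s}_{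j,m,r}=\nu(c^{n,s}_{j,m,r}-1)+1.$$
   Context: Classical queue: let $\mathcal{S}^*=\{(n,s): n\ge 1,\ 1\le s\le k\}$ ($n,s$ integers) and $\mathcal{S}=\mathcal{S}^*\cup\{(0,0)\}$. The state-phase process $Q(t)=(N(t),S(t))$ of the classical $M/E_k/1$ queue ($N$ = number of customers in the system, $S$ = phase of the customer currently being served, $S=0$ if $N=0$) is the continuous-time Markov chain on $\mathcal{S}$ with transition rates: $(0,0)\to(1,k)$ at rate $\lambda$; $(n,s)\to(n+1,s)$ at rate $\lambda$ for $(n,s)\in\mathcal{S}^*$; $(n,s)\to(n,s-1)$ at rate $k\mu$ for $s\ge2$; $(n,1)\to(n-1,k)$ at rate $k\mu$ for $n\ge2$; $(1,1)\to(0,0)$ at rate $k\mu$. Fractional queue: let $\{\sigma_\nu(t)\}_{t\ge0}$ be a $\nu$-stable subordinator independent of $Q$, with $\mathbb{E}[e^{-v\sigma_\nu(t)}]=e^{-tv^\nu}$ for $v>0$, and let $L_\nu(t)=\inf\{s\ge0:\sigma_\nu(s)>t\}$. The $\nu$-fractional $M/E_k/1$ queue has state-phase process $Q^\nu(t):=Q(L_\nu(t))$. Three-parameter Mittag-Leffler function: $E_{\nu,\gamma}^{\delta}(z)=\sum_{j=0}^{+\infty}\frac{\Gamma(\delta+j)\,z^j}{j!\,\Gamma(\delta)\,\Gamma(\nu j+\gamma)}$. *)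

(* Defs.v *)
From HB Require Import structures.
From mathcomp Require Import all_boot all_order all_algebra.
From mathcomp Require Import all_classical all_reals all_analysis.

Set Implicit Arguments.
Unset Strict Implicit.
Unset Printing Implicit Defensive.

Import Order.TTheory GRing.Theory Num.Theory.
Import numFieldNormedType.Exports.

Local Open Scope classical_set_scope.
Local Open Scope ring_scope.

(* A stochastic process is a map X : R -> T -> U of which only the times t >= 0
   are meaningful; no condition is ever put on negative times. G is the
   sigma-algebra with which the value space U is equipped. *)
Definition measurable_process {R : realType} d (T : measurableType d)
    (U : Type) (G : set (set U)) (X : R -> T -> U) : Prop :=
  forall t B, 0 <= t -> G B -> measurable (X t @^-1` B).

Definition process_sigma_algebra {R : realType} (T U : Type)
    (G : set (set U)) (X : R -> T -> U) : set (set T) :=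
  <<s [set A | exists t B, [/\ 0 <= t, G B & A = X t @^-1` B]] >>.

Definition independent_processes {R : realType} d (T : measurableType d)
    (P : probability T R) (U V : Type) (G : set (set U)) (H : set (set V))
    (X : R -> T -> U) (Y : R -> T -> V) : Prop :=
  forall A B, process_sigma_algebra G X A -> process_sigma_algebra H Y B ->
    P (A `&` B) = (P A * P B)%E.

Definition cond_prob {R : realType} d (T : measurableType d)
    (P : probability T R) (A B : set T) : R :=
  fine (P (A `&` B)) / fine (P B).

(* [q x y], for x != y, is the transition rate from x to y; the diagonal values
   of q are irrelevant. *)
Definition generator {R : realType} (I : countType) (q : I -> I -> R)
    (x y : I) : R :=
  if x == y then - fine (\esum_(z in [set~ x]) (q x z)%:E)%E else q x y.

Definition transition_function {R : realType} (I : countType)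
    (q : I -> I -> R) (p : R -> I -> I -> R) : Prop :=
  [/\ forall t x y, 0 <= t -> 0 <= p t x y,
      forall t x, 0 <= t -> (\esum_(y in [set: I]) (p t x y)%:E = 1)%E,
      forall x y, p 0 x y = (x == y)%:R,
      forall s t x z, 0 <= s -> 0 <= t ->
        ((p (s + t) x z)%:E =
         \esum_(y in [set: I]) (p s x y * p t y z)%:E)%E
    & forall x y, (p h x y - p 0 x y) / h @[h --> 0^'+] --> generator q x y].

(* The Markov property is written in product form, so that conditioning
   events of probability 0 need no special treatment. *)
Definition markov_property {R : realType} d (T : measurableType d)
    (P : probability T R) (I : countType) (p : R -> I -> I -> R)
    (X : R -> T -> I) : Prop :=
  forall (m : nat) (t : nat -> R) (x : nat -> I),
    0 <= t 0%N -> (forall i, t i <= t i.+1) ->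
    (P [set w | forall i, (i <= m.+1)%N -> X (t i) w = x i] =
     P [set w | forall i, (i <= m)%N -> X (t i) w = x i]
       * (p (t m.+1 - t m) (x m) (x m.+1))%:E)%E.

(* Time-homogeneous continuous-time Markov chain with transition rates q and an
   arbitrary initial law; paths are right-continuous for the discrete topology
   on I. *)
Definition markov_chain {R : realType} d (T : measurableType d)
    (P : probability T R) (I : countType) (q : I -> I -> R)
    (X : R -> T -> I) : Prop :=
  [/\ measurable_process [set: set I] X,
      forall w t, 0 <= t -> \forall s \near t^'+, X s w = X t w
    & exists p, transition_function q p /\ markov_property P p X].

Definition stable_subordinator {R : realType} d (T : measurableType d)
    (P : probability T R) (nu : R) (sigma : R -> T -> R) : Prop :=
  measurable_process measurable sigma /\
  [/\ forall w, sigma 0 w = 0,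
      forall w s t, 0 <= s -> s <= t -> sigma s w <= sigma t w,
      forall w t, 0 <= t -> sigma s w @[s --> t^'+] --> sigma t w
    & [/\
      forall (m : nat) (t : nat -> R) (B : nat -> set R),
        0 <= t 0%N -> (forall i, t i <= t i.+1) ->
        (forall i, measurable (B i)) ->
        (P [set w | forall i, (i < m)%N ->
              (B i (sigma (t i.+1) w - sigma (t i) w))%R] =
         \prod_(i < m)
           P [set w | (B i (sigma (t i.+1) w - sigma (t i) w))%R])%E,
      forall s h (B : set R), 0 <= s -> 0 <= h -> measurable B ->
        P [set w | B (sigma (s + h) w - sigma s w)] = P [set w | B (sigma h w)]
    & forall v t, 0 < v -> 0 <= t ->
        ('E_P[fun w => expR (- (v * sigma t w))] =
         (expR (- (t * v `^ nu)))%:E)%E ]].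

Definition inverse_subordinator {R : realType} (T : Type)
    (sigma : R -> T -> R) (t : R) (w : T) : R :=
  inf [set s | 0 <= s /\ t < sigma s w].

Definition time_change {R : realType} (T U : Type)
    (X : R -> T -> U) (L : R -> T -> R) (t : R) (w : T) : U := X (L t w) w.

Definition valid_state (k : nat) : pred (nat * nat) :=
  fun x => (x == (0, 0)%N) || [&& (0 < x.1)%N, (0 < x.2)%N & (x.2 <= k)%N].

Definition state (k : nat) : countType := {x : nat * nat | valid_state k x}.

Definition after_service (k : nat) (x : nat * nat) : nat * nat :=
  if (1 < x.2)%N then (x.1, x.2.-1)
  else if (1 < x.1)%N then (x.1.-1, k) else (0, 0)%N.

Definition queue_rate {R : realType} (lam mu : R) (k : nat)
    (x y : state k) : R :=
  let: x := val x in let: y := val y in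
  if x == (0, 0)%N then (if y == (1%N, k) then lam else 0)
  else if y == (x.1.+1, x.2) then lam
  else if y == after_service k x then k%:R * mu
  else 0.

(* For n >= 1 and 1 <= s <= k; [Qnu] is the state-phase process. *)
Definition state_prob {R : realType} d (T : measurableType d)
    (P : probability T R) (k : nat) (Qnu : R -> T -> state k)
    (n s : nat) (t : R) : R :=
  cond_prob P [set w | val (Qnu t w) = (n, s)]
              [set w | val (Qnu 0 w) = (0, 0)%N].

Definition laplace {R : realType} (f : R -> R) (v : R) : \bar R :=
  (\int[lebesgue_measure]_(t in `[0%R, +oo[%classic)
     (expR (- (v * t)) * f t)%:E)%E.

(* Euler's Gamma function, for x > 0. *)
Definition Gamma {R : realType} (x : R) : R :=
  (\int[lebesgue_measure]_(t in `]0%R, +oo[%classic)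
     (t `^ (x - 1) * expR (- t)))%R.

Definition mittag_leffler {R : realType} (nu gam del z : R) : R :=
  limn (series (fun j : nat =>
    Gamma (del + j%:R) * z ^+ j
      / (j`!%:R * Gamma del * Gamma (nu * j%:R + gam)))).

(* sum_{i = a}^{+oo} u_i converges, with sum l. *)
Definition sums_to {R : realType} (a : nat) (u : nat -> R) (l : R) : Prop :=
  (\sum_(a <= i < N) u i) @[N --> \oo] --> l.

(* The iterated sum sum_{j >= 0} sum_{m >= 1} sum_{r >= 0} u_{j,m,r} converges
   (at each of its three levels), with sum l. *)
Definition sums_to3 {R : realType} (u : nat -> nat -> nat -> R) (l : R)
    : Prop :=
  exists (g : nat -> nat -> R) (h : nat -> R),
    [/\ forall j m, (0 < m)%N -> sums_to 0 (u j m) (g j m),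
        forall j, sums_to 1 (g j) (h j)
      & sums_to 0 h l].

(* The natural-number subtractions below are only used for 1 <= s <= k and
   m >= 1, where they are not truncated. *)

Definition delta0 (k m r : nat) : nat := (m + r * (k + 1))%N.

Definition coef_C0 {R : realType} (lam mu : R) (k m r : nat) : R :=
  m%:R / (m + r * (k + 1))%:R * 'C(m + r * (k + 1), m + r * k)%:R
    * lam ^+ r * (k%:R * mu) ^+ (m + r * k - 1).

Definition coef_A {R : realType} (lam mu : R) (k n s j : nat) : R :=
  'C(n + k + k * j + j - s, n + j)%:R
    * lam ^+ (n + j) * (k%:R * mu) ^+ (k * (j + 1) - s).

Definition idx_a (k n s j : nat) : nat := (n + (j + 1) * (k + 1) - s)%N.

Definition coef_B {R : realType} (lam mu : R) (k n s j m r : nat) : R :=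
  k%:R * mu * coef_C0 lam mu k m r * coef_A lam mu k n s j.

Definition idx_b (k n s j m r : nat) : nat :=
  (delta0 k m r + idx_a k n s j)%N.

Definition coef_C {R : realType} (lam mu : R) (k n s j m r : nat) : R :=
  if s != k then k%:R * mu * coef_C0 lam mu k m r * coef_A lam mu k n s.+1 j
  else k%:R * mu * coef_C0 lam mu k m r * coef_A lam mu k n.+1 1 j.

Definition idx_c (k n s j m r : nat) : nat :=
  if s != k then (delta0 k m r + idx_a k n s.+1 j)%N
  else (delta0 k m r + idx_a k n.+1 1 j)%N.

(* alpha, beta and gamma are the images of a, b and c under this map. *)
Definition expo {R : realType} (nu : R) (a : nat) : R := nu * (a%:R - 1) + 1.

Definition time_term {R : realType} (lam mu nu : R) (k a : nat) (t : R) : R :=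
  t `^ (expo nu a - 1)
    * mittag_leffler nu (expo nu a) a%:R (- (lam + k%:R * mu) * t `^ nu).

Definition laplace_term {R : realType} (lam mu nu : R) (k a : nat) (v : R)
    : R :=
  v `^ (nu * a%:R - expo nu a) / (lam + k%:R * mu + v `^ nu) ^+ a.

(* Main.v *)
(* By independence, the law of [Q (L t)] is the expectation at the operational
   time [L t] of the transition probability [p] of the classical queue, and
   Laplace transforms in time are turned into each other by [v -> v^nu] and a
   factor [v^(nu - 1)]. The number of service phases left to complete is a walk
   with steps [+k] at rate [lam] and [-1] at rate [b = k mu], stopped going down
   at 0, so the backward equation determines the Laplace transform of [p]: it is
   the Green function of the free walk, plus a reflection term which is the
   difference of two Green functions times the sum of the first passage
   transforms [z^m], [m >= 1]. Expanded in powers of [1 / (lam + b + v)], the three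
   pieces have the nonnegative coefficients A, B and C. By injectivity of the
   Laplace transform [p] is a combination of three mixtures of the kernels
   [u^m exp (- (lam + b) u) / m!], and the expectation of such a kernel at [L t] is
   a Mittag-Leffler term. All sums are nonnegative, hence may be interchanged with
   integrals freely. *)
Require Import Defs.
From HB Require Import structures.
From mathcomp Require Import all_boot all_order all_algebra.
From mathcomp Require Import all_classical all_reals all_analysis.
From mathcomp Require Import measurable_realfun lra ring zify.
Import Order.TTheory GRing.Theory Num.Theory.
Import numFieldNormedType.Exports.
Local Open Scope classical_set_scope.
Local Open Scope ring_scope.
Set Implicit Arguments.
Unset Strict Implicit.

(** * Exponential and Gamma integrals *)

(** Convergence is always obtained by bounding partial sums. The Green series and the ballot series
    of [z^m] obey first-step equations, and simple supersolutions ([1 / v] and [(c / (c + v))^m],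
    where [c = lam + b]) bound their partial sums by induction. The powers [z^m] enter only through
    the linear recurrence in [m] that the ballot numbers satisfy. A weight [(c + v)^-(m + 1)] bounds
    the kernel of order [m] and its local Lipschitz constant, so convergence of a transform already
    makes the mixture finite and continuous. Injectivity is needed pointwise, hence requires
    regularity: the moments of [L t] are known to be monotone in [t] and are compared with a
    continuous function, whereas [p] is continuous because its increments are controlled by its
    behaviour at time 0. Two null events need care. Where [sigma] stays below [t], [L t] is the
    infimum of the empty set, which is 0; and [L 0 = 0] holds only almost surely, so the
    conditioning event at time 0 must be replaced by the one for [Q]. *)

Lemma cvg_expRN_exprn (R : realType) (m : nat) :
  (expR (- x) * x ^+ m : R) @[x --> +oo] --> (0 : R).
Proof.
apply/cvgrPdist_le => e e0.
near=> x.
have x0 : 0 < x by near: x; exact: nbhs_pinfty_gt.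
rewrite sub0r normrN ger0_norm ?mulr_ge0 ?expR_ge0 ?exprn_ge0 ?(ltW x0)//.
have := expR_ge1Dxn m (ltW x0).
move=> h; rewrite expRN. rewrite [leLHS]mulrC ler_pdivrMr ?expR_gt0//.
have h2 : x ^+ m.+1 / m.+1`!%:R <= expR x by apply: le_trans h; rewrite lerDr.
have hx : m.+1`!%:R / e <= x by near: x; apply: nbhs_pinfty_ge; rewrite num_real.
have f0 : (0:R) < m.+1`!%:R by rewrite ltr0n fact_gt0.
apply: le_trans (ler_wpM2l (ltW e0) h2).
rewrite exprS mulrA ler_pdivlMr// mulrC mulrA ler_pM2r ?exprn_gt0//.
by rewrite [leRHS]mulrC -ler_pdivrMr.
Unshelve. all: by end_near. Qed.

(** Differentiating [exp (- x)] times the Taylor polynomial of [exp] telescopes to the top term.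
    This explicit primitive evaluates the factorial integrals in one application of the fundamental
    theorem. *)
Lemma is_derive_expRN_taylor (R : realType) (m : nat) (x : R) :
  is_derive x 1 (fun x : R => - \sum_(i < m.+1) (expR (- x) * x ^+ i) / i`!%:R)
    (expR (- x) * x ^+ m / m`!%:R).
Proof.
have HE : is_derive x 1 (fun x : R => expR (- x)) (- expR (- x)).
  have h : is_derive (- x) 1 (@expR R) (expR (- x)) by exact: is_derive_expR.
  have h' : is_derive x 1 (fun x : R => - x) (- 1) by apply: is_derive_eq.
  have := @is_derive1_comp R expR (fun x => - x) x _ _ h h'.
  by move=> h2; apply: is_derive_eq; rewrite mulrN mulr1.
elim: m => [|m IH].
  rewrite (_ : (fun _ => _) = fun x : R => - expR (- x)); last first.
    by apply/funext => y; rewrite big_ord1 expr0 fact0 mulr1 divr1.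
  rewrite expr0 fact0 divr1 mulr1.
  by apply: (is_derive_eq (is_deriveN HE)); rewrite opprK ?expr0 ?fact0 ?mulr1 ?divr1.
rewrite (_ : (fun _ => _) = fun x : R => - (\sum_(i < m.+1) (expR (- x) * x ^+ i) / i`!%:R)
    - (m.+1`!%:R^-1 * (expR (- x) * x ^+ m.+1))); last first.
  by apply/funext => y; rewrite big_ord_recr/= opprD [X in _ - X = _]mulrC.
have HX : is_derive x 1 (fun x : R => x ^+ m.+1) ((m.+1%:R * x ^+ m) *: 1).
  rewrite (_ : (fun _ => _) = (@idfun R) ^+ m.+1); last by rewrite exprfctE.
  exact: (is_deriveX m.+1 (is_derive_id (x : R^o) 1)).
have H := is_deriveZ m.+1`!%:R^-1 (is_deriveM HE HX).
apply: (is_derive_eq (is_deriveB IH H)).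
have f0 : m`!%:R != 0 :> R by rewrite pnatr_eq0 -lt0n fact_gt0.
have f1 : m.+1%:R != 0 :> R by rewrite pnatr_eq0.
rewrite /GRing.scale/= exprS factS natrM.
move: f0 f1; move: (m`!%:R) (m.+1%:R) => a b f0 f1.
field.
by rewrite f0.
Qed.

Lemma continuous_expRN (R : realType) (w : R) : continuous (fun t : R => expR (- (w * t))).
Proof.
move=> t; apply: (@continuous_comp _ _ _ (fun t => - (w * t)) expR); last exact: continuous_expR.
by apply: continuousN; apply: mulrl_continuous.
Qed.

Lemma continuous_expRN_exprn (R : realType) (w : R) (m : nat) :
  continuous (fun t : R => expR (- (w * t)) * t ^+ m).
Proof.
move=> t; apply: (@continuousM R _ (fun t => expR (- (w * t))) (fun t => t ^+ m)).
  exact: continuous_expRN.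
exact: exprn_continuous.
Qed.

Lemma integral_expRN_exprn (R : realType) (m : nat) (w : R) : 0 < w ->
  (\int[lebesgue_measure]_(t in `[0%R, +oo[) (expR (- (w * t)) * t ^+ m)%:E =
   (m`!%:R / w ^+ m.+1)%:E)%E.
Proof.
move=> w0.
pose G := fun x : R => - \sum_(i < m.+1) (expR (- x) * x ^+ i) / i`!%:R.
pose K : R := m`!%:R / w ^+ m.+1.
pose F := fun t => K * G (w * t).
have f0 : m`!%:R != 0 :> R by rewrite pnatr_eq0 -lt0n fact_gt0.
have dF (t : R) : is_derive t 1 F (expR (- (w * t)) * t ^+ m).
  have HG := is_derive_expRN_taylor m (w * t).
  have h : is_derive t 1 (fun t : R => w * t) (w *: 1).
    exact: (is_deriveZ w (is_derive_id (t : R^o) 1)).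
  have h2 := @is_derive1_comp R G (fun t => w * t) t _ _ HG h.
  apply: (is_derive_eq (is_deriveZ K h2)).
  rewrite /GRing.scale/= /K exprMn exprS.
  have w1 : w != 0 by rewrite gt_eqF.
  have w2 : w ^+ m != 0 by rewrite expf_neq0.
  move: f0 w2; move: (m`!%:R) (w ^+ m) => a c a0 c0.
  by field; rewrite a0 c0.
have cF : continuous F.
  move=> t; apply: differentiable_continuous; apply/derivable1_diffP.
  by have [] := dF t.
rewrite (@ge0_continuous_FTC2y R _ F 0 0).
- rewrite /F /G mulr0 big_ord_recl big1 => [|i _].
    by rewrite oppr0 expR0 expr0 fact0 divr1 addr0 mulr1 -EFinB sub0r mulrN mulr1 opprK.
  by rewrite /= /bump/= exprS mul0r mulr0 mul0r.
- by move=> x x0; rewrite mulr_ge0// ?expR_ge0 ?exprn_ge0.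
- by apply: continuous_subspaceT; exact: continuous_expRN_exprn.
- rewrite /F [X in _ --> X](_ : _ = K * 0); last by rewrite mulr0.
  apply: cvgMl_tmp.
  have hw : (w * t) @[t --> +oo] --> +oo.
    by apply: gt0_cvgMry => //; exact: cvg_id.
  suff hG : G x @[x --> +oo] --> 0 by exact: (cvg_comp _ _ hw hG).
  rewrite /G -[X in _ --> X]oppr0.
  apply: cvgN.
  rewrite [X in _ --> X](_ : _ = \sum_(i < m.+1) (0 / i`!%:R)); last first.
    by rewrite big1// => i _; rewrite mul0r.
  apply: cvg_big => //; first by exact: add_continuous.
  by move=> i _; apply: cvgMr_tmp; exact: cvg_expRN_exprn.
- by move=> x _; have [] := dF x.
- exact/cvg_at_right_filter/cF.
- by move=> x _; rewrite derive1E; have [_ ->] := dF x.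
Qed.

Lemma within_continuous_powR (R : realType) (x : R) : 0 <= x ->
  {within `[0, +oo[, continuous (fun t : R => t `^ x)}.
Proof.
move=> x0; apply/continuous_within_itvcyP; split.
  move=> t; rewrite in_itv/= andbT => t0.
  apply: differentiable_continuous; apply/derivable1_diffP.
  by apply: derivable_powR; rewrite in_itv/= andbT.
move: x0; rewrite le_eqVlt => /orP[/eqP<-|x0].
  by rewrite powRr0; under eq_fun do rewrite powRr0; exact: cvg_cst.
by rewrite powR0 ?gt_eqF//; exact: powR_cvg0.
Qed.

Lemma powR_le_expn (R : realType) (x t : R) (m : nat) : 0 <= x -> x <= m%:R -> 0 <= t ->
  t `^ x <= 1 + t ^+ m.
Proof.
move=> x0 xm t0; have [t1|t1] := leP t 1; last first.
  apply: (@le_trans _ _ (t ^+ m)); last by rewrite lerDr.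
  by rewrite -powR_mulrn//; apply: ler_powR => //; exact: ltW.
apply: (@le_trans _ _ 1); last by rewrite lerDl exprn_ge0.
move: t0; rewrite le_eqVlt => /orP[/eqP<-|t0].
  by have [->|xn0] := eqVneq x 0; [rewrite powRr0|rewrite powR0].
by rewrite -(@powRr0 _ t); apply: ger_powR; rewrite ?t0.
Qed.

Lemma measurable_expRN (R : realType) (w : R) (D : set R) :
  measurable_fun D (fun t : R => expR (- (w * t))).
Proof.
apply: measurable_funTS.
by apply: continuous_measurable_fun; exact: continuous_expRN.
Qed.

Lemma measurable_powR_expRN (R : realType) (x w : R) (D : set R) :
  measurable_fun D (fun t : R => t `^ x * expR (- (w * t))).
Proof.
apply: measurable_funM; last exact: measurable_expRN.
by apply: measurable_funTS; exact: measurable_powR.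
Qed.

Lemma measurable_powR_expRN1 (R : realType) (x : R) (D : set R) :
  measurable_fun D (fun t : R => t `^ x * expR (- t)).
Proof. by have := @measurable_powR_expRN R x 1 D; under eq_fun do rewrite mul1r. Qed.

Lemma integral_expRN_powR_lty (R : realType) (x : R) : 0 <= x ->
  (\int[lebesgue_measure]_(t in `[0%R, +oo[) (t `^ x * expR (- t))%:E < +oo)%E.
Proof.
move=> x0; pose m := (Num.trunc x).+1.
have xm : x <= m%:R by apply/ltW; rewrite truncnS_gt.
have mE w D n : measurable_fun D (fun t : R => (expR (- (w * t)) * t ^+ n)%:E).
  apply/measurable_EFinP; apply: measurable_funTS.
  by apply: continuous_measurable_fun; exact: continuous_expRN_exprn.
apply: (@le_lt_trans _ _ (\int[lebesgue_measure]_(t in `[0%R, +oo[)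
  ((expR (- (1 * t)) * t ^+ 0)%:E + (expR (- (1 * t)) * t ^+ m)%:E))%E).
  apply: ge0_le_integral => //=.
  - by move=> t _; rewrite lee_fin mulr_ge0// ?powR_ge0 ?expR_ge0.
  - apply/measurable_EFinP; exact: measurable_powR_expRN1.
  - by apply: emeasurable_funD; exact: mE.
  - move=> t; rewrite in_itv/= andbT => t0.
    rewrite -EFinD lee_fin mul1r -mulrDr mulrC ler_wpM2l ?expR_ge0// expr0.
    exact: powR_le_expn.
rewrite ge0_integralD//=; try exact: mE.
- by rewrite !integral_expRN_exprn// -EFinD ltry.
- by move=> t; rewrite in_itv/= andbT => t0; rewrite lee_fin mulr_ge0// ?expR_ge0 ?exprn_ge0.
- by move=> t; rewrite in_itv/= andbT => t0; rewrite lee_fin mulr_ge0// ?expR_ge0 ?exprn_ge0.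
Qed.

(** Arguments [x + 1] with [0 <= x] keep the integrand bounded near 0; the closed half-line is the
    domain of all Laplace integrals here. *)
Lemma GammaE (R : realType) (x : R) : 0 <= x ->
  (Gamma (x + 1))%:E =
  (\int[lebesgue_measure]_(t in `[0%R, +oo[) (t `^ x * expR (- t))%:E)%E.
Proof.
move=> x0; rewrite /Gamma /Rintegral.
rewrite integral_itv_obnd_cbnd; last first.
  by apply/measurable_EFinP; exact: measurable_powR_expRN1.
rewrite addrK fineK// ge0_fin_numE ?integral_expRN_powR_lty//.
by apply: integral_ge0 => t _; rewrite lee_fin mulr_ge0// ?powR_ge0 ?expR_ge0.
Qed.

Lemma Gamma_fact (R : realType) (m : nat) : Gamma (m%:R + 1) = m`!%:R :> R.
Proof.
apply: EFin_inj; rewrite GammaE//.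
have := @integral_expRN_exprn R m 1 ltr01; rewrite expr1n divr1 => <-.
apply: eq_integral => t; rewrite inE/= in_itv/= andbT => t0.
by rewrite mul1r powR_mulrn// mulrC.
Qed.

Lemma laplace_powR (R : realType) (x v : R) : 0 <= x -> 0 < v ->
  (\int[lebesgue_measure]_(t in `[0%R, +oo[) (expR (- (v * t)) * t `^ x)%:E =
   (Gamma (x + 1) / v `^ (x + 1))%:E)%E.
Proof.
move=> x0 v0.
have vx : 0 < v `^ (x + 1) by rewrite powR_gt0.
have dF (t : R) : is_derive t 1 (fun t : R => v * t) (v *: 1).
  exact: (is_deriveZ v (is_derive_id (t : R^o) 1)).
have dFE : derive1 (fun t : R => v * t) = cst v.
  by apply/funext => t; rewrite derive1E; have [_ ->] := dF t; rewrite /GRing.scale/= mulr1.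
have cF : continuous (fun t : R => v * t) by move=> t; apply: mulrl_continuous.
suff : ((Gamma (x + 1))%:E = (v `^ (x + 1))%:E *
   \int[lebesgue_measure]_(t in `[0%R, +oo[) (expR (- (v * t)) * t `^ x)%:E)%E.
  by rewrite EFinM => ->; rewrite muleAC -EFinM divff ?gt_eqF// mul1e.
rewrite GammaE//.
rewrite (_ : `[0%R, +oo[%classic = `[(v * 0)%R, +oo[%classic) ; last by rewrite mulr0.
rewrite (@increasing_ge0_integration_by_substitutiony R (fun t => v * t)
  (fun t : R => t `^ x * expR (- t)) 0).
- rewrite dFE [in RHS]mulr0 -ge0_integralZl_EFin//=.
  + apply: eq_integral => t; rewrite inE/= in_itv/= andbT => t0.
    rewrite -EFinM; congr EFin.
    transitivity ((v * t) `^ x * expR (- (v * t)) * v); first by [].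
    by rewrite powRM ?(ltW v0)// powRD ?(gt_eqF v0) ?implybT// powRr1 ?(ltW v0)//; ring.
  + by move=> t _; rewrite lee_fin mulr_ge0// ?powR_ge0 ?expR_ge0.
  + apply/measurable_EFinP; apply: measurable_funM; first exact: measurable_expRN.
    by apply: measurable_funTS; exact: measurable_powR.
  + exact: ltW.
- by move=> s t _ _ st; rewrite ltr_pM2l.
- by move=> t _; rewrite dFE; exact: cst_continuous.
- by rewrite dFE; exact: is_cvg_cst.
- by rewrite dFE; exact: is_cvg_cst.
- split; first by move=> t _; have [] := dF t.
  exact/cvg_at_right_filter/cF.
- by apply: gt0_cvgMry => //; exact: cvg_id.
- rewrite mulr0.
  have cE : continuous (fun t : R => expR (- t)).
    by have := @continuous_expRN R 1; under eq_fun do rewrite mul1r.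
  have /continuous_within_itvcyP[h1 h2] := within_continuous_powR x0.
  apply/continuous_within_itvcyP; split.
    move=> t tI; apply: (@continuousM R _ (fun t : R => t `^ x) (fun t : R => expR (- t))).
      exact: h1.
    exact: cE.
  by apply: cvgM; [exact: h2|exact/cvg_at_right_filter/cE].
- by move=> t _; rewrite mulr_ge0// ?powR_ge0 ?expR_ge0.
Qed.

(** * Injectivity of the Laplace transform *)

Section laplace_injective.
Variables (R : realType) (g : R -> R).
Local Notation mu := (@lebesgue_measure R).
Local Notation D := `[0%R, +oo[%classic.
Hypothesis ig : forall v : R, 0 < v ->
  mu.-integrable D (EFin \o (fun t : R => expR (- (v * t)) * g t)).
Hypothesis g0 : forall v : R, 0 < v ->
  (\int[mu]_(t in D) (expR (- (v * t)) * g t)%:E = 0)%E.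

(** The factor [exp (- t)] makes [w] itself integrable, and a polynomial in [exp (- t)] times [w]
    becomes a combination of the Laplace integrands of [g] at the rates [1, 2, ...]. *)
Let w (t : R) : R := expR (- (1 * t)) * g t.

Let wX n (t : R) : expR (- t) ^+ n * w t = expR (- (n.+1%:R * t)) * g t.
Proof.
rewrite /w mulrA -expRM_natl -expRD; congr (expR _ * _).
by rewrite -natr1; ring.
Qed.

Let poly_w (q : {poly R}) (t : R) :
  (q.[expR (- t)] * w t)%:E =
  (\sum_(i < size q) (q`_i)%:E * (expR (- (i.+1%:R * t)) * g t)%:E)%E.
Proof.
rewrite horner_coef mulr_suml sumEFin; congr EFin; apply: eq_bigr => i _.
by rewrite -mulrA wX.
Qed.

Let integrable_poly (q : {poly R}) :
  mu.-integrable D (fun t => (q.[expR (- t)] * w t)%:E).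
Proof.
apply: (@eq_integrable _ _ _ mu D _ (fun t : R => (\sum_(i < size q)
    (q`_i)%:E * (expR (- (i.+1%:R * t)) * g t)%:E)%E)) => //.
apply: (@integrable_sum _ _ _ mu D _ _ _ _
  (fun (i : 'I_(size q)) t => ((q`_i)%:E * (expR (- (i.+1%:R * t)) * g t)%:E)%E)) => // i _.
by apply: integrableZl => //; exact: ig.
Qed.

Let integral_poly (q : {poly R}) :
  (\int[mu]_(t in D) (q.[expR (- t)] * w t)%:E = 0)%E.
Proof.
transitivity (\int[mu]_(t in D) (\sum_(i < size q)
    (q`_i)%:E * (expR (- (i.+1%:R * t)) * g t)%:E))%E.
  by apply: eq_integral => t _; exact: poly_w.
rewrite (@integral_sum _ _ _ mu D _ _
  (fun (i : 'I_(size q)) t => ((q`_i)%:E * (expR (- (i.+1%:R * t)) * g t)%:E)%E)) //.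
  rewrite big1// => i _; rewrite integralZl//; last exact: ig.
  by rewrite g0// mule0.
by move=> i; apply: integrableZl => //; exact: ig.
Qed.

(* The polynomials [(1 - (x - x0)^2)^n] in [x = exp (- t)] concentrate at an
   interior point of the interval, so they cannot all integrate to zero. *)
Lemma laplace_eq0_not_ge (a b e : R) : 0 <= a -> a < b -> 0 < e ->
  ~ (forall t, a < t < b -> e <= g t).
Proof.
move=> a0 ab e0 hg.
pose m := (a + b) / 2.
have am : a < m by rewrite /m; lra.
have mb : m < b by rewrite /m; lra.
pose x0 := expR (- m).
have x01 : x0 <= 1 by rewrite -expR0 ler_expR; lra.
have x00 : 0 < x0 by exact: expR_gt0.
(* Outside [(a, b)], [exp (- t)] is at distance at least [d] from [x0]; on [(m, b')] it is within
   [d / 2], because [exp (- t)] is 1-Lipschitz for [t >= 0]. This separates the rates in [c2] and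
   [c1]. *)
pose d : R := Num.min (expR (- a) - x0) (x0 - expR (- b)).
have d0 : 0 < d.
  by rewrite lt_min !subr_gt0 !ltr_expR; apply/andP; split; lra.
have d1 : d < 1.
  rewrite gt_min; apply/orP; right.
  by have := expR_gt0 (- b); lra.
pose b' : R := Num.min b (m + d / 2).
have mb' : m < b' by rewrite lt_min mb/=; lra.
pose q n : {poly R} := (1 - ('X - x0%:P) ^+ 2) ^+ n.
have qE n x : (q n).[x] = (1 - (x - x0) ^+ 2) ^+ n by rewrite /q !hornerE.
pose c1 n : R := (1 - d ^+ 2 / 4) ^+ n * (expR (- b) * e).
pose c2 n : R := (1 - d ^+ 2) ^+ n.
have iw : mu.-integrable D (EFin \o w) by exact: ig.
pose W := fine (\int[mu]_(t in D) (`|w t|)%:E)%E.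
have iaw : mu.-integrable D (fun t => (`|w t|)%:E) by exact: (integrable_abse iw).
have WE : (\int[mu]_(t in D) (`|w t|)%:E)%E = W%:E.
  by rewrite fineK//; apply: integrable_fin_num.
have key n (t : R) : D t ->
    c1 n * \1_(`]m, b'[%classic : set R) t - c2 n * `|w t| <= (q n).[expR (- t)] * w t.
  rewrite /= in_itv/= andbT => t0; rewrite qE.
  have et1 : expR (- t) <= 1 by rewrite -expR0 ler_expR; lra.
  have et0 : 0 < expR (- t) by exact: expR_gt0.
  have base0 : 0 <= 1 - (expR (- t) - x0) ^+ 2 by nra.
  have [/andP[ta tb]|tab] := boolP (a < t < b).
    have gt0 : e <= g t by apply: hg; rewrite ta.
    have wge : expR (- b) * e <= w t.
      rewrite /w ler_pM ?expR_ge0 ?(ltW e0)// ler_expR mul1r; lra.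
    have w0 : 0 <= w t.
      by apply: le_trans wge; rewrite mulr_ge0 ?expR_ge0// ltW.
    have c20 : 0 <= c2 n by rewrite exprn_ge0//; nra.
    rewrite indicE; have [tm|tm] := boolP (t \in _); last first.
      rewrite mulr0 sub0r (@le_trans _ _ 0)//; last by rewrite mulr_ge0// exprn_ge0.
      by rewrite oppr_le0 mulr_ge0.
    rewrite mulr1 lerBlDr (@le_trans _ _ ((1 - (expR (- t) - x0) ^+ 2) ^+ n * w t))//; last first.
      by rewrite lerDl mulr_ge0.
    rewrite /c1; apply: ler_pM => //.
    - by rewrite exprn_ge0//; nra.
    - by rewrite mulr_ge0 ?expR_ge0// ltW.
    apply: lerXn2r; rewrite ?nnegrE//; first by nra.
    move: tm; rewrite inE/= in_itv/= lt_min => /and3P[mt _ td].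
    have h1 : x0 - expR (- t) <= t - m.
      have -> : expR (- t) = x0 * expR (- (t - m)).
        by rewrite -expRD; congr expR; ring.
      have := expR_ge1Dx (- (t - m)); set E := expR (- (t - m)) => h.
      have E1 : E <= 1 by rewrite -expR0 ler_expR; lra.
      by nra.
    have h2 : expR (- t) <= x0 by rewrite ler_expR; lra.
    by nra.
  have hd : d <= `|expR (- t) - x0|.
    move: tab; rewrite negb_and -!leNgt => /orP[ta|tb].
      apply: (@le_trans _ _ (expR (- a) - x0)); first by rewrite ge_min lexx.
      apply: le_trans (ler_norm _); rewrite lerD2r ler_expR; lra.
    apply: (@le_trans _ _ (x0 - expR (- b))); first by rewrite ge_min lexx orbT.
    rewrite distrC; apply: le_trans (ler_norm _); rewrite lerD2l lerN2 ler_expR; lra.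
  rewrite indicE memNset ?mulr0 ?sub0r; last first.
    rewrite /= in_itv/= lt_min => /and3P[mt tb _].
    by move: tab; rewrite (lt_trans am mt) tb.
  rewrite lerNl.
  apply: le_trans (ler_norm _) _; rewrite normrN normrM ler_wpM2r//.
  rewrite ger0_norm ?exprn_ge0//; apply: lerXn2r; rewrite ?nnegrE//; first by nra.
  rewrite lerD2l lerN2 -[leRHS]real_normK ?num_real//.
  by rewrite lerXn2r ?nnegrE// ltW.
have main n : c1 n * (b' - m) <= c2 n * W.
  have i1 : mu.-integrable D (EFin \o (fun t : R => c1 n * \1_(`]m, b'[%classic : set R) t)).
    apply: (@integrableS _ _ _ _ setT) => //.
    exact: (integrableZl measurableT (c1 n) (integrable_indic_itv m b' false true)).
  have i2 : mu.-integrable D (EFin \o (fun t : R => c2 n * `|w t|)).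
    exact: (@integrableZl _ _ _ mu D _ (c2 n) _ iaw).
  have : (\int[mu]_(t in D) ((c1 n * \1_(`]m, b'[%classic : set R) t)%:E - (c2 n * `|w t|)%:E) <= 0)%E.
    rewrite -[leRHS](integral_poly (q n)); apply: le_integral => //.
    - exact: integrableB.
    - by move=> t; rewrite inE => tD; rewrite -EFinB lee_fin; exact: key.
  rewrite (integralB_EFin _ i1 i2)//.
  under eq_integral do rewrite EFinM.
  rewrite integralZl//; last first.
    by apply: (@integrableS _ _ _ _ setT) => //; exact: (integrable_indic_itv m b' false true).
  rewrite integral_indic//.
  under [X in (_ - X)%E]eq_integral do rewrite EFinM.
  rewrite integralZl// WE setIidl; last first.
    by move=> t; rewrite /= !in_itv/= andbT => /andP[mt _]; lra.
  have hmu : lebesgue_measure (`]m, b'[%classic : set R) = (b' - m)%:E.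
    by rewrite lebesgue_measure_itv/= lte_fin mb'.
  rewrite [X in (_ * X - _ <= _)%E](_ : _ = (b' - m)%:E); last exact: hmu.
  rewrite -!EFinM -EFinB lee_fin.
  by rewrite subr_le0.
(* Dividing [main] by [(1 - d^2 / 4)^n] bounds a fixed positive number by [rho ^+ n * W], which
   tends to 0. *)
pose rho := (1 - d ^+ 2) / (1 - d ^+ 2 / 4).
have p0 : 0 < 1 - d ^+ 2 / 4 by nra.
have rho0 : 0 <= rho by rewrite divr_ge0//; nra.
have rho1 : `|rho| < 1 by rewrite ger0_norm// ltr_pdivrMr//; nra.
pose K := expR (- b) * e * (b' - m).
have K0 : 0 < K by rewrite !mulr_gt0 ?expR_gt0// subr_gt0.
have hK n : K <= rho ^+ n * W.
  have h := main n; rewrite /rho expr_div_n [leRHS]mulrAC ler_pdivlMr ?exprn_gt0//.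
  by rewrite /K [leLHS]mulrC mulrA.
have hc : (rho ^+ n * W) @[n --> \oo] --> 0 * W.
  by apply: cvgMr_tmp; exact: cvg_expr.
have : K <= 0 * W.
  rewrite -(cvg_lim _ hc)//; apply: limr_ge; first by apply/cvg_ex; exists (0 * W).
  exact: nearW.
by rewrite mul0r leNgt K0.
Qed.

End laplace_injective.

Section laplace_unique.
Variables (R : realType).
Local Notation mu := (@lebesgue_measure R).
Local Notation D := `[0%R, +oo[%classic.

(** A strict inequality at [t0] persists, with half the gap, on a one-sided interval: to the right
    of [t0] if [m] is the larger function, to the left if [h] is. *)
Lemma laplace_monotone_eq (m h : R -> R) (t0 : R) :
  (forall v : R, 0 < v ->
    mu.-integrable D (EFin \o (fun t : R => expR (- (v * t)) * (m t - h t)))) ->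
  (forall v : R, 0 < v ->
    (\int[mu]_(t in D) (expR (- (v * t)) * (m t - h t))%:E = 0)%E) ->
  (forall s t, 0 <= s -> s <= t -> m s <= m t) ->
  0 < t0 -> {for t0, continuous h} -> m t0 = h t0.
Proof.
move=> ig g0 mm t00 ch; apply/eqP; rewrite eq_le; apply/andP; split.
  rewrite leNgt; apply/negP => hm.
  pose e := (m t0 - h t0) / 2.
  have e0 : 0 < e by rewrite /e; lra.
  move/cvgrPdist_lt : ch => /(_ _ e0)[r /= r0 hr].
  apply: (@laplace_eq0_not_ge R (fun t => m t - h t) ig g0 t0 (t0 + r) e) => //; [exact: ltW|lra|].
  move=> t /andP[tt tr].
  have ht : `|t0 - t| < r by rewrite ltr_norml; lra.
  have := hr t ht; rewrite /= ltr_norml => /andP[].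
  by have := mm t0 t (ltW t00) (ltW tt); rewrite /e; lra.
rewrite leNgt; apply/negP => hm.
pose e := (h t0 - m t0) / 2.
have e0 : 0 < e by rewrite /e; lra.
move/cvgrPdist_lt : ch => /(_ _ e0)[r /= r0 hr].
(* The interval to the left must remain in the half-line where [m] is monotone. *)
pose a := Num.max 0 (t0 - r).
have a0 : 0 <= a by rewrite le_max lexx.
have at0 : a < t0 by rewrite gt_max t00/=; lra.
have ar : t0 - r <= a by rewrite le_max lexx orbT.
have E (v t : R) : expR (- (v * t)) * (h t - m t) = - (expR (- (v * t)) * (m t - h t)).
  by ring.
apply: (@laplace_eq0_not_ge R (fun t => h t - m t) _ _ a t0 e) => //.
- move=> v v0; have := ig v v0 => /integrableN.
  by apply: eq_integrable => // t _; rewrite /= E EFinN.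
- move=> v v0; transitivity (\int[mu]_(t in D) (- (expR (- (v * t)) * (m t - h t))%:E))%E.
    by apply: eq_integral => t _; rewrite E EFinN.
  rewrite integralN ?g0 ?oppe0//.
  exact: (integrable_add_def _ (ig v v0)).
move=> t /andP[tt tr].
have ht : `|t0 - t| < r by rewrite ltr_norml; lra.
have := hr t ht; rewrite /= ltr_norml => /andP[].
by have := mm t t0 (ltW (le_lt_trans a0 tt)) (ltW tr); rewrite /e; lra.
Qed.

Lemma laplace_continuous_eq0 (g : R -> R) (t0 : R) :
  (forall v : R, 0 < v ->
    mu.-integrable D (EFin \o (fun t : R => expR (- (v * t)) * g t))) ->
  (forall v : R, 0 < v -> (\int[mu]_(t in D) (expR (- (v * t)) * g t)%:E = 0)%E) ->
  0 < t0 -> {for t0, continuous g} -> g t0 = 0.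
Proof.
move=> ig g0 t00 cg.
have E (v t : R) : expR (- (v * t)) * (0 - - g t) = expR (- (v * t)) * g t.
  by rewrite sub0r opprK.
apply/eqP; rewrite -oppr_eq0 eq_sym; apply/eqP.
apply: (@laplace_monotone_eq (fun=> 0) (fun t => - g t)) => //.
- by move=> v v0; have := ig v v0; apply: eq_integrable => // t _; rewrite /= E.
- by move=> v v0; rewrite -[RHS](g0 v v0); apply: eq_integral => t _; rewrite E.
- exact: continuousN.
Qed.

End laplace_unique.

(** * The inverse subordinator *)

Section density.
Context d (T : measurableType d) (R : realType).
Variables (mu m : {measure set T -> \bar R}) (h : T -> R).
Hypotheses (mh : measurable_fun setT h) (h0 : forall x, 0 <= h x).
Hypothesis mE : forall A, measurable A -> m A = (\int[mu]_(x in A) (h x)%:E)%E.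
Import HBNNSimple.

Let integral_density_nnsfun (f : {nnsfun T >-> R}) :
  (\int[m]_x (f x)%:E = \int[mu]_x ((f x)%:E * (h x)%:E))%E.
Proof.
under [LHS]eq_integral do rewrite fimfunE -fsumEFin//.
rewrite [LHS]ge0_integral_fsum//; last 2 first.
  - by move=> r; exact/measurable_EFinP/measurableT_comp.
  - by move=> n x _; rewrite EFinM nnfun_muleindic_ge0.
under [RHS]eq_integral.
  move=> x xD; rewrite fimfunE -fsumEFin// muleC ge0_mule_fsumr; last first.
    by move=> r; rewrite EFinM nnfun_muleindic_ge0.
  over.
rewrite [RHS]ge0_integral_fsum//; last 2 first.
  - move=> r; apply: emeasurable_funM; first exact/measurable_EFinP.
    exact/measurable_EFinP/measurableT_comp.
  - move=> n x _; rewrite EFinM mule_ge0//; first by rewrite lee_fin.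
    by rewrite nnfun_muleindic_ge0.
apply: eq_fsbigr => r _; rewrite integralZl_indic_nnsfun// integral_indic// setIT.
rewrite mE; last exact: measurable_sfunP.
have [r0|r0] := ltP r 0.
  rewrite preimage_nnfun0//; rewrite integral_set0 mule0.
  under eq_integral do rewrite indic0 mulr0 mule0.
  by rewrite integral0.
have mfr : measurable (f @^-1` [set r]) by exact: measurable_sfunP.
rewrite integral_mkcond -ge0_integralZl//; last 2 first.
  - by apply/measurable_restrict => //; apply: measurable_funTS; exact/measurable_EFinP.
  - by move=> x _; apply: erestrict_ge0 => y _; rewrite lee_fin.
apply: eq_integral => x _; rewrite patchE indicE.
by case: ifPn => _; rewrite ?mulr1 ?mulr0 ?mule0// muleC.
Qed.

(** True for simple functions, then extended by monotone convergence on both sides. It serves to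
    integrate against the exponential law, which is given by its density. *)
Lemma ge0_integral_density (f : T -> \bar R) :
  measurable_fun setT f -> (forall x, 0 <= f x)%E ->
  (\int[m]_x f x = \int[mu]_x (f x * (h x)%:E))%E.
Proof.
move=> mf f0.
pose f_ := nnsfun_approx measurableT mf.
transitivity (lim (\int[m]_x (f_ n x)%:E @[n --> \oo])%E).
  rewrite -monotone_convergence//=.
  - apply: eq_integral => x _; apply/esym/cvg_lim => //=.
    exact: cvg_nnsfun_approx.
  - by move=> n; exact/measurable_EFinP/measurable_funTS.
  - by move=> n x _; rewrite lee_fin.
  - by move=> x _ a b mn; rewrite lee_fin; exact/lefP/nd_nnsfun_approx.
transitivity (lim (\int[mu]_x ((f_ n x)%:E * (h x)%:E) @[n --> \oo])%E).
  by apply: congr_lim; apply/funext => n; exact: integral_density_nnsfun.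
rewrite -monotone_convergence//=.
- apply: eq_integral => x _; apply/cvg_lim => //=.
  by apply: cvgeZr => //; exact: cvg_nnsfun_approx.
- move=> n; apply: emeasurable_funM; last exact/measurable_EFinP.
  exact/measurable_EFinP/measurable_funTS.
- by move=> n x _; rewrite mule_ge0// lee_fin.
- move=> x _ a b mn; rewrite lee_wpmul2r ?lee_fin//.
  exact/lefP/nd_nnsfun_approx.
Qed.

End density.

Definition exp_law (R : realType) (v : R) (v0 : 0 < v) : probability (measurableTypeR R) R.
Proof. pose E : probability _ R := exponential_prob v; exact: (E v0). Defined.

Lemma ge0_integral_exp_law (R : realType) (v : R) (v0 : 0 < v) (f : R -> \bar R) :
  measurable_fun setT f -> (forall x, 0 <= f x)%E ->
  (\int[exp_law v0]_x f x =
   v%:E * \int[lebesgue_measure]_(x in `[0%R, +oo[) ((expR (- (v * x)))%:E * f x))%E.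
Proof.
move=> mf f0.
rewrite (@ge0_integral_density _ _ _ lebesgue_measure _ (exponential_pdf v))//; last 2 first.
  - exact: measurable_exponential_pdf.
  - by move=> x; rewrite exponential_pdf_ge0// ltW.
rewrite -ge0_integralZl//; last 3 first.
  - apply: emeasurable_funM; last exact: measurable_funTS.
    by apply/measurable_EFinP; exact: measurable_expRN.
  - by move=> x _; rewrite mule_ge0// lee_fin expR_ge0.
  - by rewrite lee_fin ltW.
rewrite [RHS]integral_mkcond; apply: eq_integral => x _.
rewrite patchE /exponential_pdf patchE; case: ifPn => _; last by rewrite mule0.
by rewrite muleC EFinM mulNr muleA.
Qed.

(** The boolean selects the closed or the open half-line. That both have the same mass is what
    closes the sandwich in [inverse_subordinator_tail]. *)
Lemma exp_law_itvoy (R : realType) (v : R) (v0 : 0 < v) (b : bool) (x : R) : 0 <= x ->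
  exp_law v0 [set` Interval (BSide b x) +oo%O] = (expR (- (v * x)))%:E.
Proof.
move=> x0.
have E : exp_law v0 `[x, +oo[%classic = (expR (- (v * x)))%:E.
  transitivity (\int[lebesgue_measure]_(t in `[x, +oo[) (v * expR (- (v * t)))%:E)%E.
    apply: eq_integral => t; rewrite inE/= in_itv/= andbT => xt.
    by rewrite exponential_pdfE ?(le_trans x0)// mulNr.
  have dF (t : R) : is_derive t 1 (fun t => - expR (- (v * t))) (v * expR (- (v * t))).
    have h : is_derive t 1 (fun t : R => - v * t) (- v *: 1).
      exact: (is_deriveZ (- v) (is_derive_id (t : R^o) 1)).
    have h1 := @is_derive1_comp R expR (fun t => - v * t) t _ _ (is_derive_expR _) h.
    rewrite (_ : (fun _ => _) = (fun t : R => - expR (- v * t))); last first.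
      by apply/funext => u; rewrite mulNr.
    apply: (is_derive_eq (is_deriveN h1)).
    by rewrite /GRing.scale/= mulr1 mulrN opprK mulrC mulNr.
  have cF : continuous (fun t : R => - expR (- (v * t))).
    by move=> t; apply: cvgN; exact: continuous_expRN.
  rewrite (@ge0_continuous_FTC2y R _ (fun t => - expR (- (v * t))) x 0).
  - by rewrite sub0e -EFinN opprK.
  - by move=> t _; rewrite mulr_ge0 ?expR_ge0// ltW.
  - apply: continuous_subspaceT => t.
    by apply: cvgMl_tmp; exact: continuous_expRN.
  - rewrite -[X in _ --> X]oppr0; apply: cvgN.
    have hw : (v * t) @[t --> +oo] --> +oo by apply: gt0_cvgMry => //; exact: cvg_id.
    exact: (cvg_comp _ _ hw (@cvgr_expR R)).
  - by move=> t _; have [] := dF t.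
  - exact/cvg_at_right_filter/cF.
  - by move=> t _; rewrite derive1E; have [_ ->] := dF t.
case: b; first exact: E.
rewrite -E /=; apply: integral_itv_obnd_cbnd.
by apply/measurable_EFinP; apply: measurable_funTS; exact: measurable_exponential_pdf.
Qed.

Section inverse_subordinator_path.
Variables (R : realType) (T : Type) (sigma : R -> T -> R).
Hypothesis smono : forall w s t, 0 <= s -> s <= t -> sigma s w <= sigma t w.
Local Notation L := (inverse_subordinator sigma).

Lemma inverse_subordinator_ge0 t w : 0 <= L t w.
Proof.
rewrite /inverse_subordinator; set A := [set s | _].
have [->|A0] := eqVneq A set0; first by rewrite inf0.
by apply: lb_le_inf; [exact/set0P|move=> s []].
Qed.

Lemma inverse_subordinator_le t w s : 0 <= s -> t < sigma s w -> L t w <= s.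
Proof.
by move=> s0 ts; apply: ge_inf; [exists 0 => u []|split].
Qed.

(* If [sigma] never exceeds [t], then [L t w = inf set0 = 0]; this is the second
   case. *)
Lemma inverse_subordinatorltP t w s : 0 < s ->
  L t w < s <->
  (exists q : rat, Num.max 0 (ratr q) < s /\ t < sigma (Num.max 0 (ratr q)) w) \/
  (forall n : nat, sigma n%:R w <= t).
Proof.
move=> s0; split.
  rewrite /inverse_subordinator; set A := [set s | _] => Ls.
  have [A0|/set0P A0] := eqVneq A set0.
    right => n; rewrite leNgt; apply/negP => h.
    by have : A n%:R by []; rewrite A0.
  left; have [u [u0 tu] us] := inf_lt A0 Ls.
  have [q] := rat_in_itvoo us; rewrite in_itv/= => /andP[uq qs].
  have q0 : 0 <= (ratr q : R) by rewrite (le_trans u0)// ltW.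
  exists q; rewrite max_r//; split=> //.
  by apply: lt_le_trans tu _; apply: smono => //; exact: ltW.
move=> [[q [qs tq]]|h].
  apply: le_lt_trans qs; apply: inverse_subordinator_le => //.
  by rewrite le_max lexx.
rewrite /inverse_subordinator; set A := [set s | _].
suff -> : A = set0 by rewrite inf0.
rewrite -subset0 => u [u0 tu].
have := h (Num.trunc u).+1; rewrite leNgt => /negP; apply.
by apply: lt_le_trans tu _; apply: smono => //; exact/ltW/truncnS_gt.
Qed.

Lemma sigma_le_inverse_subordinator t w s : 0 <= s -> s < L t w -> sigma s w <= t.
Proof.
move=> s0; apply: contraTle => ts; rewrite -leNgt.
exact: inverse_subordinator_le.
Qed.

(** By right-continuity [sigma] stays below [t] slightly beyond [s], and by monotonicity it exceeds
    [t] only after that. Some time of exceedance must exist, since otherwise [L t w] is the infimum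
    of the empty set, which is 0. *)
Lemma lt_inverse_subordinator t w s : 0 <= s ->
  sigma u w @[u --> s^'+] --> sigma s w ->
  (exists n : nat, t < sigma n%:R w) -> sigma s w < t -> s < L t w.
Proof.
move=> s0 rc [n tn] st.
have e0 : 0 < t - sigma s w by rewrite subr_gt0.
move/cvgrPdist_lt : rc => /(_ _ e0)[r /= r0 hr].
apply: (@lt_le_trans _ _ (s + r / 2)); first by rewrite ltrDl divr_gt0.
apply: lb_le_inf; first by exists n%:R; split.
move=> u [u0 tu]; rewrite leNgt; apply/negP => us.
have h : sigma (s + r / 2) w < t.
  have := hr (s + r / 2) => /=.
  rewrite opprD addrA subrr sub0r normrN gtr0_norm ?divr_gt0// => /(_ _ _).
  have r2 : r / 2 < r by lra.
  have sr : s < s + r / 2 by lra.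
  by move=> /(_ r2 sr); rewrite ltr_norml => /andP[]; lra.
have := lt_trans tu (le_lt_trans (smono _ u0 (ltW us)) h).
by rewrite ltxx.
Qed.

End inverse_subordinator_path.

Definition image_measure d1 d2 (T1 : measurableType d1) (T2 : measurableType d2)
  (R : realType) (m : {measure set T1 -> \bar R}) (f : T1 -> T2)
  (mf : measurable_fun setT f) : {measure set T2 -> \bar R}.
Proof.
pose E : {measure set T2 -> \bar R} := pushforward m f.
exact: (E mf).
Defined.

Section inverse_subordinator_law.
Context (R : realType) (d : measure_display) (T : measurableType d)
  (P : probability T R) (nu : R) (sigma : R -> T -> R).
Hypotheses (hsigma : stable_subordinator P nu sigma).
Local Notation L := (inverse_subordinator sigma).
Local Notation mu := (@lebesgue_measure R).

Let msigma s : 0 <= s -> measurable_fun setT (sigma s).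
Proof.
by move=> s0 _ B mB; rewrite setTI; case: hsigma => h _; exact: h.
Qed.

Let smono w s t : 0 <= s -> s <= t -> sigma s w <= sigma t w.
Proof. by case: hsigma => _ [_ h _ _]; exact: h. Qed.

Let sright w t : 0 <= t -> sigma s w @[s --> t^'+] --> sigma t w.
Proof. by case: hsigma => _ [_ _ h _]; exact: h. Qed.

Let sge0 w t : 0 <= t -> 0 <= sigma t w.
Proof.
by move=> t0; case: hsigma => _ [h _ _ _]; rewrite -(h w); exact: smono.
Qed.

Let slaplace v t : 0 < v -> 0 <= t ->
  (\int[P]_w (expR (- (v * sigma t w)))%:E = (expR (- (t * v `^ nu)))%:E)%E.
Proof.
move=> v0 t0; case: hsigma => _ [_ _ _ [_ _ h]].
by rewrite -h// unlock.
Qed.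

(** Joint measurability in time and sample point, for Fubini. Events [L < s] are countable
    combinations of events on single values of [sigma]; [Num.max 0] keeps the times away from the
    negative ones, where [sigma] is unconstrained. *)
Lemma measurable_inverse_subordinator2 :
  measurable_fun [set: measurableTypeR R * T] (fun z => L z.1 z.2).
Proof.
apply: (measurability _ (RGenCInfty.measurableE R)) => _ [_ [s ->] <-].
rewrite setTI.
have [s0|s0] := leP s 0.
  rewrite (_ : _ @^-1` _ = setT)//; apply/seteqP; split=> // z _ /=.
  by rewrite in_itv/= andbT (le_trans s0)// inverse_subordinator_ge0.
have sE n : measurable_fun [set: measurableTypeR R * T] (fun z => sigma (Num.max 0 n) z.2).
  by apply: measurableT_comp; [apply: msigma; rewrite le_max lexx|exact: measurable_snd].
rewrite [X in measurable X](_ : _ = ~` (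
   (\bigcup_(q : rat) [set z : measurableTypeR R * T |
      Num.max 0 (ratr q) < s /\ z.1 < sigma (Num.max 0 (ratr q)) z.2]) `|`
   \bigcap_(n : nat) [set z : measurableTypeR R * T | sigma (Num.max 0 n%:R) z.2 <= z.1])).
  apply: measurableC; apply: measurableU.
    apply: bigcupT_measurable_rat => q.
    have [qs|qs] := ltP (Num.max 0 (ratr q)) s; last first.
      by rewrite (_ : [set _ | _] = set0)//; apply/seteqP; split=> // z [].
    rewrite (_ : [set _ | _] = (fun z : measurableTypeR R * T =>
       z.1 < sigma (Num.max 0 (ratr q)) z.2) @^-1` [set true]).
      rewrite -[X in measurable X]setTI; apply: measurable_fun_ltr => //.
    by apply/seteqP; split=> z /=; [move=> []|move=> ?; split].
  apply: bigcapT_measurable => n.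
  rewrite (_ : [set _ | _] = (fun z : measurableTypeR R * T =>
       sigma (Num.max 0 n%:R) z.2 <= z.1) @^-1` [set true])//.
  by rewrite -[X in measurable X]setTI; apply: measurable_fun_ler.
apply/seteqP; split=> z /=.
  rewrite in_itv/= andbT leNgt => /negP sL h; apply: sL.
  apply/inverse_subordinatorltP => //; case: h => [[q _ h]|h]; [left|right].
    by exists q.
  by move=> n; have := h n I; rewrite max_r.
move=> h; rewrite in_itv/= andbT leNgt; apply/negP => Ls; apply: h.
move/(inverse_subordinatorltP smono) : Ls => /(_ s0)[[q [h1 h2]]|h]; [left|right].
  by exists q.
by move=> n _ /=; rewrite max_r.
Qed.

Lemma measurable_inverse_subordinator t : measurable_fun setT (L t).
Proof.
have -> : L t = (fun z => L z.1 z.2) \o (fun w => (t, w)) by [].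
apply: measurableT_comp; first exact: measurable_inverse_subordinator2.
exact: measurable_fun_pair.
Qed.

(** Chernoff bound: on the event, [exp (v * t - v * sigma s)] is at least 1. The rate [v] is free
    and is tuned at each use. *)
Lemma sigma_tail v s t : 0 < v -> 0 <= s ->
  (P [set w | (sigma s w <= t)%R] <= (expR (v * t - s * v `^ nu))%:E)%E.
Proof.
move=> v0 s0.
have mA : measurable [set w | (sigma s w <= t)%R].
  rewrite (_ : [set _ | _] = sigma s @^-1` `]-oo, t]).
    by rewrite -[X in measurable X]setTI; apply: msigma.
  by apply/seteqP; split=> w /=; rewrite in_itv.
have mX : measurable_fun setT (fun w => (expR (- (v * sigma s w)))%:E).
  apply/measurable_EFinP; apply: measurableT_comp => //.
  apply: measurableT_comp => //; apply: measurable_funM => //; exact: msigma.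
rewrite expRD EFinM -slaplace//.
rewrite -(setIT [set w | _]) -integral_indic// -ge0_integralZl//.
apply: ge0_le_integral => //.
- by apply/measurable_EFinP; exact: measurable_indic.
- exact: emeasurable_funM.
move=> w _; rewrite -EFinM -expRD indicE lee_fin; case: (boolP (w \in _)) => h.
  rewrite -[leLHS]expR0 ler_expR -mulrBr mulr_ge0 ?(ltW v0)// subr_ge0.
  by move: h; rewrite inE.
exact: expR_ge0.
Qed.

Lemma measurable_sigma_le s t : 0 <= s -> measurable [set w | sigma s w <= t].
Proof.
move=> s0; rewrite (_ : [set _ | _] = sigma s @^-1` `]-oo, t]).
  by rewrite -[X in measurable X]setTI; apply: msigma.
by apply/seteqP; split=> w /=; rewrite in_itv.
Qed.

Lemma measurable_sigma_bounded t : measurable [set w | forall n : nat, sigma n%:R w <= t].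
Proof.
rewrite (_ : [set _ | _] = \bigcap_n [set w | sigma n%:R w <= t]).
  by apply: bigcapT_measurable => n; exact: measurable_sigma_le.
by apply/seteqP; split=> w /=; [move=> h n _; exact: h|move=> h n; exact: h].
Qed.

(** The Chernoff bound with [v = 1] at time [n] is [exp t * exp (- n)], which tends to 0. On this
    event [L t] takes the default value 0. *)
Lemma sigma_bounded_null t :
  P [set w | forall n : nat, (sigma n%:R w <= t)%R] = 0%E.
Proof.
have mA := measurable_sigma_bounded t.
have mS n : measurable [set w | sigma n%:R w <= t] by exact: measurable_sigma_le.
set A := [set w | _] in mA *.
have h n : (P A <= (expR t * expR (- n%:R))%:E)%E.
  apply: (@le_trans _ _ (P [set w | sigma n%:R w <= t])).
    by apply: le_measure; rewrite ?inE// => w /=; exact.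
  by have := @sigma_tail 1 n%:R t ltr01 (ler0n _ _); rewrite powR1 mul1r mulr1 expRD.
have PA : P A \is a fin_num by exact: fin_num_measure.
rewrite -(fineK PA); congr EFin; apply/eqP; rewrite eq_le fine_ge0// andbT.
have hc : (expR t * expR (- n%:R)) @[n --> \oo] --> expR t * 0.
  by apply: cvgMl_tmp; exact: cvgn_expR.
rewrite -(mulr0 (expR t)) -(cvg_lim _ hc)//; apply: limr_ge.
  by apply/cvg_ex; exists (expR t * 0).
by apply: nearW => n; rewrite -lee_fin fineK.
Qed.

Let measurable_sigma2 s : 0 <= s ->
  measurable_fun [set: measurableTypeR R * T] (fun z => sigma s z.2).
Proof. by move=> s0; apply: measurableT_comp; [exact: msigma|exact: measurable_snd]. Qed.

(** The weak ([b = true]) and the strict version enclose the event [s < L] up to null sets. *)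
Let epigraph (b : bool) s :=
  [set z : measurableTypeR R * T | z.1 \in Interval (BSide b (sigma s z.2)) +oo%O].

Let measurable_epigraph b s : 0 <= s -> measurable (epigraph b s).
Proof.
move=> s0.
rewrite (_ : epigraph b s = (fun z : measurableTypeR R * T =>
    if b then sigma s z.2 <= z.1 else sigma s z.2 < z.1) @^-1` [set true]).
  rewrite -[X in measurable X]setTI; case: b.
    by apply: measurable_fun_ler => //; exact: measurable_sigma2.
  by apply: measurable_fun_ltr => //; exact: measurable_sigma2.
by apply/seteqP; split=> z; rewrite /epigraph /= in_itv/= andbT; case: b.
Qed.

(** Given [sigma s], an exponential time of rate [v] exceeds it with probability
    [exp (- (v * sigma s))], whose expectation is the Laplace transform of the subordinator. *)
Let prod_sigma (b : bool) v (v0 : 0 < v) s : 0 <= s ->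
  (exp_law v0 \x P)%E (epigraph b s) = (expR (- (s * v `^ nu)))%:E.
Proof.
move=> s0; have mB := measurable_epigraph b s0; set B := epigraph b s in mB *.
have f0 : forall z, (0 <= (\1_B z)%:E :> \bar R)%E by move=> z; rewrite lee_fin.
have mf : measurable_fun setT (fun z => (\1_B z)%:E : \bar R).
  by apply/measurable_EFinP; exact: measurable_indic.
rewrite -(setIT B) -integral_indic// fubini_tonelli2// -slaplace//.
apply: eq_integral => w _.
rewrite -(exp_law_itvoy v0 b (sge0 w s0)) /fubini_G.
set C := [set` _].
have mC : measurable (C : set (measurableTypeR R)) by exact: measurable_itv.
rewrite -(setIT C) -integral_indic//.
Qed.

(** The event lies in the weak epigraph and contains the strict one up to a [P]-null set that
    depends on the time; the lower bound is therefore made section by section. *)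
Lemma inverse_subordinator_tail v (v0 : 0 < v) s : 0 <= s ->
  (exp_law v0 \x P)%E [set z : measurableTypeR R * T | s < L z.1 z.2] =
  (expR (- (s * v `^ nu)))%:E.
Proof.
move=> s0; set A := [set z | _].
have mA : measurable A.
  rewrite (_ : A = (fun z : measurableTypeR R * T => s < L z.1 z.2) @^-1` [set true])//.
  rewrite -[X in measurable X]setTI; apply: measurable_fun_ltr => //.
  exact: measurable_inverse_subordinator2.
apply/eqP; rewrite eq_le; apply/andP; split.
  rewrite -(prod_sigma true v0 s0); apply: le_measure; rewrite ?inE//.
    exact: measurable_epigraph.
  by move=> z /= /(sigma_le_inverse_subordinator s0) h; rewrite /epigraph/= in_itv/= andbT.
rewrite -(prod_sigma false v0 s0); apply: ge0_le_integral => //.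
- by apply: measurable_fun_xsection; exact: measurable_epigraph.
- exact: measurable_fun_xsection.
move=> t _ /=.
pose N := [set w | forall n : nat, sigma n%:R w <= t].
have mN : measurable N by exact: measurable_sigma_bounded.
have mAt : measurable (xsection A t) by exact: measurable_xsection.
apply: (@le_trans _ _ (P (xsection A t `|` N))).
  apply: le_measure; rewrite ?inE//.
  - by apply: measurable_xsection; exact: measurable_epigraph.
  - exact: measurableU.
  move=> w; rewrite /xsection/= !inE /epigraph /= in_itv/= andbT => st.
  have [h|h] := pselect (N w); [by right|left].
  apply: lt_inverse_subordinator => //; first exact: sright.
  by move/existsNP : h => [n /negP]; rewrite -ltNge => h; exists n.
rewrite -[leRHS]adde0 -(sigma_bounded_null t); exact: measureU2.
Qed.

(** The tails of [L] at an exponential time are those of the exponential law with rate [v^nu], and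
    open half-lines form a generating pi-system. *)
Lemma inverse_subordinator_exp v (v0 : 0 < v) (w0 : 0 < v `^ nu) (f : R -> \bar R) :
  measurable_fun setT f -> (forall x, 0 <= f x)%E ->
  (\int[exp_law v0]_t (\int[P]_w f (L t w)) = \int[exp_law w0]_u f u)%E.
Proof.
move=> mf f0.
have mL := measurable_inverse_subordinator2.
transitivity (\int[exp_law v0 \x P]_z f (L z.1 z.2))%E.
  rewrite (@fubini_tonelli1 _ _ (measurableTypeR R) T R (exp_law v0) P (fun z => f (L z.1 z.2)))//.
  exact: measurableT_comp.
pose m := @image_measure _ _ _ (measurableTypeR R) R (exp_law v0 \x P)%E _ mL.
transitivity (\int[m]_u f u)%E.
  by rewrite (@ge0_integral_pushforward _ _ _ (measurableTypeR R) _ _ mL).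
apply: eq_measure_integral => A mA _.
apply: (@measure_unique _ R (measurableTypeR R) (@RGenOInfty.G R)
  (fun k : nat => `](- k%:R)%R, +oo[%classic) _ _ _ _ m (exp_law w0)) => //.
- exact: RGenOInfty.measurableE.
- move=> _ _ [x ->] [y ->]; exists (Num.max x y).
  by apply/seteqP; split=> t; rewrite /= !in_itv/= !andbT gt_max; [case=> -> ->|case/andP].
- by move=> k; exists (- k%:R).
- apply/seteqP; split=> // x _; exists (Num.trunc `|x|).+1 => //=.
  rewrite in_itv/= andbT ltrNl; apply: le_lt_trans (truncnS_gt _).
  by rewrite -normrN ler_norm.
- move=> _ [x ->]; have [x0|x0] := leP 0 x.
    transitivity ((expR (- (x * v `^ nu)))%:E).
      rewrite /m /= /pushforward (_ : _ @^-1` _ = [set z | x < L z.1 z.2]).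
        exact: inverse_subordinator_tail.
      by apply/seteqP; split=> z /=; rewrite in_itv/= andbT.
    by rewrite mulrC; apply/esym; exact: exp_law_itvoy.
  transitivity (1%E : \bar R).
    rewrite /m /= /pushforward (_ : _ @^-1` _ = setT) ?probability_setT//.
    apply/seteqP; split=> z //= _; rewrite in_itv/= andbT (lt_le_trans x0)//.
    exact: inverse_subordinator_ge0.
  apply/esym/eqP; rewrite eq_le probability_le1//=.
  have <- : exp_law w0 `[0%R, +oo[%classic = 1%E.
    by apply: etrans (exp_law_itvoy w0 true (lexx 0)) _; rewrite mulr0 oppr0 expR0.
  apply: le_measure; rewrite ?inE//.
  by move=> t /=; rewrite !in_itv/= !andbT; exact: lt_le_trans.
- move=> k; rewrite /m /= /pushforward; apply: le_lt_trans (ltry 1%R).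
  apply: probability_le1 => //.
  rewrite -[X in measurable X]setTI.
  by apply: measurable_inverse_subordinator2 => //; exact: measurable_itv.
Qed.

Lemma measurable_expectation_inverse_subordinator (f : R -> \bar R) :
  measurable_fun setT f -> (forall x, 0 <= f x)%E ->
  measurable_fun setT (fun t => \int[P]_w f (L t w))%E.
Proof.
move=> mf f0.
apply: (@measurable_fun_fubini_tonelli_F _ _ (measurableTypeR R) T R P
  (fun z => f (L z.1 z.2))) => //.
by apply: measurableT_comp => //; exact: measurable_inverse_subordinator2.
Qed.

(* [L] maps an independent exponential time with rate [v] to an exponential time
   with rate [v `^ nu]; the factor [v `^ (nu - 1)] is the quotient of the rates. *)
Lemma laplace_inverse_subordinator v (f : R -> \bar R) : 0 < v ->
  measurable_fun setT f -> (forall x, 0 <= f x)%E ->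
  (\int[mu]_(t in `[0%R, +oo[) ((expR (- (v * t)))%:E * \int[P]_w f (L t w)) =
   (v `^ (nu - 1))%:E *
     \int[mu]_(u in `[0%R, +oo[) ((expR (- (v `^ nu * u)))%:E * f u))%E.
Proof.
move=> v0 mf f0; have w0 : 0 < v `^ nu by exact: powR_gt0.
have := inverse_subordinator_exp v0 w0 mf f0.
rewrite !ge0_integral_exp_law//.
  move=> /(congr1 (fun x => v^-1%:E * x)%E).
  rewrite !muleA -!EFinM mulVf ?gt_eqF// mul1e => ->.
  congr (_%:E * _)%E; rewrite mulrC -powR_inv1 ?ltW// -powRD ?(gt_eqF v0) ?implybT//.
- exact: measurable_expectation_inverse_subordinator.
- by move=> t; apply: integral_ge0 => w _.
Qed.

End inverse_subordinator_law.

Lemma ge0_fin_integrable (d : measure_display) (T : measurableType d) (R : realType)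
    (mu : {measure set T -> \bar R}) (D : set T) (f : T -> R) (r : R) :
  measurable D -> measurable_fun D f -> (forall x, D x -> 0 <= f x) ->
  (\int[mu]_(x in D) (f x)%:E = r%:E)%E -> mu.-integrable D (EFin \o f).
Proof.
move=> mD mf f0 fr; apply/integrableP; split; first exact/measurable_EFinP.
rewrite (_ : integral _ _ _ = r%:E) ?ltry// -fr; apply: eq_integral => x.
by rewrite inE => Dx; rewrite /= ger0_norm// f0.
Qed.

(** * Moments of the inverse subordinator *)

Section inverse_subordinator_moments.
Context (R : realType) (d : measure_display) (T : measurableType d)
  (P : probability T R) (nu : R) (sigma : R -> T -> R).
Hypotheses (nu0 : 0 < nu) (hsigma : stable_subordinator P nu sigma).
Local Notation L := (inverse_subordinator sigma).
Local Notation mu := (@lebesgue_measure R).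
Local Notation EL f t := (\int[P]_w f (L t w))%E.

Let smono w s t : 0 <= s -> s <= t -> sigma s w <= sigma t w.
Proof. by case: hsigma => _ [_ h _ _]; exact: h. Qed.

Let measurable_EL f : measurable_fun setT f -> (forall x : R, 0 <= f x)%E ->
  measurable_fun setT (fun t => EL f t).
Proof. exact: (measurable_expectation_inverse_subordinator hsigma). Qed.

Let measurable_L t : measurable_fun setT (L t).
Proof. exact: (measurable_inverse_subordinator hsigma). Qed.

(** If [sigma] never exceeded [t], then [L t w] would be 0 while [L s w] could be positive; the
    second hypothesis excludes this and fails only on a null event. *)
Lemma inverse_subordinator_nondecreasing w s t : s <= t ->
  (exists n : nat, t < sigma n%:R w) -> L s w <= L t w.
Proof.
move=> st [n tn]; apply: lb_le_inf; first by exists n%:R; split.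
move=> u [u0 tu]; apply: inverse_subordinator_le => //.
exact: le_lt_trans tu.
Qed.

Lemma expectation_inverse_subordinator_le (f : R -> \bar R) s t :
  measurable_fun setT f -> (forall x, 0 <= f x)%E ->
  (forall x y, 0 <= x -> x <= y -> (f x <= f y)%E) -> s <= t ->
  (EL f s <= EL f t)%E.
Proof.
move=> mf f0 fm st; apply: ae_ge0_le_integral => //.
- by apply: measurableT_comp.
- by apply: measurableT_comp.
exists [set w | forall n : nat, sigma n%:R w <= t]; split.
- exact: (measurable_sigma_bounded hsigma).
- exact: (sigma_bounded_null hsigma).
move=> w /= h n; rewrite leNgt; apply/negP => tn; apply: h => _.
apply: fm; first exact: inverse_subordinator_ge0.
by apply: inverse_subordinator_nondecreasing => //; exists n.
Qed.

(** [EL f] is nondecreasing, so the part of its Laplace integral over [[t, t + 1]] is already large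
    enough. Finiteness of the transform at one rate thus gives finiteness at every time, not only
    almost everywhere. *)
Lemma expectation_inverse_subordinator_bound (f : R -> \bar R) v t :
  measurable_fun setT f -> (forall x, 0 <= f x)%E ->
  (forall x y, 0 <= x -> x <= y -> (f x <= f y)%E) -> 0 < v -> 0 <= t ->
  ((expR (- (v * (t + 1))))%:E * EL f t <=
   \int[mu]_(s in `[0%R, +oo[) ((expR (- (v * s)))%:E * EL f s))%E.
Proof.
move=> mf f0 fm v0 t0.
have E0 s : (0 <= EL f s)%E by apply: integral_ge0.
have mE D : measurable_fun D (fun s => (expR (- (v * s)))%:E * EL f s)%E.
  apply: emeasurable_funM; last by apply: measurable_funTS; exact: measurable_EL.
  by apply/measurable_EFinP; exact: measurable_expRN.
apply: (@le_trans _ _ (\int[mu]_(s in `[t, (t + 1)%R]) ((expR (- (v * s)))%:E * EL f s))%E); last first.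
  apply: ge0_subset_integral => //.
  - exact: mE.
  - by move=> s _; rewrite mule_ge0// lee_fin expR_ge0.
  - by move=> s /=; rewrite !in_itv/= andbT => /andP[ts _]; exact: le_trans ts.
apply: (@le_trans _ _ (\int[mu]_(s in `[t, (t + 1)%R]) cst ((expR (- (v * (t + 1))))%:E * EL f t) s)%E).
  have h1 : lebesgue_measure (`[t, (t + 1)%R]%classic : set R) = 1%E.
    by rewrite lebesgue_measure_itv/= lte_fin ltrDl ltr01 -EFinB addrAC subrr add0r.
  rewrite integral_cst//= [X in (_ <= _ * X)%E](_ : _ = 1%E) ?mule1//.
apply: ge0_le_integral => //.
- by move=> s _; rewrite mule_ge0// lee_fin expR_ge0.
- exact: mE.
move=> s /=; rewrite in_itv/= => /andP[ts st].
apply: lee_pmul => //; first by rewrite lee_fin ler_expR lerN2 ler_pM2l.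
exact: expectation_inverse_subordinator_le.
Qed.

Lemma expectation_expR_inverse_subordinator_lty c t : 0 < c -> 0 <= t ->
  (EL (fun u => (expR (c * u))%:E) t < +oo)%E.
Proof.
move=> c0 t0.
(* With [v^nu = 2 c] the operational integrand is [exp (- (c * u))], of integral [1 / c]. *)
pose v := (2 * c) `^ nu^-1.
have c20 : 0 < 2 * c by rewrite mulr_gt0.
have v0 : 0 < v by rewrite powR_gt0.
have vnu : v `^ nu = 2 * c by rewrite -powRrM mulVf ?gt_eqF// powRr1 ?ltW.
have mf : measurable_fun setT (fun u : R => (expR (c * u))%:E).
  by apply/measurable_EFinP; do 2 apply: measurableT_comp => //.
have f0 (u : R) : (0 <= (expR (c * u))%:E :> \bar R)%E by rewrite lee_fin expR_ge0.
have fm (x y : R) : 0 <= x -> x <= y -> ((expR (c * x))%:E <= (expR (c * y))%:E :> \bar R)%E.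
  by move=> _ xy; rewrite lee_fin ler_expR ler_pM2l.
have := expectation_inverse_subordinator_bound mf f0 fm v0 t0.
rewrite (laplace_inverse_subordinator hsigma v0 mf f0) vnu.
rewrite [X in (_ <= _ * X)%E](_ : _ = (c^-1)%:E); last first.
  have := @integral_expRN_exprn R 0 c c0; rewrite fact0 expr1 mul1r => <-.
  apply: eq_integral => u _; rewrite -EFinM -expRD expr0 mulr1; congr (expR _)%:E; ring.
rewrite -EFinM muleC -lee_pdivlMr ?expR_gt0// => h.
apply: le_lt_trans h _.
by rewrite -EFinM ltry.
Qed.

(** A path of [sigma] may vanish on an initial interval, but [P (L 0 > s) <= P (sigma s <= 0) <= exp
    (- (s * v^nu))] for every [v], and [v] may tend to infinity. *)
Lemma inverse_subordinator0_null : P [set w | (L 0 w != 0)%R] = 0%E.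
Proof.
have mS (n : nat) : measurable [set w | n.+1%:R^-1 < L 0 w].
  rewrite (_ : [set _ | _] = L 0 @^-1` `]n.+1%:R^-1, +oo[).
    by rewrite -[X in measurable X]setTI; apply: measurable_L.
  by apply/seteqP; split=> w /=; rewrite in_itv/= andbT.
have S0 (n : nat) : P [set w | n.+1%:R^-1 < L 0 w] = 0%E.
  set s : R := n.+1%:R^-1; have s0 : 0 < s by rewrite invr_gt0.
  apply/eqP; rewrite eq_le measure_ge0 andbT.
  have PA : P [set w | s < L 0 w] \is a fin_num by apply: fin_num_measure; exact: mS.
  rewrite -(fineK PA) lee_fin.
  have h m : fine (P [set w | s < L 0 w]) <= expR (- m%:R).
    pose v := (m.+1%:R / s) `^ nu^-1.
    have v0 : 0 < v by rewrite powR_gt0 ?divr_gt0.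
    have vnu : v `^ nu = m.+1%:R / s.
      by rewrite -powRrM mulVf ?gt_eqF// powRr1// divr_ge0// ltW.
    rewrite -lee_fin fineK//.
    apply: (@le_trans _ _ (P [set w | sigma s w <= 0])).
      apply: le_measure; rewrite ?inE//; first exact: mS.
        by apply: (measurable_sigma_le hsigma); exact: ltW.
      by move=> w /=; apply: sigma_le_inverse_subordinator => //; exact: ltW.
    apply: le_trans (sigma_tail hsigma 0 v0 (ltW s0)) _.
    by rewrite lee_fin ler_expR mulr0 sub0r lerN2 vnu mulrCA divff ?gt_eqF// mulr1 ler_nat.
  have : fine (P [set w | s < L 0 w]) <= limn (fun m : nat => expR (- m%:R) : R).
    apply: limr_ge; first by apply/cvg_ex; exists 0; exact: cvgn_expR.
    exact: nearW.
  by rewrite (cvg_lim _ (@cvgn_expR R)).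
rewrite (_ : [set _ | _] = \bigcup_n [set w | n.+1%:R^-1 < L 0 w]).
  apply/eqP; rewrite eq_le measure_ge0 andbT.
  apply: le_trans (measure_sigma_subadditive _ _ _ (@subset_refl _ _)) _ => //.
    exact: bigcupT_measurable.
  by rewrite eseries0// => n _ _; exact: S0.
apply/seteqP; split=> w /=.
  move=> L0; have {}L0 : 0 < L 0 w by rewrite lt_def L0 inverse_subordinator_ge0.
  exists (Num.trunc (L 0 w)^-1) => //=.
  by rewrite invf_plt ?posrE// truncnS_gt.
by move=> [n _ /= h]; rewrite gt_eqF// (lt_trans _ h)// invr_gt0.
Qed.

Lemma expectation_inverse_subordinator0 (f : R -> \bar R) :
  measurable_fun setT f -> (forall x, 0 <= f x)%E -> EL f 0 = f 0.
Proof.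
move=> mf f0; rewrite (@ge0_ae_eq_integral _ _ _ _ _ _ (cst (f 0)))//.
- by rewrite integral_cst//= probability_setT mule1.
- exact: measurableT_comp.
- by move=> w _; exact: f0.
exists [set w | L 0 w != 0]; split.
- rewrite (_ : [set _ | _] = ~` (L 0 @^-1` [set 0])).
    by apply: measurableC; rewrite -[X in measurable X]setTI; apply: measurable_L.
  by apply/seteqP; split=> w /= /eqP.
- exact: inverse_subordinator0_null.
by move=> w /= h; apply/eqP => L0; apply: h => _; rewrite L0.
Qed.

Let mX (m : nat) : measurable_fun setT (fun u : R => (`|u| ^+ m)%:E).
Proof.
apply/measurable_EFinP; apply: measurable_funX.
by apply: measurableT_comp => //; exact: normr_measurable.
Qed.

Let X0 (m : nat) (u : R) : (0 <= (`|u| ^+ m)%:E :> \bar R)%E.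
Proof. by rewrite lee_fin exprn_ge0. Qed.

Let mexp (c : R) : measurable_fun setT (fun u : R => (expR (c * u))%:E).
Proof. by apply/measurable_EFinP; do 2 apply: measurableT_comp => //. Qed.

Lemma exprn_le_expR (m : nat) (u : R) : 0 <= u -> u ^+ m <= m`!%:R * expR u.
Proof.
move=> u0; have f0 : (0:R) < m`!%:R by rewrite ltr0n fact_gt0.
rewrite -ler_pdivrMl// mulrC; case: m f0 => [|m] f0.
  by rewrite expr0 fact0 divr1 -[leLHS]expR0 ler_expR.
by apply: le_trans (expR_ge1Dxn m u0); rewrite lerDr.
Qed.

Lemma moment_inverse_subordinator_lty (m : nat) t : 0 <= t ->
  (EL (fun u => (`|u| ^+ m)%:E) t < +oo)%E.
Proof.
move=> t0.
apply: (@le_lt_trans _ _ (EL (fun u => (m`!%:R)%:E * (expR (1 * u))%:E) t)%E).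
  apply: ge0_le_integral => //.
  - exact: (measurableT_comp (mX m) (measurable_L t)).
  - apply: emeasurable_funM => //; exact: (measurableT_comp (mexp 1) (measurable_L t)).
  - move=> w _; have := inverse_subordinator_ge0 sigma t w => L0.
    by rewrite -EFinM lee_fin ger0_norm// mul1r exprn_le_expR.
rewrite ge0_integralZl//; last exact: (measurableT_comp (mexp 1) (measurable_L t)).
by rewrite lte_mul_pinfty ?lee_fin// expectation_expR_inverse_subordinator_lty.
Qed.

Lemma Gamma_ge0 (x : R) : 0 <= Gamma x.
Proof. by apply: Rintegral_ge0 => t _; rewrite mulr_ge0 ?powR_ge0 ?expR_ge0. Qed.

(** Both sides have the Laplace transform [n! Gamma (nu n + 1) / v^(nu n + 1)]; the left one is
    monotone in [t], the right one continuous. The Gamma factor stays on the left because it is not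
    yet known to be nonzero. *)
Lemma moment_inverse_subordinator_pos (n : nat) t : 0 < t ->
  ((Gamma (nu * n%:R + 1))%:E * EL (fun u => (`|u| ^+ n)%:E) t =
   (n`!%:R * t `^ (nu * n%:R))%:E)%E.
Proof.
move=> t0.
pose m s := fine (EL (fun u => (`|u| ^+ n)%:E) s).
have mE s : 0 <= s -> EL (fun u => (`|u| ^+ n)%:E) s = (m s)%:E.
  move=> s0; rewrite fineK// ge0_fin_numE ?moment_inverse_subordinator_lty//.
  exact: integral_ge0.
have m0 s : 0 <= m s by rewrite fine_ge0// integral_ge0.
have x0 : 0 <= nu * n%:R by rewrite mulr_ge0// ltW.
set G := Gamma _; have G0 : 0 <= G by exact: Gamma_ge0.
have mm : measurable_fun setT m.
  exact: (measurableT_comp (@fine_measurable R setT measurableT) (measurable_EL (mX n) (X0 n))).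
have I1 v : 0 < v ->
  (\int[mu]_(s in `[0%R, +oo[) (expR (- (v * s)) * m s)%:E = (n`!%:R / v `^ (nu * n%:R + 1))%:E)%E.
  move=> v0; transitivity (\int[mu]_(s in `[0%R, +oo[)
     ((expR (- (v * s)))%:E * EL (fun u => (`|u| ^+ n)%:E) s))%E.
    by apply: eq_integral => s; rewrite inE/= in_itv/= andbT => s0; rewrite mE.
  rewrite (laplace_inverse_subordinator hsigma v0 (mX n) (X0 n)).
  have w0 : 0 < v `^ nu by rewrite powR_gt0.
  rewrite [X in (_ * X)%E](_ : _ = (n`!%:R / (v `^ nu) ^+ n.+1)%:E); last first.
    rewrite -integral_expRN_exprn//; apply: eq_integral => u.
    by rewrite inE/= in_itv/= andbT => u0; rewrite -EFinM ger0_norm.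
  rewrite -EFinM; congr EFin; rewrite mulrCA; congr (_ * _).
  rewrite -powR_invn ?powR_ge0// -powRrM -powRN -powRD ?(gt_eqF v0) ?implybT//.
  by congr powR; rewrite -natr1; ring.
have I2 v : 0 < v ->
  (\int[mu]_(s in `[0%R, +oo[) (expR (- (v * s)) * s `^ (nu * n%:R))%:E =
   (G / v `^ (nu * n%:R + 1))%:E)%E.
  by move=> v0; rewrite laplace_powR.
have J1 v : 0 < v -> mu.-integrable `[0%R, +oo[
    (EFin \o (fun s => expR (- (v * s)) * m s)).
  move=> v0; apply: (@ge0_fin_integrable _ _ _ _ _ _ _ _ _ _ (I1 v v0)) => //.
    apply: measurable_funM; first exact: measurable_expRN.
    exact: measurable_funTS.
  by move=> s _; rewrite mulr_ge0// expR_ge0.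
have J2 v : 0 < v -> mu.-integrable `[0%R, +oo[
    (EFin \o (fun s => expR (- (v * s)) * s `^ (nu * n%:R))).
  move=> v0; apply: (@ge0_fin_integrable _ _ _ _ _ _ _ _ _ _ (I2 v v0)) => //.
    apply: measurable_funM; first exact: measurable_expRN.
    by apply: measurable_funTS; exact: measurable_powR.
  by move=> s _; rewrite mulr_ge0// ?expR_ge0 ?powR_ge0.
rewrite mE ?(ltW t0)// -EFinM; congr EFin.
have E (v s : R) : expR (- (v * s)) * (G * m s - n`!%:R * s `^ (nu * n%:R)) =
  G * (expR (- (v * s)) * m s) - n`!%:R * (expR (- (v * s)) * s `^ (nu * n%:R)).
  by ring.
have K1 v : 0 < v -> mu.-integrable `[0%R, +oo[
    (EFin \o (fun s => G * (expR (- (v * s)) * m s))).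
  by move=> v0; exact: (@integrableZl _ _ _ mu _ _ G _ (J1 v v0)).
have K2 v : 0 < v -> mu.-integrable `[0%R, +oo[
    (EFin \o (fun s => n`!%:R * (expR (- (v * s)) * s `^ (nu * n%:R)))).
  by move=> v0; exact: (@integrableZl _ _ _ mu _ _ n`!%:R _ (J2 v v0)).
apply: (@laplace_monotone_eq R (fun s => G * m s) (fun s => n`!%:R * s `^ (nu * n%:R))).
- move=> v v0; have := @integrableB _ _ _ mu `[0%R, +oo[ _ _ _ (K1 v v0) (K2 v v0).
  by move=> /(_ (measurable_itv _)); apply: eq_integrable => // s _; rewrite /= E.
- move=> v v0.
  transitivity (\int[mu]_(s in `[0%R, +oo[) ((G * (expR (- (v * s)) * m s))%:E -
     (n`!%:R * (expR (- (v * s)) * s `^ (nu * n%:R)))%:E))%E.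
    by apply: eq_integral => s _; rewrite E.
  rewrite (integralB_EFin _ (K1 v v0) (K2 v v0))//.
  under eq_integral do rewrite EFinM.
  rewrite (@integralZl _ _ _ mu _ _ _ (J1 v v0))//= (I1 v v0).
  under [X in (_ - X)%E]eq_integral do rewrite EFinM.
  rewrite (@integralZl _ _ _ mu _ _ _ (J2 v v0))//= (I2 v v0).
  by rewrite -!EFinM -EFinB; congr EFin; ring.
- move=> r s r0 rs; apply: ler_wpM2l => //.
  rewrite -lee_fin -!mE ?(le_trans r0)//.
  apply: (@expectation_inverse_subordinator_le (fun u => (`|u| ^+ n)%:E)) => //.
  move=> x y x0' xy; rewrite lee_fin !ger0_norm ?(le_trans x0')//.
  by rewrite lerXn2r ?nnegrE ?(le_trans x0').
- exact: t0.
have : {for t, continuous (fun s : R => s `^ (nu * n%:R))}.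
  apply: differentiable_continuous; apply/derivable1_diffP.
  by apply: derivable_powR; rewrite in_itv/= andbT.
by move=> h; apply: cvgMl_tmp; exact: h.
Qed.

(** A zero here would force [n! = 0] in the moment identity at time 1. *)
Lemma Gamma_neq0 (n : nat) : Gamma (nu * n%:R + 1) != 0.
Proof.
apply/eqP => G0; have := moment_inverse_subordinator_pos n (@ltr01 R).
rewrite G0 mul0e powR1 mulr1 => /esym/eqP.
by rewrite eqe pnatr_eq0 -leqn0 leqNgt fact_gt0.
Qed.

Lemma moment_inverse_subordinator (n : nat) t : 0 < t ->
  (EL (fun u => (`|u| ^+ n)%:E) t =
   (n`!%:R * t `^ (nu * n%:R) / Gamma (nu * n%:R + 1))%:E)%E.
Proof.
move=> t0; have := moment_inverse_subordinator_pos n t0.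
set G := Gamma _; have G0 : G != 0 by exact: Gamma_neq0.
move=> h; rewrite mulrC EFinM -h muleA -EFinM mulVf// mul1e.
by [].
Qed.

End inverse_subordinator_moments.

(* [u^m exp (- c u) / m!], whose Laplace transform is [(c + v)^-(m + 1)]; the
   absolute value only makes it nonnegative on the whole line. *)
Definition erlang {R : realType} (c : R) (m : nat) (u : R) : R :=
  `|u| ^+ m * expR (- (c * u)) / m`!%:R.

Lemma erlang_ge0 (R : realType) (c : R) m u : 0 <= erlang c m u.
Proof. by rewrite /erlang !mulr_ge0 ?exprn_ge0 ?expR_ge0 ?invr_ge0. Qed.

Lemma measurable_erlang (R : realType) (c : R) m D : measurable_fun D (erlang c m).
Proof.
apply: measurable_funM => //; apply: measurable_funM; last exact: measurable_expRN.
by apply: measurable_funX; apply: measurable_funTS; exact: normr_measurable.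
Qed.

Lemma expR_ge_sum (R : realType) (x : R) (J : nat) : 0 <= x ->
  \sum_(j < J) x ^+ j / j`!%:R <= expR x.
Proof.
move=> x0.
have -> : \sum_(j < J) x ^+ j / j`!%:R = series (exp_coeff x) J.
  by rewrite /series/= big_mkord; apply: eq_bigr => j _.
rewrite /expR; apply: (nondecreasing_cvgn_le _ (is_cvg_series_exp_coeff x)).
by apply: nondecreasing_series => i _ _; rewrite /exp_coeff divr_ge0// exprn_ge0.
Qed.

(** * Mittag-Leffler functions as expectations of Erlang kernels *)

Section mittag_leffler.
Context (R : realType) (d : measure_display) (T : measurableType d)
  (P : probability T R) (nu : R) (sigma : R -> T -> R).
Hypotheses (nu0 : 0 < nu) (hsigma : stable_subordinator P nu sigma).
Variables (c : R) (m : nat).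
Hypothesis c0 : 0 < c.
Local Notation L := (inverse_subordinator sigma).
Local Notation EL f t := (\int[P]_w f (L t w))%E.

Let measurable_L t : measurable_fun setT (L t).
Proof. exact: (measurable_inverse_subordinator hsigma). Qed.

Let coef j : R := (- c) ^+ j / (j`!%:R * m`!%:R).

Let moment j (t : R) : R := j`!%:R * t `^ (nu * j%:R) / Gamma (nu * j%:R + 1).

(** Partial sums of [erlang c m u] after expanding its exponential factor. *)
Let f_ J (u : R) : R := \sum_(j < J) coef j * `|u| ^+ (m + j).

Let f_E J (u : R) : f_ J u = `|u| ^+ m / m`!%:R * \sum_(j < J) (- (c * `|u|)) ^+ j / j`!%:R.
Proof.
rewrite /f_ big_distrr/=; apply: eq_bigr => j _.
rewrite /coef exprD -mulNr exprMn invfM; ring.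
Qed.

(** [u^m / m!] is at most [exp u], and the truncated exponential at most [exp (c u)] in absolute
    value. The bound is free of [J] and integrable at [L t], as dominated convergence requires. *)
Let f_le J (u : R) : 0 <= u -> `|f_ J u| <= expR ((c + 1) * u).
Proof.
move=> u0; rewrite f_E normrM [X in X * _]ger0_norm ?divr_ge0 ?exprn_ge0//.
rewrite mulrDl mul1r addrC expRD; apply: ler_pM => //.
- by rewrite ler_pdivrMr ?ltr0n ?fact_gt0// mulrC ger0_norm// exprn_le_expR.
have cu : 0 <= c * u by rewrite mulr_ge0// ltW.
apply: le_trans (expR_ge_sum J cu); apply: le_trans (ler_norm_sum _ _ _) _.
apply: ler_sum => j _; rewrite (ger0_norm u0) normrM normrX normrN (ger0_norm cu).
by rewrite [X in _ * X]ger0_norm ?invr_ge0.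
Qed.

Let f_cvg (u : R) : 0 <= u -> f_ J u @[J --> \oo] --> erlang c m u.
Proof.
move=> u0; under eq_fun do rewrite f_E.
rewrite /erlang mulrAC; apply: cvgMl_tmp.
rewrite ger0_norm//.
have := is_cvg_series_exp_coeff (- (c * u)).
rewrite -[X in _ --> X]/(limn (series (exp_coeff (- (c * u))))).
rewrite [X in X @ \oo --> _](_ : _ = series (exp_coeff (- (c * u)))); first exact.
by apply/funext => J; rewrite /series/= big_mkord.
Qed.

Let int_f J t : 0 < t ->
  EL (fun u => (f_ J u)%:E) t = (\sum_(j < J) coef j * moment (m + j) t)%:E.
Proof.
move=> t0.
have iX n : P.-integrable setT (EFin \o (fun w => `|L t w| ^+ n)).
  apply: (@ge0_fin_integrable _ _ _ _ _ _ _ _ _ _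
    (moment_inverse_subordinator nu0 hsigma n t0)) => //.
  apply: measurable_funX; apply: measurableT_comp => //; exact: normr_measurable.
transitivity (\int[P]_w (\sum_(j < J) (coef j)%:E * (`|L t w| ^+ (m + j))%:E))%E.
  by apply: eq_integral => w _; rewrite /f_ -sumEFin.
rewrite (@integral_sum _ _ _ P setT _ _
  (fun (j : 'I_J) w => (coef j)%:E * (`|L t w| ^+ (m + j))%:E)%E)//.
  rewrite -sumEFin; apply: eq_bigr => j _.
  rewrite (@integralZl _ _ _ P setT _ _ (iX (m + j)%N))//.
  by rewrite (moment_inverse_subordinator nu0 hsigma).
by move=> j; apply: (@integrableZl _ _ _ P setT _ _ _ (iX (m + j)%N)).
Qed.

Let cvg_moments t : 0 < t ->
  EL (fun u => (erlang c m u)%:E) t \is a fin_num /\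
  \sum_(j < J) coef j * moment (m + j) t @[J --> \oo] -->
    fine (EL (fun u => (erlang c m u)%:E) t).
Proof.
move=> t0.
have L0 w := inverse_subordinator_ge0 sigma t w.
have mf J : measurable_fun setT (fun w => (f_ J (L t w))%:E).
  apply/measurable_EFinP; apply: measurable_sum => j.
  apply: measurable_funM => //; apply: measurable_funX.
  by apply: measurableT_comp => //; exact: normr_measurable.
have me : measurable_fun setT (fun w => (erlang c m (L t w))%:E).
  apply/measurable_EFinP; exact: (measurableT_comp (@measurable_erlang R c m setT) (measurable_L t)).
have ig : P.-integrable setT (fun w => (expR ((c + 1) * L t w))%:E).
  have mg : measurable_fun setT (fun w => (expR ((c + 1) * L t w))).
    by do 2 apply: measurableT_comp => //.
  apply/integrableP; split; first exact/measurable_EFinP.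
  under eq_integral do rewrite /= ger0_norm ?expR_ge0//.
  by apply: (expectation_expR_inverse_subordinator_lty nu0 hsigma) => //; [rewrite addr_gt0|exact: ltW].
have hcv w : (f_ J (L t w))%:E @[J --> \oo] --> (erlang c m (L t w))%:E.
  by apply: cvg_EFin; [exact: nearW|exact: f_cvg].
have hle (w : T) (J : nat) : (`|(f_ J (L t w))%:E| <= (expR ((c + 1) * L t w))%:E)%E.
  by rewrite lee_fin; exact: f_le.
have [i1 _ h] := @dominated_convergence _ _ _ P setT measurableT
  (fun J w => (f_ J (L t w))%:E) (fun w => (erlang c m (L t w))%:E)
  (fun w => (expR ((c + 1) * L t w))%:E) mf me
  (aeW _ (fun w _ => hcv w)) ig (aeW _ (fun w J _ => hle w J)).
have fE : EL (fun u => (erlang c m u)%:E) t \is a fin_num by exact: integrable_fin_num.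
split=> //; move: h; rewrite -[X in _ --> X -> _](fineK fE) => /fine_cvg.
rewrite (_ : fine \o _ = fun J => \sum_(j < J) coef j * moment (m + j) t)//.
by apply/funext => J; rewrite /= int_f.
Qed.

(** Integrated termwise, the expansion turns the moment of order [m + j] into
    [(m + j)! / Gamma (nu (m + j) + 1)], the [j]-th Mittag-Leffler coefficient since
    [(m + j)! = Gamma (m + 1 + j)]. Convergence of the series comes with the identity. *)
Lemma expectation_erlang_pos t : 0 < t ->
  EL (fun u => (erlang c m u)%:E) t =
  (t `^ (expo nu m.+1 - 1) *
    mittag_leffler nu (expo nu m.+1) m.+1%:R (- c * t `^ nu))%:E.
Proof.
move=> t0; have [fE h] := cvg_moments t0.
rewrite -(fineK fE); congr EFin.
set T0 := fine _ in h *.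
have tm : t `^ (nu * m%:R) != 0 by rewrite gt_eqF// powR_gt0.
have -> : expo nu m.+1 - 1 = nu * m%:R by rewrite /expo -natr1; ring.
suff -> : mittag_leffler nu (expo nu m.+1) m.+1%:R (- c * t `^ nu) = T0 / t `^ (nu * m%:R).
  by rewrite mulrCA divff// mulr1.
rewrite /mittag_leffler; apply/cvg_lim => //.
rewrite [X in X @ \oo --> _](_ : _ =
  fun J => (\sum_(j < J) coef j * moment (m + j) t) / t `^ (nu * m%:R)).
  by apply: cvgMr_tmp.
apply/funext => J; rewrite /series/= big_mkord mulr_suml; apply: eq_bigr => j _.
rewrite /coef /moment.
have -> : m.+1%:R = m%:R + 1 :> R by rewrite natr1.
rewrite [m%:R + 1 + j%:R]addrAC -natrD !Gamma_fact.
have -> : nu * j%:R + expo nu m.+1 = nu * (m + j)%:R + 1.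
  by rewrite /expo -natr1 natrD; ring.
have -> : t `^ (nu * (m + j)%:R) = t `^ (nu * m%:R) * (t `^ nu) ^+ j.
  rewrite -powR_mulrn ?powR_ge0// -powRrM -powRD ?(gt_eqF t0) ?implybT//.
  by congr powR; rewrite natrD; ring.
have g0 := Gamma_neq0 nu0 hsigma (m + j).
have f1 : j`!%:R != 0 :> R by rewrite pnatr_eq0 -lt0n fact_gt0.
have f2 : m`!%:R != 0 :> R by rewrite pnatr_eq0 -lt0n fact_gt0.
rewrite exprMn.
set G := Gamma _ in g0 *; move: tm g0 f1 f2.
move: (t `^ _) G (_ `!%:R) (m`!%:R) (_ ^+ j) (_ ^+ j) => a G b e x y a0 G0 b0 e0.
by field; rewrite a0 G0 b0 e0.
Qed.

End mittag_leffler.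

(** * Mixtures of Erlang kernels *)

Section esum_countable.
Context (R : realType) (I : countType).

(** Through the encoding, sums over any countable type, triples included, become series over [nat],
    to which monotone convergence for series applies. *)
Lemma esum_pickle (g : I -> \bar R) : (forall i, 0 <= g i)%E ->
  (\esum_(i in [set: I]) g i = \sum_(n <oo) (if pickle_inv n is Some i then g i else 0))%E.
Proof.
move=> g0.
pose a n : \bar R := if pickle_inv n is Some i then g i else 0%E.
have a0 n : (0 <= a n)%E by rewrite /a; case: pickle_inv.
rewrite (nneseries_esumT a0).
transitivity (\esum_(n in range (@pickle I)) a n)%E.
  rewrite (@reindex_esum R I nat setT _ pickle).
    by apply: eq_esum => i _; rewrite /a pickleK_inv.
  by apply: inj_bij => x y _ _; exact: (pcan_inj (@pickleK_inv I)).
rewrite esum_mkcond; apply: eq_esum => n _.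
case: ifPn => // /negP nI; rewrite /a.
case E : (pickle_inv n) => [i|//]; exfalso; apply: nI.
rewrite inE; exists i => //.
by have := @pickle_invK I n; rewrite E.
Qed.

Lemma ge0_integral_esum d (T : measurableType d) (mu : {measure set T -> \bar R})
    (D : set T) (f : I -> T -> \bar R) : measurable D ->
  (forall i, measurable_fun D (f i)) -> (forall i x, D x -> (0 <= f i x)%E) ->
  (\int[mu]_(x in D) (\esum_(i in [set: I]) f i x) =
   \esum_(i in [set: I]) (\int[mu]_(x in D) f i x))%E.
Proof.
move=> mD mf f0.
rewrite esum_pickle; last by move=> i; apply: integral_ge0 => x; exact: f0.
pose F n x : \bar R := if pickle_inv n is Some i then f i x else 0%E.
transitivity (\int[mu]_(x in D) (\sum_(n <oo) F n x))%E.
  apply: eq_integral => x; rewrite inE => Dx; rewrite esum_pickle//.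
  by move=> i; exact: f0.
rewrite integral_nneseries//.
- apply: eq_eseriesr => n _; rewrite /F; case: pickle_inv => // .
  by rewrite integral0.
- by move=> n; rewrite /F; case: pickle_inv.
- by move=> n x Dx; rewrite /F; case: pickle_inv => // i; exact: f0.
Qed.

Lemma ge0_measurable_esum d (T : measurableType d) (D : set T) (f : I -> T -> \bar R) :
  measurable D ->
  (forall i, measurable_fun D (f i)) -> (forall i x, (0 <= f i x)%E) ->
  measurable_fun D (fun x => (\esum_(i in [set: I]) f i x)%E).
Proof.
move=> mD mf f0.
under eq_fun do rewrite esum_pickle//.
apply: (@ge0_emeasurable_sum _ _ _ D
  (fun n x => if pickle_inv n is Some i then f i x else 0%E) xpredT).
- by move=> n x Dx _; case: pickle_inv.
- by move=> n _; case: pickle_inv.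
Qed.

Lemma ge0_esumZl (g : I -> \bar R) (k : R) : 0 <= k -> (forall i, 0 <= g i)%E ->
  (\esum_(i in [set: I]) (k%:E * g i) = k%:E * (\esum_(i in [set: I]) g i))%E.
Proof.
move=> k0 g0; rewrite !esum_pickle//; last by move=> i; rewrite mule_ge0.
rewrite -nneseriesZl//; last by move=> n _; case: pickle_inv.
by apply: eq_eseriesr => n _; case: pickle_inv => //; rewrite mule0.
Qed.

End esum_countable.

Lemma esum_sums_to (R : realType) (u : nat -> R) (l : R) : (forall n, 0 <= u n) ->
  (\esum_(n in [set: nat]) (u n)%:E = l%:E)%E -> sums_to 0 u l.
Proof.
move=> u0; rewrite -nneseries_esumT; last by move=> n; rewrite lee_fin.
move=> ul; rewrite /sums_to.
have : (\sum_(0 <= i < N) (u i)%:E)%E @[N --> \oo] --> l%:E.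
  rewrite -ul; apply: is_cvg_nneseries => n _ _; by rewrite lee_fin.
move=> /fine_cvg; apply: cvg_trans; apply: near_eq_cvg; apply: nearW => N.
by rewrite /= sumEFin.
Qed.

Lemma esum_sums_to1 (R : realType) (u : nat -> R) (l : R) : (forall n, 0 <= u n) ->
  u 0%N = 0 -> (\esum_(n in [set: nat]) (u n)%:E = l%:E)%E -> sums_to 1 u l.
Proof.
move=> u0 u00 /(esum_sums_to u0); apply: cvg_trans; apply: near_eq_cvg.
near=> N; rewrite [LHS]big_ltn ?u00 ?add0r//.
by near: N; exists 1%N.
Unshelve. all: by end_near. Qed.

(** A finite total over all triples bounds every inner sum, so all three levels converge to real
    numbers. The vanishing terms at [m = 0] reconcile a sum over all of [nat] with one that starts
    at [m = 1]. *)
Lemma esum_sums_to3 (R : realType) (u : nat -> nat -> nat -> R) (l : R) :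
  (forall j m r, 0 <= u j m r) -> (forall j r, u j 0%N r = 0) ->
  (\esum_(x in [set: nat * (nat * nat)]) (u x.1 x.2.1 x.2.2)%:E = l%:E)%E -> sums_to3 u l.
Proof.
move=> u0 u00.
pose G j m : \bar R := (\esum_(r in [set: nat]) (u j m r)%:E)%E.
pose H j : \bar R := (\esum_(m in [set: nat]) G j m)%E.
have G0 j m : (0 <= G j m)%E by apply: esum_ge0 => r _; rewrite lee_fin.
have H0 j : (0 <= H j)%E by apply: esum_ge0.
have -> : (\esum_(x in [set: nat * (nat * nat)]) (u x.1 x.2.1 x.2.2)%:E =
   \esum_(j in [set: nat]) H j)%E.
  transitivity (\esum_(j in [set: nat]) \esum_(x in [set: nat * nat]) (u j x.1 x.2)%:E)%E.
    rewrite (@esum_esum R _ _ setT (fun=> setT) (fun j x => (u j x.1 x.2)%:E)); last first.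
      by move=> *; rewrite lee_fin.
    by congr esum; apply/seteqP.
  apply: eq_esum => j _; rewrite /H /G.
  rewrite (@esum_esum R _ _ setT (fun=> setT) (fun m r => (u j m r)%:E)); last first.
    by move=> *; rewrite lee_fin.
  by congr esum; apply/seteqP.
move=> Hl.
have fin_le (I : choiceType) (f : I -> \bar R) (i : I) : (forall i, 0 <= f i)%E ->
    (\esum_(i in [set: I]) f i < +oo)%E -> f i \is a fin_num.
  move=> f0; rewrite ge0_fin_numE//; apply: le_lt_trans.
  apply: esum_ge; exists [set i]; last by rewrite fsbig_set1.
  by split.
have Hf j : H j \is a fin_num by apply: fin_le => //; rewrite Hl ltry.
have Gf j m : G j m \is a fin_num.
  by apply: fin_le => //; have := Hf j; rewrite ge0_fin_numE.
exists (fun j m => fine (G j m)), (fun j => fine (H j)); split.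
- move=> j m _; apply: esum_sums_to => //; by rewrite fineK.
- move=> j; apply: esum_sums_to1.
  + by move=> m; rewrite fine_ge0.
  + by rewrite /G esum1// => r _; rewrite u00.
  + by rewrite fineK// /H; apply: eq_esum => m _; rewrite fineK.
- apply: esum_sums_to; first by move=> j; rewrite fine_ge0.
  by rewrite -Hl; apply: eq_esum => j _; rewrite fineK.
Qed.

Section erlang_estimates.
Variables (R : realType) (c : R).
Hypothesis c0 : 0 < c.

Lemma laplace_erlang (m : nat) (v : R) : 0 < v ->
  (\int[lebesgue_measure]_(t in `[0%R, +oo[) ((expR (- (v * t)))%:E * (erlang c m t)%:E) =
   ((c + v) ^- m.+1)%:E)%E.
Proof.
move=> v0; have cv : 0 < c + v by rewrite addr_gt0.
have f0 : m`!%:R != 0 :> R by rewrite pnatr_eq0 -lt0n fact_gt0.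
transitivity (\int[lebesgue_measure]_(t in `[0%R, +oo[)
  ((m`!%:R^-1)%:E * (expR (- ((c + v) * t)) * t ^+ m)%:E))%E.
  apply: eq_integral => t; rewrite inE/= in_itv/= andbT => t0.
  rewrite -!EFinM /erlang ger0_norm//; congr EFin.
  have -> : - ((c + v) * t) = - (c * t) + - (v * t) by ring.
  by rewrite expRD; ring.
rewrite ge0_integralZl//; last 2 first.
- by apply/measurable_EFinP; apply: measurable_funTS;
    apply: continuous_measurable_fun; exact: continuous_expRN_exprn.
- by move=> t; rewrite /= in_itv/= andbT => t0; rewrite lee_fin mulr_ge0 ?expR_ge0 ?exprn_ge0.
by rewrite integral_expRN_exprn// -EFinM mulrA mulVf// mul1r.
Qed.

(** From [u^m / m! <= exp ((c + v) u) / (c + v)^m]. The bound is the transform of the kernel at [v]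
    times a factor free of [m], so it can be summed over a mixture. *)
Lemma erlang_le (m : nat) (v u : R) : 0 < v -> 0 <= u ->
  erlang c m u <= (c + v) * expR (v * u) / (c + v) ^+ m.+1.
Proof.
move=> v0 u0; have cv : 0 < c + v by rewrite addr_gt0.
have f0 : 0 < m`!%:R :> R by rewrite ltr0n fact_gt0.
have := exprn_le_expR m (mulr_ge0 (ltW cv) u0) => h.
rewrite ler_pdivlMr ?exprn_gt0// /erlang ger0_norm// mulrAC ler_pdivrMr//.
have -> : u ^+ m * expR (- (c * u)) * (c + v) ^+ m.+1 =
    (c + v) * expR (- (c * u)) * ((c + v) * u) ^+ m by rewrite exprMn exprS; ring.
apply: le_trans (ler_wpM2l _ h) _; first by rewrite mulr_ge0 ?expR_ge0// ltW.
have -> : expR (v * u) = expR ((c + v) * u) * expR (- (c * u)).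
  by rewrite -expRD; congr expR; ring.
by rewrite le_eqVlt; apply/orP; left; apply/eqP; ring.
Qed.

Lemma ler_subXX (m : nat) (u u' : R) : 0 <= u -> u <= u' ->
  u' ^+ m.+1 - u ^+ m.+1 <= (u' - u) * (m.+1%:R * u' ^+ m).
Proof.
move=> u0 uu; elim: m => [|m IH]; first by rewrite !expr1 expr0 !mulr1.
have -> : u' ^+ m.+2 - u ^+ m.+2 = u' * (u' ^+ m.+1 - u ^+ m.+1) + (u' - u) * u ^+ m.+1.
  by rewrite !(exprS _ m.+1); ring.
have h : (u' - u) * u ^+ m.+1 <= (u' - u) * u' ^+ m.+1.
  by rewrite ler_wpM2l ?subr_ge0// lerXn2r ?nnegrE// (le_trans u0).
apply: le_trans (lerD (ler_wpM2l (le_trans u0 uu) IH) h) _.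
rewrite le_eqVlt; apply/orP; left; apply/eqP; rewrite exprS -[m.+2%:R]natr1; ring.
Qed.

(** The power [u^m] limits the increase of the kernel and the exponential limits its decrease; the
    slopes [(c + v)^2] and [c (c + v)], times a common factor, add up to [(2 c + v) (c + v)]. The
    dependence on [m] is again only [(c + v)^-(m + 1)]. *)
Lemma erlang_lipschitz (m : nat) (v B u u' : R) : 0 < v -> 0 <= u -> u <= u' -> u' <= B ->
  `|erlang c m u' - erlang c m u| <=
  (u' - u) * ((2 * c + v) * (c + v) * expR (v * B)) / (c + v) ^+ m.+1.
Proof.
move=> v0 u0 uu uB; have cv : 0 < c + v by rewrite addr_gt0.
have u'0 := le_trans u0 uu.
have d0 : 0 <= u' - u by rewrite subr_ge0.
have f0 n : 0 < n`!%:R :> R by rewrite ltr0n fact_gt0.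
set M := (c + v) ^+ m.+1; have M0 : 0 < M by rewrite exprn_gt0.
set E := expR (v * B).
have Ele x : x <= B -> expR (v * x) <= E by move=> xB; rewrite ler_expR ler_pM2l.
have up : erlang c m u' - erlang c m u <= (u' - u) * ((c + v) * (c + v) * E / M).
  have -> : erlang c m u' - erlang c m u =
      (u' ^+ m - u ^+ m) * expR (- (c * u')) / m`!%:R -
      u ^+ m * (expR (- (c * u)) - expR (- (c * u'))) / m`!%:R.
    by rewrite /erlang !ger0_norm//; ring.
  rewrite lerBlDr (@le_trans _ _ ((u' - u) * ((c + v) * (c + v) * E / M)))//; last first.
    rewrite lerDl divr_ge0// mulr_ge0 ?exprn_ge0// subr_ge0 ler_expR lerN2.
    by rewrite ler_pM2l.
  case: m @M M0 => [|m] M M0.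
    rewrite !expr0 subrr !mul0r mulr_ge0// divr_ge0 ?(ltW M0)//.
    by rewrite mulr_ge0 ?expR_ge0// mulr_ge0 ?ltW.
  have h := ler_subXX m u0 uu.
  apply: (@le_trans _ _ ((u' - u) * (m.+1%:R * u' ^+ m) * expR (- (c * u')) / m.+1`!%:R)).
    by rewrite ler_pM2r ?invr_gt0// ler_wpM2r ?expR_ge0.
  have -> : (u' - u) * (m.+1%:R * u' ^+ m) * expR (- (c * u')) / m.+1`!%:R =
      (u' - u) * erlang c m u'.
    rewrite /erlang ger0_norm// factS natrM.
    have n0 : m.+1%:R != 0 :> R by rewrite pnatr_eq0.
    have := lt0r_neq0 (f0 m); move: n0; move: (m.+1%:R) (m`!%:R) => a b a0 b0.
    by field; rewrite a0 b0.
  rewrite ler_wpM2l//; apply: le_trans (erlang_le m v0 u'0) _.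
  have -> : (c + v) * (c + v) * E / M = (c + v) * E / (c + v) ^+ m.+1.
    rewrite /M [in LHS]exprS.
    have := lt0r_neq0 cv; have : (c + v) ^+ m.+1 != 0 by rewrite expf_neq0 ?gt_eqF.
    generalize (c + v) ((c + v) ^+ m.+1) E => x y z y0 x0.
    by field; rewrite x0 y0.
  by rewrite ler_pM2r ?invr_gt0 ?exprn_gt0// ler_pM2l// Ele.
have dn : erlang c m u - erlang c m u' <= (u' - u) * (c * (c + v) * E / M).
  have -> : erlang c m u - erlang c m u' =
      u ^+ m * (expR (- (c * u)) - expR (- (c * u'))) / m`!%:R -
      (u' ^+ m - u ^+ m) * expR (- (c * u')) / m`!%:R.
    by rewrite /erlang !ger0_norm//; ring.
  rewrite lerBlDr; apply: (@le_trans _ _ ((u' - u) * (c * (c + v) * E / M))); last first.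
    rewrite lerDl divr_ge0// mulr_ge0 ?expR_ge0// subr_ge0.
    case: (m) => [|i]; first by rewrite !expr0.
    by rewrite lerXn2r ?nnegrE.
  apply: (@le_trans _ _ ((u' - u) * (c * erlang c m u))); last first.
    rewrite ler_wpM2l// -!mulrA ler_pM2l//.
    apply: le_trans (erlang_le m v0 u0) _; rewrite -mulrA ler_pM2l//.
    by rewrite ler_pM2r ?invr_gt0// Ele// (le_trans uu).
  have h : expR (- (c * u)) - expR (- (c * u')) <= expR (- (c * u)) * (c * (u' - u)).
    have -> : expR (- (c * u')) = expR (- (c * u)) * expR (- (c * (u' - u))).
      by rewrite -expRD; congr expR; ring.
    rewrite -[X in X - _]mulr1 -mulrBr ler_pM2l ?expR_gt0//.
    by have := expR_ge1Dx (- (c * (u' - u))); lra.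
  have -> : (u' - u) * (c * erlang c m u) =
      u ^+ m * (expR (- (c * u)) * (c * (u' - u))) / m`!%:R.
    by rewrite /erlang ger0_norm//; ring.
  by rewrite ler_pM2r ?invr_gt0// ler_wpM2l// exprn_ge0.
have eqM : (u' - u) * ((2 * c + v) * (c + v) * E) / M =
  (u' - u) * ((c + v) * (c + v) * E / M) + (u' - u) * (c * (c + v) * E / M) by ring.
rewrite ler_norml eqM; apply/andP; split.
  rewrite lerNl opprB; apply: le_trans dn _; rewrite lerDr mulr_ge0// divr_ge0 ?(ltW M0)//.
  by rewrite mulr_ge0 ?expR_ge0// mulr_ge0// ltW.
apply: le_trans up _; rewrite lerDl mulr_ge0// divr_ge0 ?(ltW M0)//.
by rewrite mulr_ge0 ?expR_ge0// mulr_ge0// ltW.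
Qed.

End erlang_estimates.

Section erlang_mixture.
Variables (R : realType) (c : R) (I : countType) (w : I -> R) (a : I -> nat) (K : R -> R).
Hypotheses (c0 : 0 < c) (w0 : forall i, 0 <= w i).
Hypothesis hK : forall v, 0 < v ->
  (\esum_(i in [set: I]) (w i * (c + v) ^- (a i).+1)%:E = (K v)%:E)%E.
Local Notation mu := (@lebesgue_measure R).

(** By [hK] this is the inverse Laplace transform of [K]. It is extended-real valued because
    finiteness is a consequence of [hK], derived below. *)
Definition erlang_mixture (u : R) : \bar R :=
  (\esum_(i in [set: I]) (w i * erlang c (a i) u)%:E)%E.
Local Notation U := erlang_mixture.

Lemma erlang_mixture_ge0 u : (0 <= U u)%E.
Proof. by apply: esum_ge0 => i _; rewrite lee_fin mulr_ge0// erlang_ge0. Qed.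

Lemma measurable_erlang_mixture : measurable_fun setT U.
Proof.
apply: ge0_measurable_esum => //.
- by move=> i; apply/measurable_EFinP; apply: measurable_funM => //; exact: measurable_erlang.
- by move=> i x; rewrite lee_fin mulr_ge0// erlang_ge0.
Qed.

Let esumZ v k : 0 < v -> 0 <= k ->
  (\esum_(i in [set: I]) (k * (w i * (c + v) ^- (a i).+1))%:E = (k * K v)%:E)%E.
Proof.
move=> v0 k0; rewrite EFinM -hK// -ge0_esumZl// => i.
by rewrite lee_fin mulr_ge0// invr_ge0 exprn_ge0// ltW// addr_gt0.
Qed.

Lemma erlang_mixture_le v u : 0 < v -> 0 <= u ->
  (U u <= ((c + v) * expR (v * u) * K v)%:E)%E.
Proof.
move=> v0 u0.
have k0 : 0 <= (c + v) * expR (v * u) by rewrite mulr_ge0 ?expR_ge0// ltW// addr_gt0.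
rewrite -esumZ//; apply: le_esum => i _; rewrite lee_fin [leRHS]mulrCA ler_wpM2l//.
exact: erlang_le.
Qed.

Lemma erlang_mixture_fin_num u : 0 <= u -> U u \is a fin_num.
Proof.
move=> u0; rewrite ge0_fin_numE ?erlang_mixture_ge0//.
by apply: le_lt_trans (erlang_mixture_le ltr01 u0) _; rewrite ltry.
Qed.

Lemma erlang_mixture_lipschitz B u u' : 0 <= u -> u <= u' -> u' <= B ->
  `|fine (U u') - fine (U u)| <= (u' - u) * ((2 * c + 1) * (c + 1) * expR B * K 1).
Proof.
move=> u0 uu uB; have u'0 := le_trans u0 uu.
pose k := (u' - u) * ((2 * c + 1) * (c + 1) * expR B).
have k0 : 0 <= k.
  by rewrite mulr_ge0 ?subr_ge0// mulr_ge0 ?expR_ge0// mulr_ge0// addr_ge0// ?mulr_ge0// ltW.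
have lip i : `|erlang c (a i) u' - erlang c (a i) u| <= k * (c + 1) ^- (a i).+1.
  by have := erlang_lipschitz c0 (a i) ltr01 u0 uu uB; rewrite mul1r.
have ei i : 0 <= (c + 1) ^- (a i).+1 :> R.
  by rewrite invr_ge0 exprn_ge0// addr_ge0// ltW.
(* A one-sided inequality between nonnegative sums, used in both directions, so that no difference
   of series is formed. *)
have main x y : 0 <= x -> 0 <= y ->
    (forall i, erlang c (a i) x <= erlang c (a i) y + k * (c + 1) ^- (a i).+1) ->
    fine (U x) <= fine (U y) + k * K 1.
  move=> x0 y0 h; rewrite -lee_fin EFinD !fineK ?erlang_mixture_fin_num//.
  rewrite -esumZ// -esumD; last 2 first.
  - by move=> i _; rewrite lee_fin mulr_ge0// erlang_ge0.
  - by move=> i _; rewrite lee_fin mulr_ge0// mulr_ge0.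
  apply: le_esum => i _; rewrite -EFinD lee_fin [X in _ + X]mulrCA -mulrDr ler_wpM2l//.
have -> : (u' - u) * ((2 * c + 1) * (c + 1) * expR B * K 1) = k * K 1 by rewrite /k; ring.
rewrite ler_norml lerNl opprB !lerBlDl; apply/andP; split.
  by apply: main => // i; have := lip i; rewrite ler_norml => /andP[]; lra.
by apply: main => // i; have := lip i; rewrite ler_norml => /andP[]; lra.
Qed.

Lemma erlang_mixture_continuous (t : R) : 0 < t -> {for t, continuous (fine \o U)}.
Proof.
move=> t0; pose M := `|(2 * c + 1) * (c + 1) * expR (t + 1) * K 1| + 1.
have M0 : 0 < M by rewrite ltr_wpDl.
apply/cvgrPdist_le => e e0.
near=> u.
have u0 : 0 <= u by apply: ltW; near: u; exact: lt_nbhsr.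
have ut : u <= t + 1 by apply: ltW; near: u; apply: lt_nbhsl; rewrite ltrDl.
have tt : t <= t + 1 by rewrite lerDl.
have h : `|fine (U t) - fine (U u)| <= `|t - u| * M.
  have le_M d : 0 <= d -> d * ((2 * c + 1) * (c + 1) * expR (t + 1) * K 1) <= d * M.
    by move=> d0; rewrite ler_wpM2l// (le_trans (ler_norm _))// lerDl.
  have [tu|tu] := leP t u.
    rewrite distrC; apply: le_trans (erlang_mixture_lipschitz (ltW t0) tu ut) _.
    by rewrite distrC ger0_norm ?subr_ge0// le_M// subr_ge0.
  apply: le_trans (erlang_mixture_lipschitz u0 (ltW tu) tt) _.
  by rewrite ger0_norm ?subr_ge0 ?(ltW tu)// le_M// subr_ge0 ltW.
apply: le_trans h _; rewrite -ler_pdivlMr//.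
near: u; apply: (@cvgr_dist_le _ _ _ _ _ id); first exact: cvg_id.
by rewrite divr_gt0.
Unshelve. all: by end_near. Qed.

Lemma laplace_erlang_mixture v : 0 < v ->
  (\int[mu]_(t in `[0%R, +oo[) ((expR (- (v * t)))%:E * U t) = (K v)%:E)%E.
Proof.
move=> v0.
transitivity (\int[mu]_(t in `[0%R, +oo[)
  (\esum_(i in [set: I]) ((w i)%:E * ((expR (- (v * t)))%:E * (erlang c (a i) t)%:E))))%E.
  apply: eq_integral => t _; rewrite /U -ge0_esumZl ?expR_ge0//.
    by apply: eq_esum => i _; rewrite EFinM muleCA.
  by move=> i; rewrite lee_fin mulr_ge0// erlang_ge0.
have mE i : measurable_fun (`[0%R, +oo[%classic : set R)
    (fun t : R => (expR (- (v * t)))%:E * (erlang c (a i) t)%:E)%E.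
  apply: emeasurable_funM; apply/measurable_EFinP; first exact: measurable_expRN.
  exact: measurable_erlang.
have E0 i (t : R) : (0 <= (expR (- (v * t)))%:E * (erlang c (a i) t)%:E)%E.
  by rewrite mule_ge0// lee_fin ?expR_ge0 ?erlang_ge0.
rewrite ge0_integral_esum//; last 2 first.
- by move=> i; apply: emeasurable_funM => //; exact: mE.
- by move=> i t _; rewrite mule_ge0// lee_fin.
rewrite -hK//; apply: eq_esum => i _.
rewrite ge0_integralZl//; first by rewrite laplace_erlang.
  exact: mE.
by rewrite lee_fin.
Qed.

Section time_changed.
Context (d : measure_display) (T : measurableType d)
  (P : probability T R) (nu : R) (sigma : R -> T -> R).
Hypotheses (nu0 : 0 < nu) (hsigma : stable_subordinator P nu sigma).
Hypothesis a0 : forall i, (0 < a i)%N.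
Local Notation L := (inverse_subordinator sigma).
Local Notation EL f t := (\int[P]_w f (L t w))%E.

Let measurable_L t : measurable_fun setT (L t).
Proof. exact: (measurable_inverse_subordinator hsigma). Qed.

(** At time 0 both sides vanish: [L 0 = 0] almost surely, a kernel of positive order is 0 there, and
    so is the power [0^(nu m)]. *)
Lemma expectation_erlang (m : nat) t : 0 <= t -> (0 < m)%N ->
  EL (fun u => (erlang c m u)%:E) t =
  (t `^ (expo nu m.+1 - 1) *
    mittag_leffler nu (expo nu m.+1) m.+1%:R (- c * t `^ nu))%:E.
Proof.
move=> t0 m0; move: t0; rewrite le_eqVlt => /orP[/eqP<-|t0]; last first.
  exact: expectation_erlang_pos.
rewrite (expectation_inverse_subordinator0 nu0 hsigma (f := fun u => (erlang c m u)%:E)); last 2 first.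
- by apply/measurable_EFinP; exact: measurable_erlang.
- by move=> u; rewrite lee_fin erlang_ge0.
rewrite /erlang normr0 expr0n gtn_eqF// !mul0r powR0 ?mul0r//.
have -> : expo nu m.+1 - 1 = nu * m%:R by rewrite /expo -natr1; ring.
by rewrite gt_eqF// mulr_gt0// ltr0n.
Qed.

Lemma expectation_erlang_mixture t : 0 <= t ->
  EL U t = (\esum_(i in [set: I]) (w i * (t `^ (expo nu (a i).+1 - 1) *
    mittag_leffler nu (expo nu (a i).+1) (a i).+1%:R (- c * t `^ nu)))%:E)%E.
Proof.
move=> t0.
have me i : measurable_fun setT (fun x => (erlang c (a i) (L t x))%:E).
  apply/measurable_EFinP.
  exact: (measurableT_comp (@measurable_erlang R c (a i) setT) (measurable_L t)).
rewrite /U ge0_integral_esum//; last 2 first.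
- move=> i; apply/measurable_EFinP; apply: measurable_funM => //.
  exact: (measurableT_comp (@measurable_erlang R c (a i) setT) (measurable_L t)).
- by move=> i x _; rewrite lee_fin mulr_ge0// erlang_ge0.
apply: eq_esum => i _; rewrite EFinM -expectation_erlang//.
under eq_integral do rewrite EFinM.
rewrite ge0_integralZl//.
- by move=> x _; rewrite lee_fin erlang_ge0.
- by rewrite lee_fin.
Qed.

Lemma expectation_erlang_mixture_fin_num t : 0 <= t -> EL U t \is a fin_num.
Proof.
move=> t0; rewrite ge0_fin_numE; last first.
  by apply: integral_ge0 => x _; exact: erlang_mixture_ge0.
have K0 : 0 <= K 1.
  rewrite -lee_fin -hK//; apply: esum_ge0 => i _.
  by rewrite lee_fin mulr_ge0// invr_ge0 exprn_ge0// addr_ge0// ltW.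
have mexp : measurable_fun setT (fun x => (expR (1 * L t x))%:E).
  by apply/measurable_EFinP; do 2 apply: measurableT_comp => //.
apply: (@le_lt_trans _ _ (\int[P]_x (((c + 1) * K 1)%:E * (expR (1 * L t x))%:E))%E).
  apply: ge0_le_integral => //.
  - by move=> x _; exact: erlang_mixture_ge0.
  - exact: (measurableT_comp measurable_erlang_mixture (measurable_L t)).
  - exact: emeasurable_funM.
  move=> x _; rewrite -EFinM mulrAC.
  exact: (erlang_mixture_le ltr01 (inverse_subordinator_ge0 _ _ _)).
rewrite ge0_integralZl//; last first.
  by rewrite lee_fin mulr_ge0// addr_ge0// ltW.
rewrite lte_mul_pinfty ?lee_fin ?mulr_ge0 ?addr_ge0 ?(ltW c0)//.
exact: (expectation_expR_inverse_subordinator_lty nu0 hsigma).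
Qed.

End time_changed.
End erlang_mixture.

(** * The resolvent of the reflected walk *)

(** A relation rather than a value: with [nnsum_uniq], an identity between terms passes to the sums
    by exhibiting two totals of one family. *)
Definition nnsum {R : realType} {I : choiceType} (u : I -> R) (l : R) : Prop :=
  (forall i, 0 <= u i) /\ (\esum_(i in [set: I]) (u i)%:E = l%:E)%E.

Section nnsum_theory.
Context {R : realType}.

Lemma eq_nnsum (I : choiceType) (u v : I -> R) l : u =1 v -> nnsum u l -> nnsum v l.
Proof. by move=> /funext ->. Qed.

Lemma nnsum_uniq (I : choiceType) (u : I -> R) l l' : nnsum u l -> nnsum u l' -> l = l'.
Proof. by move=> [_ h] [_]; rewrite h => -[]. Qed.

Lemma nnsum_ge0 (I : choiceType) (u : I -> R) l : nnsum u l -> 0 <= l.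
Proof.
by move=> [u0 h]; rewrite -lee_fin -h; apply: esum_ge0 => i _; rewrite lee_fin.
Qed.

Lemma nnsumD (I : choiceType) (u v : I -> R) l l' : nnsum u l -> nnsum v l' ->
  nnsum (fun i => u i + v i) (l + l').
Proof.
move=> [u0 hu] [v0 hv]; split=> [i|]; first by rewrite addr_ge0.
rewrite EFinD -hu -hv -esumD//; try by move=> i _; rewrite lee_fin.
Qed.

Lemma nnsumZ (I : countType) (u : I -> R) l k : 0 <= k -> nnsum u l ->
  nnsum (fun i => k * u i) (k * l).
Proof.
move=> k0 [u0 hu]; split=> [i|]; first by rewrite mulr_ge0.
by rewrite EFinM -hu -ge0_esumZl// => i; rewrite lee_fin.
Qed.

Lemma nnsum_bounded (u : nat -> R) M : (forall n, 0 <= u n) ->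
  (forall N, \sum_(n < N) u n <= M) -> exists l, nnsum u l /\ l <= M.
Proof.
move=> u0 hM.
have h : (\esum_(n in [set: nat]) (u n)%:E <= M%:E)%E.
  rewrite -nneseries_esumT; last by move=> n; rewrite lee_fin.
  apply: lime_le; first by apply: is_cvg_nneseries => n _ _; rewrite lee_fin.
  by apply: nearW => N; rewrite big_mkord sumEFin lee_fin.
have f : (\esum_(n in [set: nat]) (u n)%:E)%E \is a fin_num.
  rewrite ge0_fin_numE; last by apply: esum_ge0 => n _; rewrite lee_fin.
  by rewrite (le_lt_trans h)// ltry.
exists (fine (\esum_(n in [set: nat]) (u n)%:E)%E); split.
  by split=> //; rewrite fineK.
by rewrite -lee_fin fineK.
Qed.

Lemma nnsum_recl (u : nat -> R) l : 0 <= u 0%N ->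
  nnsum (fun n => u n.+1) l -> nnsum u (u 0%N + l).
Proof.
move=> u00 [u0 hu].
have u0' n : 0 <= u n by case: n => // n; exact: u0.
split=> //; rewrite -nneseries_esumT; last by move=> n; rewrite lee_fin.
rewrite nneseries_recl//; last by move=> n _; rewrite lee_fin.
rewrite EFinD -hu -nneseries_esumT; last by move=> n; rewrite lee_fin.
rewrite -(@nneseries_addn R (fun n => (u n)%:E) 1); last by move=> n; rewrite lee_fin.
by congr (_ + _)%E; apply: eq_eseriesr => n _; rewrite addn1.
Qed.

Lemma nnsum_addn (u : nat -> R) l N : (forall n, (n < N)%N -> u n = 0) ->
  nnsum (fun n => u (N + n)%N) l -> nnsum u l.
Proof.
elim: N u => [|N IH] u uN h; first exact: h.
rewrite -[l]add0r -[X in X + _](uN 0%N)//.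
apply: nnsum_recl; first by rewrite uN.
by apply: IH => // n nN; exact: uN.
Qed.

Lemma nnsum_pair (I J : countType) (u : I -> J -> R) (h : I -> R) l :
  (forall i, nnsum (u i) (h i)) -> nnsum h l -> nnsum (fun x : I * J => u x.1 x.2) l.
Proof.
move=> uh [_ hl]; split=> [x|]; first by have [] := uh x.1.
rewrite -hl.
have -> : (\esum_(x in [set: I * J]) (u x.1 x.2)%:E =
   \esum_(i in [set: I]) (\esum_(j in [set: J]) (u i j)%:E))%E.
  rewrite (@esum_esum R _ _ setT (fun=> setT) (fun i j => (u i j)%:E)); last first.
    by move=> i j _ _; rewrite lee_fin; have [] := uh i.
  by congr esum; apply/seteqP.
by apply: eq_esum => i _; have [] := uh i.
Qed.

End nnsum_theory.

(** * Green function and first passage series of the walk *)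

Section walk.
Variables (R : realType) (lam b v : R) (k : nat).
Hypotheses (lam0 : 0 < lam) (b0 : 0 < b) (v0 : 0 < v) (k0 : (0 < k)%N).
Local Notation c := (lam + b).

Let cv0 : 0 < c + v. Proof. by rewrite !addr_gt0. Qed.

(* Laplace transform of the probability that the free walk on the integers with
   steps [+k] (rate [lam]) and [-1] (rate [b]) has made [j] up-steps and [i]
   down-steps. *)
Definition walk_weight (j i : nat) : R :=
  'C(j + i, j)%:R * lam ^+ j * b ^+ i / (c + v) ^+ (j + i).+1.

Definition green_term (x y j : nat) : R :=
  if (y <= k * j + x)%N then walk_weight j (k * j + x - y) else 0.

Lemma green_term_ge0 x y j : 0 <= green_term x y j.
Proof.
rewrite /green_term; case: ifP => // _.
by rewrite divr_ge0 ?mulr_ge0 ?exprn_ge0// ltW.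
Qed.

(** First-step equation, which is Pascal's rule. A down-step leads to [x - 1]; by translation
    invariance it is written as raising the target to [y.+1], which keeps its meaning at [x = 0]. *)
Lemma green_term_recl x y j : (c + v) * green_term x y j =
  ((x == y) && (j == 0%N))%:R +
  lam * (if j is j'.+1 then green_term (x + k) y j' else 0) +
  b * green_term x y.+1 j.
Proof.
have cv1 : c + v != 0 by rewrite gt_eqF.
case: j => [|j].
  rewrite mulr0 addr0 andbT /green_term muln0 add0n.
  have [xy|yx|->] := ltngtP x y.
  - by rewrite !mulr0 addr0.
  - rewrite add0r /walk_weight !bin0 !expr0 !mul1r.
    have -> : (x - y = (x - y.+1).+1)%N by lia.
    rewrite !add0n !exprS; set X := _ ^+ _; set Y := _ ^+ _.
    have Y0 : Y != 0 by rewrite expf_neq0.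
    by field; rewrite cv1 Y0.
  - rewrite mulr0 addr0 subnn /walk_weight bin0 !expr0 !mul1r expr1.
    by rewrite divff.
rewrite andbF add0r /green_term.
have -> : (k * j.+1 + x = k * j + (x + k))%N by lia.
set N := (k * j + (x + k))%N.
have [yN|yN] := ltnP y N.
  rewrite ltnW// /walk_weight.
  have -> : (N - y = (N - y.+1).+1)%N by lia.
  set i := (N - y.+1)%N.
  have -> : (j.+1 + i.+1 = (j + i.+1).+1)%N by lia.
  have -> : (j.+1 + i = j + i.+1)%N by lia.
  rewrite binS natrD !exprS.
  set X := (c + v) ^+ (j + i.+1).
  have X0 : X != 0 by rewrite expf_neq0.
  move: X X0 => X X0; by field; rewrite cv1 X0.
rewrite mulr0 addr0; case: ifP => yN'; last by rewrite !mulr0.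
have -> : (N - y = 0)%N by lia.
rewrite /walk_weight !addn0 !binn !exprS expr0.
set X := (c + v) ^+ j.
have X0 : X != 0 by rewrite expf_neq0.
by field; rewrite cv1 X0.
Qed.

Lemma green_term_pred x y j : green_term x.+1 y.+1 j = green_term x y j.
Proof. by rewrite /green_term addnS ltnS subSS. Qed.

(** [1 / v] is a supersolution of the first-step equation, as [(c + v) / v = 1 + lam / v + b / v].
    An up-step lowers [J]; a down-step raises [y] and so lowers [D]; at [D = 0] the target is out of
    reach and all terms vanish. *)
Lemma sum_green_term_le J x y : \sum_(j < J) green_term x y j <= v^-1.
Proof.
elim: J x y => [|J IHJ] x y; first by rewrite big_ord0 invr_ge0 ltW.
have [D] : exists D, (k * J.+1 + x <= y + D)%N by exists (k * J.+1 + x)%N; lia.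
elim: D x y => [|D IHD] x y h.
  rewrite big1 ?invr_ge0 ?(ltW v0)// => j _; rewrite /green_term ifF//.
  by apply/negbTE; rewrite -ltnNge; have := ltn_ord j; nia.
have E : (c + v) * \sum_(j < J.+1) green_term x y j =
    (x == y)%:R + lam * \sum_(j < J) green_term (x + k) y j +
    b * \sum_(j < J.+1) green_term x y.+1 j.
  rewrite mulr_sumr; under eq_bigr do rewrite green_term_recl.
  rewrite !big_split/= -!mulr_sumr; congr (_ + _).
  rewrite big_ord_recl /= andbT big1 ?addr0; last by move=> j _; rewrite andbF.
  by congr (_ + _ * _); rewrite big_ord_recl add0r.
rewrite -(ler_pM2l cv0) E.
have h1 : (x == y)%:R <= 1 :> R by case: (x == y).
have h2 := IHJ (x + k)%N y.
have h3 : \sum_(j < J.+1) green_term x y.+1 j <= v^-1 by apply: IHD; lia.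
have -> : (c + v) / v = 1 + lam / v + b / v by field; rewrite gt_eqF.
by rewrite !lerD// ler_pM2l.
Qed.

Definition green (x y : nat) : R :=
  fine (\esum_(j in [set: nat]) (green_term x y j)%:E)%E.

Lemma greenP x y : nnsum (green_term x y) (green x y).
Proof.
have [l [h _]] := nnsum_bounded (@green_term_ge0 x y) (fun J => sum_green_term_le J x y).
by have [h1 h2] := h; rewrite /green h2.
Qed.

Lemma green_le x y : green x y <= v^-1.
Proof.
have [l [h lv]] := nnsum_bounded (@green_term_ge0 x y) (fun J => sum_green_term_le J x y).
by rewrite (nnsum_uniq (greenP x y) h).
Qed.

Lemma green_ge0 x y : 0 <= green x y.
Proof. exact: nnsum_ge0 (greenP x y). Qed.

Lemma green_pred x y : green x.+1 y.+1 = green x y.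
Proof. by rewrite /green; congr fine; apply: eq_esum => j _; rewrite green_term_pred. Qed.

Lemma green_recl x y :
  (c + v) * green x y = (x == y)%:R + lam * green (x + k) y + b * green x y.+1.
Proof.
apply: (nnsum_uniq (nnsumZ (ltW cv0) (greenP x y))).
apply: (@eq_nnsum _ _ (fun j => (((x == y) && (j == 0%N))%:R +
  (if j is j'.+1 then lam * green_term (x + k) y j' else 0)) +
  b * green_term x y.+1 j)).
  by move=> j; rewrite green_term_recl; case: j => // ; rewrite mulr0.
apply: nnsumD; last exact: nnsumZ (ltW b0) (greenP _ _).
have := @nnsum_recl R (fun j => ((x == y) && (j == 0%N))%:R +
  (if j is j'.+1 then lam * green_term (x + k) y j' else 0)) (lam * green (x + k) y).
rewrite /= andbT addr0; apply; first exact: ler0n.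
apply: (@eq_nnsum _ _ (fun j => lam * green_term (x + k) y j)); last first.
  exact: nnsumZ (ltW lam0) (greenP _ _).
by move=> j; rewrite andbF add0r.
Qed.

(* Coefficients of [z^m], where [z] is the Laplace transform of the first passage
   time of the walk one level down. *)
Definition passage_coef (m r : nat) : R :=
  if m == 0%N then (r == 0%N)%:R
  else m%:R / (m + r * k.+1)%:R * 'C(m + r * k.+1, r)%:R.

Definition passage_term (m r : nat) : R :=
  passage_coef m r * lam ^+ r * b ^+ (m + r * k) / (c + v) ^+ (m + r * k.+1).

Lemma passage_coef_ge0 m r : 0 <= passage_coef m r.
Proof. by rewrite /passage_coef; case: ifP => _ //; rewrite mulr_ge0 ?divr_ge0. Qed.

Lemma passage_term_ge0 m r : 0 <= passage_term m r.
Proof.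
by rewrite divr_ge0 ?exprn_ge0 ?(ltW cv0)// !mulr_ge0 ?exprn_ge0 ?passage_coef_ge0// ltW.
Qed.

(** First-step decomposition of ballot numbers: a descent of [m + 1] levels starts with a down-step,
    leaving [m] levels, or with an up-step, leaving [m + 1 + k] levels and one up-step fewer.
    Algebraically, both binomials on the right are multiples of the one on the left. *)
Lemma passage_coef_recl m r : passage_coef m.+1 r =
  passage_coef m r + (if r is r'.+1 then passage_coef (m.+1 + k) r' else 0).
Proof.
have nz (n : nat) : n.+1%:R != 0 :> R by rewrite pnatr_eq0.
case: r => [|r].
  rewrite /passage_coef/= addr0 mul0n addn0 bin0 mulr1 divff//.
  by case: m => [|m] //=; rewrite addn0 bin0 mulr1 divff.
rewrite /passage_coef /=.
pose N := (m + r * k.+1 + k)%N.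
have -> : (m.+1 + r.+1 * k.+1 = N.+2)%N by rewrite /N; lia.
have -> : (m.+1 + k + r * k.+1 = N.+1)%N by rewrite /N; lia.
have -> : (m + r.+1 * k.+1 = N.+1)%N by rewrite /N; lia.
have h1 : r.+1%:R * 'C(N.+2, r.+1)%:R = N.+2%:R * 'C(N.+1, r)%:R :> R.
  by rewrite -!natrM -mul_bin_diag.
have h2 : (N.+2 - r.+1)%:R * 'C(N.+2, r.+1)%:R = N.+2%:R * 'C(N.+1, r.+1)%:R :> R.
  by rewrite -!natrM -mul_bin_down.
have rN : (r.+1 <= N.+2)%N by rewrite /N; lia.
have -> : (if m == 0%N then 0 else m%:R / N.+1%:R * 'C(N.+1, r.+1)%:R) =
    m%:R / N.+1%:R * 'C(N.+1, r.+1)%:R :> R.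
  by case: (m) => [|m'] //=; rewrite !mul0r.
move: h1 h2; rewrite natrB//.
have eN : N%:R = m%:R + r%:R * (k%:R + 1) + k%:R :> R.
  by rewrite /N !natrD natrM -natr1.
set C2 := 'C(N.+2, r.+1)%:R; set C1 := 'C(N.+1, r)%:R; set C1' := 'C(N.+1, r.+1)%:R.
move=> h1 h2.
have -> : C1 = r.+1%:R * C2 / N.+2%:R by rewrite h1 mulrAC divff ?mul1r.
have -> : C1' = (N.+2%:R - r.+1%:R) * C2 / N.+2%:R by rewrite h2 mulrAC divff ?mul1r.
have n1 := nz N; have n2 := nz N.+1.
move: n1 n2; rewrite natrD -!natr1 eN => n1 n2.
by field; rewrite n1 n2.
Qed.

Lemma passage_term_recl m r : (c + v) * passage_term m.+1 r =
  b * passage_term m r +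
  lam * (if r is r'.+1 then passage_term (m.+1 + k) r' else 0).
Proof.
have cv1 : c + v != 0 by rewrite gt_eqF.
rewrite /passage_term passage_coef_recl.
case: r => [|r].
  rewrite !mul0n !addn0 mulr0 !addr0 !exprS.
  set X := (c + v) ^+ m; have X0 : X != 0 by rewrite expf_neq0.
  by field; rewrite cv1 X0.
have -> : (m.+1 + r.+1 * k = (m + r.+1 * k).+1)%N by lia.
have -> : (m.+1 + k + r * k = (m + r.+1 * k).+1)%N by lia.
have -> : (m.+1 + r.+1 * k.+1 = (m + r.+1 * k.+1).+1)%N by lia.
have -> : (m.+1 + k + r * k.+1 = m + r.+1 * k.+1)%N by lia.
rewrite !exprS.
set X := (c + v) ^+ _; have X0 : X != 0 by rewrite expf_neq0.
by field; rewrite cv1 X0.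
Qed.

(** The discount of a single jump. Descending [m] levels takes at least [m] jumps, whence the bound
    [zeta ^+ m] and the summability over [m] needed for the reflection term. *)
Let zeta : R := c / (c + v).

Let zeta0 : 0 < zeta. Proof. by rewrite divr_gt0// addr_gt0. Qed.

Let zeta1 : zeta < 1. Proof. by rewrite ltr_pdivrMr// mul1r ltrDl. Qed.

Lemma passage_term0 r : passage_term 0 r = (r == 0%N)%:R.
Proof.
rewrite /passage_term /passage_coef/=; case: r => [|r]; last by rewrite !mul0r.
by rewrite !mul0n !addn0 !expr0 divr1 !mulr1.
Qed.

Lemma sum_passage_term_le N m : \sum_(r < N) passage_term m r <= zeta ^+ m.
Proof.
elim: N m => [|N IHN] m; first by rewrite big_ord0 exprn_ge0// ltW.
elim: m => [|m IHm].
  by rewrite big_ord_recl passage_term0 big1 ?addr0// => r _; rewrite passage_term0.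
have E : (c + v) * \sum_(r < N.+1) passage_term m.+1 r =
    b * \sum_(r < N.+1) passage_term m r + lam * \sum_(r < N) passage_term (m.+1 + k) r.
  rewrite mulr_sumr; under eq_bigr do rewrite passage_term_recl.
  rewrite big_split/= -!mulr_sumr; congr (_ + _ * _).
  by rewrite big_ord_recl add0r.
rewrite -(ler_pM2l cv0) E.
have -> : (c + v) * zeta ^+ m.+1 = b * zeta ^+ m + lam * zeta ^+ m.
  rewrite exprS /zeta mulrA mulrCA divff ?gt_eqF// mulr1 -mulrDl [b + lam]addrC; ring.
apply: lerD; rewrite ler_pM2l//.
apply: le_trans (IHN _) _.
rewrite addSnnS exprD ler_piMr ?exprn_ge0 ?(ltW zeta0)//.
by rewrite exprn_ile1// ltW.
Qed.

Definition passage (m : nat) : R :=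
  fine (\esum_(r in [set: nat]) (passage_term m r)%:E)%E.

Lemma passageP m : nnsum (passage_term m) (passage m).
Proof.
have [l [h _]] := nnsum_bounded (passage_term_ge0 m) (fun J => sum_passage_term_le J m).
by have [h1 h2] := h; rewrite /passage h2.
Qed.

Lemma passage_le m : passage m <= zeta ^+ m.
Proof.
have [l [h lv]] := nnsum_bounded (passage_term_ge0 m) (fun J => sum_passage_term_le J m).
by rewrite (nnsum_uniq (passageP m) h).
Qed.

Lemma passage_ge0 m : 0 <= passage m.
Proof. exact: nnsum_ge0 (passageP m). Qed.

Lemma passage0 : passage 0 = 1.
Proof.
apply: (nnsum_uniq (passageP 0)).
have h : nnsum (fun=> 0 : R) (0 : R) by split=> // ; rewrite esum1.
have := @nnsum_recl R (passage_term 0) 0 (passage_term_ge0 0 0).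
rewrite passage_term0 addr0; apply.
by apply: (@eq_nnsum _ _ (fun=> 0)) => // r; rewrite passage_term0.
Qed.

Lemma passage_recl m :
  (c + v) * passage m.+1 = b * passage m + lam * passage (m.+1 + k).
Proof.
apply: (nnsum_uniq (nnsumZ (ltW cv0) (passageP _))).
apply: (@eq_nnsum _ _ (fun r => b * passage_term m r +
  (if r is r'.+1 then lam * passage_term (m.+1 + k) r' else 0))).
  by move=> r; rewrite passage_term_recl; case: r => //; rewrite mulr0.
apply: nnsumD; first exact: nnsumZ (ltW b0) (passageP _).
have := @nnsum_recl R (fun r =>
  (if r is r'.+1 then lam * passage_term (m.+1 + k) r' else 0)) (lam * passage (m.+1 + k)).
rewrite add0r; apply => //.
exact: nnsumZ (ltW lam0) (passageP _).
Qed.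

Let sum_passage_le x N : \sum_(m < N) passage (m + x) <= (1 - zeta)^-1.
Proof.
have z1 : 0 < 1 - zeta by rewrite subr_gt0.
apply: (@le_trans _ _ (\sum_(m < N) zeta ^+ m)).
  apply: ler_sum => m _; apply: le_trans (passage_le _) _.
  by rewrite exprD ler_piMr ?exprn_ge0 ?(ltW zeta0)// exprn_ile1// ltW.
rewrite -[leRHS]mul1r ler_pdivlMr//.
have : (1 - zeta) * \sum_(m < N) zeta ^+ m = 1 - zeta ^+ N.
  have h := subrX1 zeta N; rewrite -[RHS]opprB h; ring.
by rewrite mulrC => ->; rewrite gerBl exprn_ge0// ltW.
Qed.

(* [passage_tail x.+1 / b] is the Laplace transform of the probability of the
   empty queue, started with [x] phases of service. *)
Definition passage_tail (x : nat) : R :=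
  fine (\esum_(m in [set: nat]) (passage (m + x))%:E)%E.

Lemma passage_tailP x : nnsum (fun m => passage (m + x)) (passage_tail x).
Proof.
have [l [h _]] := nnsum_bounded (fun m => passage_ge0 (m + x)) (sum_passage_le x).
by have [h1 h2] := h; rewrite /passage_tail h2.
Qed.

Lemma passage_tail_le x : passage_tail x <= (1 - zeta)^-1.
Proof.
have [l [h lv]] := nnsum_bounded (fun m => passage_ge0 (m + x)) (sum_passage_le x).
by rewrite (nnsum_uniq (passage_tailP x) h).
Qed.

Lemma passage_tail_ge0 x : 0 <= passage_tail x.
Proof. exact: nnsum_ge0 (passage_tailP x). Qed.

Lemma passage_tailS x : passage_tail x = passage x + passage_tail x.+1.
Proof.
apply: (nnsum_uniq (passage_tailP x)).
have := @nnsum_recl R (fun m => passage (m + x)) (passage_tail x.+1) (passage_ge0 _).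
rewrite add0n; apply.
by apply: (@eq_nnsum _ _ _ _ _ _ (passage_tailP x.+1)) => m; rewrite addnS.
Qed.

Lemma passage_tail_recl x : (c + v) * passage_tail x.+1 =
  b * passage_tail x + lam * passage_tail (x.+1 + k).
Proof.
apply: (nnsum_uniq (nnsumZ (ltW cv0) (passage_tailP _))).
apply: (@eq_nnsum _ _ (fun m => b * passage (m + x) + lam * passage (m + (x.+1 + k)))).
  by move=> m; rewrite addnS passage_recl addnA addnS.
apply: nnsumD; first exact: nnsumZ (ltW b0) (passage_tailP _).
exact: nnsumZ (ltW lam0) (passage_tailP _).
Qed.

(** The second factor is fixed by reflection. Extended to level -1, with [green 0 y.+1] for the
    Green function there and [passage_tail 0 = 1 + passage_tail 1], the formula takes the same value
    at -1 and at 0, so the down-step at 0 cancels. *)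
Definition resolvent (x y : nat) : R :=
  green x y + passage_tail x.+1 * (green 0 y - green 0 y.+1).

Lemma resolventS x y : v * resolvent x.+1 y = (x.+1 == y)%:R +
  lam * (resolvent (x.+1 + k) y - resolvent x.+1 y) + b * (resolvent x y - resolvent x.+1 y).
Proof.
have := green_recl x.+1 y; rewrite green_pred => h1.
have h2 := passage_tail_recl x.+1.
rewrite /resolvent.
have -> : v * (green x.+1 y + passage_tail x.+2 * (green 0 y - green 0 y.+1)) =
  (c + v) * green x.+1 y + (c + v) * passage_tail x.+2 * (green 0 y - green 0 y.+1) -
  c * (green x.+1 y + passage_tail x.+2 * (green 0 y - green 0 y.+1)) by ring.
by rewrite h1 h2 -addSn; ring.
Qed.

Lemma resolvent0 y : v * resolvent 0 y = (0%N == y)%:R +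
  lam * (resolvent k y - resolvent 0 y).
Proof.
have h1 := green_recl 0 y; rewrite add0n in h1.
have h2 := passage_tail_recl 0.
have h3 := passage_tailS 0; rewrite passage0 in h3.
rewrite /resolvent.
have -> : v * (green 0 y + passage_tail 1 * (green 0 y - green 0 y.+1)) =
  (c + v) * green 0 y + (c + v) * passage_tail 1 * (green 0 y - green 0 y.+1) -
  c * (green 0 y + passage_tail 1 * (green 0 y - green 0 y.+1)) by ring.
by rewrite h1 h2 h3 add1n; ring.
Qed.

Lemma resolvent_bounded y : exists M, forall x, `|resolvent x y| <= M.
Proof.
exists (v^-1 + (1 - zeta)^-1 * v^-1) => x.
have g0 := green_ge0; have gv := green_le.
apply: le_trans (ler_normD _ _) _; apply: lerD; first by rewrite ger0_norm.
rewrite normrM ger0_norm ?passage_tail_ge0//; apply: ler_pM => //.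
- exact: passage_tail_ge0.
- exact: passage_tail_le.
have h1 := gv 0%N y; have h2 := gv 0%N y.+1; have h3 := g0 0%N y; have h4 := g0 0%N y.+1.
by rewrite ler_norml; lra.
Qed.

End walk.

(** * Continuous-time Markov chains *)

Lemma ge0_integral_shift (R : realType) (G : R -> R) (a : R) :
  continuous G -> (forall x, 0 <= G x) ->
  (\int[lebesgue_measure]_(x in `[a, +oo[) (G x)%:E =
   \int[lebesgue_measure]_(x in `[0%R, +oo[) (G (x + a))%:E)%E.
Proof.
move=> cG G0.
have dF (t : R) : is_derive t 1 (fun t : R => t + a) (1 + 0).
  exact: (is_deriveD (is_derive_id (t : R^o) 1) (is_derive_cst a t 1)).
have dFE : derive1 (fun t : R => t + a) = cst 1.
  by apply/funext => t; rewrite derive1E; have [_ ->] := dF t; rewrite addr0.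
rewrite (_ : `[a, +oo[%classic = `[(0 + a)%R, +oo[%classic); last by rewrite add0r.
rewrite (@increasing_ge0_integration_by_substitutiony R (fun t => t + a) G 0).
- by apply: eq_integral => t _; rewrite dFE; congr EFin; exact: mulr1.
- by move=> s t _ _ st; rewrite ltrD2r.
- by move=> t _; rewrite dFE; exact: cst_continuous.
- by rewrite dFE; exact: is_cvg_cst.
- by rewrite dFE; exact: is_cvg_cst.
- split; first by move=> t _; have [] := dF t.
  apply: cvg_at_right_filter.
  by apply: cvgD; [exact: cvg_id|exact: cvg_cst].
- by apply: cvg_addrr.
- exact: continuous_subspaceT.
- by move=> t _; exact: G0.
Qed.

Section resolvent.
Variables (R : realType) (I : countType) (q : I -> I -> R) (p : R -> I -> I -> R).
Hypothesis hp : transition_function q p.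
Local Notation mu := (@lebesgue_measure R).

Let p_ge0 t x y : 0 <= t -> 0 <= p t x y.
Proof. by case: hp => h _ _ _ _; exact: h. Qed.

Let p_sum t x : 0 <= t -> (\esum_(y in [set: I]) (p t x y)%:E = 1)%E.
Proof. by case: hp => _ h _ _ _; exact: h. Qed.

Let p_init x y : p 0 x y = (x == y)%:R.
Proof. by case: hp => _ _ h _ _; exact: h. Qed.

Let p_chapman s t x z : 0 <= s -> 0 <= t ->
  ((p (s + t) x z)%:E = \esum_(y in [set: I]) (p s x y * p t y z)%:E)%E.
Proof. by case: hp => _ _ _ h _; exact: h. Qed.

Let p_generator x y : (p h x y - p 0 x y) / h @[h --> 0^'+] --> generator q x y.
Proof. by case: hp => _ _ _ _ h; exact: h. Qed.

Let esum_seq (s : seq I) (f : I -> R) : uniq s -> (forall i, 0 <= f i) ->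
  (\esum_(i in [set` s]) (f i)%:E = (\sum_(i <- s) f i)%:E)%E.
Proof.
move=> us f0; rewrite esum_fset; first by rewrite -fsbig_seq// sumEFin.
  exact: finite_seq.
by move=> i _; rewrite lee_fin.
Qed.

Let esum_split (s : seq I) (f : I -> R) : uniq s -> (forall i, 0 <= f i) ->
  (\esum_(i in [set: I]) (f i)%:E =
   (\sum_(i <- s) f i)%:E + \esum_(i in ~` [set` s]) (f i)%:E)%E.
Proof.
move=> us f0; rewrite (esumID [set` s]); last by move=> i _; rewrite lee_fin.
by rewrite !setTI esum_seq.
Qed.

Lemma transition_sum_le1 (s : seq I) t x : uniq s -> 0 <= t ->
  \sum_(z <- s) p t x z <= 1.
Proof.
move=> us t0; rewrite -lee_fin -(p_sum x t0) (esum_split us); last first.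
  by move=> i; exact: p_ge0.
by rewrite leeDl// esum_ge0// => i _; rewrite lee_fin p_ge0.
Qed.

Lemma transition_le1 t x y : 0 <= t -> p t x y <= 1.
Proof.
by move=> t0; have := @transition_sum_le1 [:: y] t x isT t0; rewrite big_seq1.
Qed.

(** The omitted part of the Chapman-Kolmogorov sum is nonnegative and, as [p t z y <= 1], at most
    the mass that [p h x] puts outside [s]. *)
Lemma chapman_bounds (s : seq I) h t x y : uniq s -> 0 <= h -> 0 <= t ->
  0 <= p (h + t) x y - \sum_(z <- s) p h x z * p t z y <= 1 - \sum_(z <- s) p h x z.
Proof.
move=> us h0 t0.
have f0 z : 0 <= p h x z * p t z y by rewrite mulr_ge0// p_ge0.
have e0 : (0 <= \esum_(i in ~` [set` s]) (p h x i * p t i y)%:E)%E.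
  by apply: esum_ge0 => i _; rewrite lee_fin.
have hE := p_chapman x y h0 t0; rewrite (esum_split us f0) in hE.
apply/andP; split; rewrite -lee_fin EFinB hE addeAC subee// add0e//.
have h1 := p_sum x h0; rewrite (esum_split us (fun i => p_ge0 x i h0)) in h1.
rewrite EFinB -h1 addeAC subee// add0e.
apply: le_esum => i _; rewrite lee_fin ler_piMr ?p_ge0//.
exact: transition_le1.
Qed.

(** The truncation to the single state [x]. The bound is free of [t], so the limit of [p h x x] at 0
    yields continuity at all times. *)
Lemma transition_diff_le h t x y : 0 <= h -> 0 <= t ->
  `|p (h + t) x y - p t x y| <= 1 - p h x x.
Proof.
move=> h0 t0; have := @chapman_bounds [:: x] h t x y isT h0 t0.
rewrite !big_seq1 => /andP[h1 h2].
have h3 := transition_le1 x x h0; have h4 := p_ge0 x x h0.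
have h5 := transition_le1 x y t0; have h6 := p_ge0 x y t0.
by rewrite ler_norml; apply/andP; split; nra.
Qed.

Lemma transition_diag_cvg x : p h x x @[h --> 0^'+] --> (1 : R).
Proof.
have h1 : (p h x x - p 0 x x) / h * h @[h --> 0^'+] --> generator q x x * 0.
  by apply: cvgM; [exact: p_generator|exact/cvg_at_right_filter/cvg_id].
have h2 : ((p h x x - p 0 x x) / h * h + 1) @[h --> 0^'+] --> generator q x x * 0 + 1.
  by apply: cvgD => //; exact: cvg_cst.
rewrite mulr0 add0r in h2; apply: cvg_trans h2; apply: near_eq_cvg.
near=> h; have h0 : h != 0.
  by rewrite gt_eqF//; near: h; exact: nbhs_right_gt.
by rewrite divfK// p_init eqxx subrK.
Unshelve. all: by end_near. Qed.

(** Freezing [p] at negative times gives a function continuous on the whole line, which settles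
    measurability and allows a two-sided derivative at 0. *)
Definition transition0 x y (t : R) : R := p (Num.max 0 t) x y.

Lemma transition0_continuous x y : continuous (transition0 x y).
Proof.
move=> t; apply/cvgrPdist_le => e e0.
have /cvgrPdist_le/(_ _ e0)[r /= r0 hr] := @transition_diag_cvg x.
have key d s : 0 <= d -> d < r -> 0 <= s -> `|p (d + s) x y - p s x y| <= e.
  rewrite le_eqVlt => /orP[/eqP<-|d0] dr s0.
    by rewrite add0r subrr normr0 ltW.
  apply: le_trans (transition_diff_le x y (ltW d0) s0) _.
  have := hr d; rewrite /= sub0r normrN gtr0_norm// => /(_ dr d0).
  by rewrite ger0_norm// subr_ge0 transition_le1// ltW.
near=> u.
have ur : `|t - u| < r by near: u; exact: (@cvgr_dist_lt _ _ _ _ _ id t cvg_id).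
rewrite /transition0.
have m0 a : 0 <= Num.max 0 a :> R by rewrite le_max lexx.
have dm (a b : R) : a <= b -> Num.max 0 b - Num.max 0 a <= b - a.
  by move=> ab; case: (leP 0 a); case: (leP 0 b); lra.
have mono (a b : R) : a <= b -> Num.max 0 a <= Num.max 0 b.
  by move=> ab; case: (leP 0 a); case: (leP 0 b); lra.
have [tu|ut] := leP t u.
  have h := key (Num.max 0 u - Num.max 0 t) (Num.max 0 t).
  rewrite subrK subr_ge0 in h; rewrite distrC; apply: h => //; first exact: mono.
  apply: le_lt_trans (dm _ _ tu) _; apply: le_lt_trans ur.
  by rewrite distrC ler_norm.
have h := key (Num.max 0 t - Num.max 0 u) (Num.max 0 u).
rewrite subrK subr_ge0 in h; apply: h => //; first exact/mono/ltW.
apply: le_lt_trans (dm _ _ (ltW ut)) _; apply: le_lt_trans ur.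
exact: ler_norm.
Unshelve. all: by end_near. Qed.

Lemma transition0_ge0 x y t : 0 <= transition0 x y t.
Proof. by apply: p_ge0; rewrite le_max lexx. Qed.

Lemma transition0_le1 x y t : transition0 x y t <= 1.
Proof. by apply: transition_le1; rewrite le_max lexx. Qed.

Lemma transition0E x y t : 0 <= t -> transition0 x y t = p t x y.
Proof. by move=> t0; rewrite /transition0 max_r. Qed.

Section laplace.
Variable v : R.
Hypothesis v0 : 0 < v.

Definition transition_laplace x y : R :=
  fine (\int[mu]_(t in `[0%R, +oo[) (expR (- (v * t)) * transition0 x y t)%:E)%E.

Let intE : (\int[mu]_(t in `[0%R, +oo[) (expR (- (v * t)))%:E = (v^-1)%:E)%E.
Proof.
have := @integral_expRN_exprn R 0 v v0; rewrite fact0 expr1 mul1r => <-.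
by apply: eq_integral => t _; rewrite expr0 mulr1.
Qed.

Let continuous_f x y : continuous (fun t => expR (- (v * t)) * transition0 x y t).
Proof.
move=> t; apply: (@continuousM R _ (fun t => expR (- (v * t))) (transition0 x y)).
  exact: continuous_expRN.
exact: transition0_continuous.
Qed.

Let f_ge0 x y t : 0 <= expR (- (v * t)) * transition0 x y t.
Proof. by rewrite mulr_ge0 ?expR_ge0 ?transition0_ge0. Qed.

Let tail_le x y a : (\int[mu]_(t in `[a, +oo[) (expR (- (v * t)) * transition0 x y t)%:E <=
  (expR (- (v * a)) / v)%:E)%E.
Proof.
rewrite (@ge0_integral_shift R (fun t => expR (- (v * t)) * transition0 x y t))//.
have mE : measurable_fun (`[0%R, +oo[%classic : set R) (fun t : R => (expR (- (v * t)))%:E).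
  by apply/measurable_EFinP; exact: measurable_expRN.
have E0 : (0 <= (expR (- (v * a)))%:E)%E by rewrite lee_fin expR_ge0.
have E1 (t : R) : `[0%R, +oo[%classic t -> (0 <= (expR (- (v * t)))%:E)%E.
  by rewrite lee_fin expR_ge0.
rewrite EFinM -intE -ge0_integralZl//.
apply: ge0_le_integral => //.
- by move=> t _; rewrite lee_fin.
- apply/measurable_EFinP; apply: measurable_funTS; apply: continuous_measurable_fun.
  move=> t; apply: (@continuous_comp _ _ _ (fun t => t + a)
    (fun t => expR (- (v * t)) * transition0 x y t)); last exact: continuous_f.
  by apply: cvgD; [exact: cvg_id|exact: cvg_cst].
- apply: emeasurable_funM => //; apply/measurable_EFinP; exact: measurable_expRN.
move=> t _; rewrite -EFinM lee_fin -expRD.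
have -> : - (v * a) + - (v * t) = - (v * (t + a)) by ring.
by rewrite ler_piMr ?expR_ge0// transition0_le1.
Qed.

Let tail_fin x y a :
  (\int[mu]_(t in `[a, +oo[) (expR (- (v * t)) * transition0 x y t)%:E)%E \is a fin_num.
Proof.
rewrite ge0_fin_numE; last by apply: integral_ge0 => t _; rewrite lee_fin.
by apply: le_lt_trans (tail_le x y a) _; rewrite ltry.
Qed.

Lemma transition_laplaceE x y :
  (\int[mu]_(t in `[0%R, +oo[) (expR (- (v * t)) * transition0 x y t)%:E =
   (transition_laplace x y)%:E)%E.
Proof. by rewrite fineK. Qed.

Lemma transition_laplace_ge0 x y : 0 <= transition_laplace x y.
Proof. by rewrite fine_ge0// integral_ge0// => t _; rewrite lee_fin. Qed.

Lemma transition_laplace_le x y : transition_laplace x y <= v^-1.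
Proof.
rewrite -lee_fin -transition_laplaceE; apply: le_trans (tail_le x y 0) _.
by rewrite mulr0 oppr0 expR0 mul1r.
Qed.

Section backward.
Variables (s : seq I) (x y : I).
Hypotheses (us : uniq s) (xs : x \in s).
Hypothesis gen0 : \sum_(z <- s) generator q x z = 0.
Local Notation pi := transition_laplace.
Local Notation f := (fun t => expR (- (v * t)) * transition0 x y t).

(** Starting at -1 makes 0 an interior point for the fundamental theorem. [A h] below is the Laplace
    integral of [p] shifted by [h], rewritten as a tail of the unshifted one so that it can be
    differentiated in [h]. *)
Let G (u : R) : R := (\int[mu]_(t in [set` Interval (BLeft (-1)) (BRight u)]) f t)%R.
Let Tot : R := (\int[mu]_(t in [set` Interval (BLeft (-1)) +oo%O]) f t)%R.
Let A (h : R) : R := expR (v * h) * (Tot - G h).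

Let mf D : measurable_fun D f.
Proof.
by apply: measurable_funTS; apply: continuous_measurable_fun; exact: continuous_f.
Qed.

Let i1 : mu.-integrable `[(-1)%R, +oo[ (EFin \o f).
Proof.
apply: (@ge0_fin_integrable _ _ _ _ _ _ _ _ _ _ (esym (fineK (tail_fin x y (-1))))) => //.
exact: mf.
Qed.

Let tailE h : 0 <= h -> (\int[mu]_(t in `[h, +oo[) (f t)%:E)%E = (Tot - G h)%:E.
Proof.
move=> h0; have h1 : (BLeft (-1 : R) <= BRight h)%O by rewrite bnd_simp; lra.
have := @Rintegral_itvB R f (BLeft (-1)) +oo%O h i1 h1 isT.
rewrite -/Tot -/(G h) => ->.
rewrite Rintegral_itv_obnd_cbnd; last first.
  by apply: integrableS i1 => // t /=; rewrite !in_itv/= !andbT; lra.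
by rewrite /Rintegral fineK.
Qed.

Let AE h : 0 <= h ->
  (\int[mu]_(t in `[0%R, +oo[) (expR (- (v * t)) * transition0 x y (t + h))%:E)%E = (A h)%:E.
Proof.
move=> h0; rewrite /A EFinM -tailE//.
rewrite (@ge0_integral_shift R f)//.
rewrite -ge0_integralZl//.
- apply: eq_integral => t _; rewrite -EFinM mulrA -expRD; congr (expR _ * _)%:E; ring.
- apply/measurable_EFinP; apply: measurable_funTS; apply: continuous_measurable_fun.
  move=> t; apply: (@continuous_comp _ _ _ (fun t => t + h) f); last exact: continuous_f.
  by apply: cvgD; [exact: cvg_id|exact: cvg_cst].
- by move=> t _; rewrite lee_fin.
Qed.

Let A0 : A 0 = pi x y.
Proof.
apply: EFin_inj; rewrite -AE// -transition_laplaceE.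
by apply: eq_integral => t _; rewrite addr0.
Qed.

(** The product rule for [exp (v h) (Tot - G h)], where [f 0 = p 0 x y]. *)
Let dA : (A h - A 0) / h @[h --> 0^'+] --> v * pi x y - (x == y)%:R.
Proof.
have [dG GE] : derivable G 0 1 /\ derive1 G 0 = f 0.
  apply: (@continuous_FTC1 R f (BLeft (-1)) 0 1) => //.
  - apply: integrableS i1 => //; apply: subset_itvl; by rewrite bnd_simp.
  - exact: continuous_f.
have dG' : is_derive (0 : R) 1 G (f 0).
  by split; [exact: dG|rewrite -derive1E; exact: GE].
have dE : is_derive (0 : R) 1 (fun h => expR (v * h)) (expR (v * 0) * (v *: 1)).
  exact: (is_derive1_comp (is_derive_expR _) (is_deriveZ v (is_derive_id (0 : R^o) 1))).
have dB : is_derive (0 : R) 1 (fun h => Tot - G h) (0 - f 0).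
  exact: (is_deriveB (is_derive_cst Tot (0 : R) 1) dG').
have [dA dAE] := is_deriveM dE dB.
have -> : v * pi x y - (x == y)%:R = 'D_1 A 0.
  rewrite dAE /GRing.scale/= mulr0 expR0 /transition0 maxxx p_init -A0 /A mulr0 oppr0 expR0.
  ring.
apply: cvg_dnbhs_at_right; move: dA; rewrite /derivable -/(derive _ _ _).
apply: cvg_trans; apply: near_eq_cvg; apply: nearW => h.
by rewrite /= /GRing.scale/= mulr1 addr0 mulrC.
Qed.

Let S (h : R) : R := \sum_(z <- s) (p h x z - p 0 x z) / h * pi z y.
Let rest (h : R) : R := - \sum_(z <- s) (p h x z - p 0 x z) / h.

Let S_cvg : S h @[h --> 0^'+] --> \sum_(z <- s) generator q x z * pi z y.
Proof.
apply: cvg_big => //; first exact: add_continuous.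
by move=> z _; apply: cvgMr_tmp; exact: p_generator.
Qed.

Let rest_cvg : rest h / v @[h --> 0^'+] --> (0 : R).
Proof.
rewrite -[X in _ --> X](mul0r v^-1); apply: cvgMr_tmp.
rewrite [X in _ --> X](_ : _ = - \sum_(z <- s) generator q x z); last first.
  by rewrite gen0 oppr0.
apply: cvgN.
by apply: cvg_big => //; exact: add_continuous.
Qed.

Let sum_init (g : I -> R) : \sum_(z <- s) p 0 x z * g z = g x.
Proof.
rewrite (bigD1_seq x)//= p_init eqxx mul1r big1_seq ?addr0//.
by move=> z /andP[zx _]; rewrite p_init eq_sym (negbTE zx) mul0r.
Qed.

(** The truncated Chapman-Kolmogorov bounds, integrated against [exp (- (v * t))], whose integral is
    the factor [1 / v]. *)
Let A_bounds h : 0 < h -> 0 <= (A h - A 0) / h - S h <= rest h / v.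
Proof.
move=> h0; have h0' := ltW h0.
have SE : h * S h = \sum_(z <- s) p h x z * pi z y - A 0.
  rewrite A0 -(sum_init (fun z => pi z y)) /S mulr_sumr -sumrB; apply: eq_bigr => z _.
  by rewrite mulrA mulrCA divff ?gt_eqF// mulr1 mulrBl.
have rE : h * rest h = 1 - \sum_(z <- s) p h x z.
  have -> : 1 = \sum_(z <- s) p 0 x z.
    by rewrite -(sum_init (fun=> 1)); under [RHS]eq_bigr do rewrite -[p 0 x _]mulr1.
  rewrite /rest mulrN mulr_sumr -opprB -sumrB; congr (- _); apply: eq_bigr => z _.
  by rewrite mulrCA divff ?gt_eqF// mulr1.
suff : 0 <= A h - \sum_(z <- s) p h x z * pi z y <= h * rest h / v.
  have -> : A h - \sum_(z <- s) p h x z * pi z y = h * ((A h - A 0) / h - S h).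
    rewrite mulrBr SE mulrCA divff ?gt_eqF// mulr1; ring.
  by rewrite pmulr_rge0// -mulrA ler_pM2l.
rewrite rE.
have mfz (z : I) (D : set R) : measurable_fun D
    (fun t : R => (expR (- (v * t)) * transition0 z y t)%:E).
  apply/measurable_EFinP; apply: measurable_funTS.
  by apply: continuous_measurable_fun; exact: continuous_f.
have ph0 z : 0 <= p h x z by exact: p_ge0.
have mpz (z : I) (D : set R) : measurable_fun D
    (fun t : R => (p h x z * (expR (- (v * t)) * transition0 z y t))%:E).
  by apply/measurable_EFinP; apply: measurable_funM => //; apply/measurable_EFinP; exact: mfz.
have sumE : (\int[mu]_(t in `[0%R, +oo[)
    (\sum_(z <- s) (p h x z * (expR (- (v * t)) * transition0 z y t))%:E) =
    (\sum_(z <- s) p h x z * pi z y)%:E)%E.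
  rewrite ge0_integral_sum//.
  - rewrite -sumEFin; apply: eq_bigr => z _.
    under eq_integral do rewrite EFinM.
    rewrite ge0_integralZl//; first by rewrite transition_laplaceE.
    + exact: mfz.
    + by move=> t _; rewrite lee_fin.
    + by rewrite lee_fin.
  - by move=> z; exact: mpz.
  - by move=> z t _; rewrite lee_fin mulr_ge0.
have bnd t : 0 <= t ->
   \sum_(z <- s) p h x z * (expR (- (v * t)) * transition0 z y t) <=
   expR (- (v * t)) * transition0 x y (t + h) <=
   \sum_(z <- s) p h x z * (expR (- (v * t)) * transition0 z y t) +
     (1 - \sum_(z <- s) p h x z) * expR (- (v * t)).
  move=> t0; have /andP[b1 b2] := chapman_bounds x y us h0' t0.
  rewrite (transition0E x y (addr_ge0 t0 h0')) [t + h]addrC.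
  have -> : \sum_(z <- s) p h x z * (expR (- (v * t)) * transition0 z y t) =
     expR (- (v * t)) * \sum_(z <- s) p h x z * p t z y.
    by rewrite mulr_sumr; apply: eq_bigr => z _; rewrite transition0E// mulrCA.
  have e0 := expR_gt0 (- (v * t)).
  by apply/andP; split; [rewrite ler_pM2l// -subr_ge0|nra].
have msum (D : set R) : measurable_fun D (fun t : R =>
    (\sum_(z <- s) (p h x z * (expR (- (v * t)) * transition0 z y t))%:E)%E).
  by apply: emeasurable_sum => z; exact: mpz.
have mexp (D : set R) : measurable_fun D (fun t : R => (expR (- (v * t)))%:E).
  by apply/measurable_EFinP; exact: measurable_expRN.
have mA (D : set R) : measurable_fun D (fun t : R => (expR (- (v * t)) * transition0 x y (t + h))%:E).
  apply/measurable_EFinP; apply: measurable_funTS; apply: continuous_measurable_fun => t.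
  apply: (@continuousM R _ (fun t => expR (- (v * t))) (fun t => transition0 x y (t + h))).
    exact: continuous_expRN.
  apply: (@continuous_comp _ _ _ (fun t => t + h) (transition0 x y)); last exact: transition0_continuous.
  by apply: cvgD; [exact: cvg_id|exact: cvg_cst].
have r0 : 0 <= 1 - \sum_(z <- s) p h x z by rewrite subr_ge0 transition_sum_le1.
have s0 (t : R) : (0 <= \sum_(z <- s) (p h x z * (expR (- (v * t)) * transition0 z y t))%:E)%E.
  by rewrite sumEFin lee_fin sumr_ge0// => z _; rewrite mulr_ge0.
apply/andP; split.
  rewrite subr_ge0 -lee_fin -sumE -AE//.
  apply: ge0_le_integral => //; [exact: msum|exact: mA|].
  move=> t; rewrite /= in_itv/= andbT => t0; rewrite sumEFin lee_fin.
  by have /andP[] := bnd t t0.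
rewrite lerBlDl -lee_fin -AE// EFinD -sumE EFinM -intE.
rewrite -ge0_integralZl//; last exact: mexp.
rewrite -ge0_integralD//; last 2 first.
- by move=> t _; rewrite mule_ge0// lee_fin expR_ge0.
- by apply: emeasurable_funM => //; exact: mexp.
apply: ge0_le_integral => //.
- by move=> t _; rewrite lee_fin mulr_ge0 ?expR_ge0 ?transition0_ge0.
- exact: mA.
- apply: emeasurable_funD; first exact: msum.
  by apply: emeasurable_funM => //; exact: mexp.
move=> t; rewrite /= in_itv/= andbT => t0; rewrite sumEFin -EFinM -EFinD lee_fin.
by have /andP[] := bnd t t0.
exact: msum.
Qed.

(* Chapman-Kolmogorov truncated to [s] is off by at most [1 - \sum_(z <- s) p h x z],
   which is [o(h)] because the generator entries over [s] sum to zero. *)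
Lemma transition_laplace_backward :
  v * pi x y = (x == y)%:R + \sum_(z <- s) generator q x z * pi z y.
Proof.
have h1 : (A h - A 0) / h - S h @[h --> 0^'+] -->
    v * pi x y - (x == y)%:R - \sum_(z <- s) generator q x z * pi z y.
  by apply: cvgB; [exact: dA|exact: S_cvg].
have h2 : (A h - A 0) / h - S h @[h --> 0^'+] --> (0 : R).
  apply: (@squeeze_cvgr _ _ _ _ (fun=> 0) (fun h => rest h / v)) => //; last exact: cvg_cst.
  near=> h; apply: A_bounds.
  by near: h; exact: nbhs_right_gt.
have : v * pi x y - (x == y)%:R - \sum_(z <- s) generator q x z * pi z y = 0.
  exact: (cvg_unique (@norm_hausdorff _ R) h1 h2).
by move=> /eqP; rewrite subr_eq0 subr_eq => /eqP ->; rewrite addrC.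
Unshelve. all: by end_near. Qed.

End backward.

End laplace.
End resolvent.

Lemma generator_diag (R : realType) (I : countType) (q : I -> I -> R) (x : I) (s : seq I) :
  uniq s -> x \notin s -> (forall z, 0 <= q x z) ->
  (forall z, z != x -> z \notin s -> q x z = 0) ->
  generator q x x = - \sum_(z <- s) q x z.
Proof.
move=> us xs q0 qs; rewrite /generator eqxx.
rewrite (esumID [set` s]); last by move=> i _; rewrite lee_fin.
rewrite [X in (_ + X)%E]esum1 ?adde0; last first.
  by move=> z [/= /eqP zx /negP zs]; rewrite qs.
have -> : [set~ x] `&` [set` s] = [set` s].
  apply/seteqP; split=> [z []//|z /= zs]; split=> // zx.
  by move: xs; rewrite -zx zs.
rewrite esum_fset; [|exact: finite_seq|by move=> i _; rewrite lee_fin].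
by rewrite -fsbig_seq// sumEFin.
Qed.

Lemma transition_laplace_finite (R : realType) (I : countType) (q : I -> I -> R)
    (p : R -> I -> I -> R) (v : R) (s : seq I) (x y : I) :
  transition_function q p -> 0 < v ->
  uniq s -> x \notin s -> (forall z, 0 <= q x z) ->
  (forall z, z != x -> z \notin s -> q x z = 0) ->
  v * transition_laplace p v x y = (x == y)%:R +
    \sum_(z <- s) q x z * (transition_laplace p v z y - transition_laplace p v x y).
Proof.
move=> hp v0 us xs q0 qs.
have gE z : z \in s -> generator q x z = q x z.
  by move=> zs; rewrite /generator; case: eqP => // xz; move: xs; rewrite xz zs.
have gx := generator_diag us xs q0 qs.
rewrite (@transition_laplace_backward _ _ _ _ hp v v0 (x :: s) x y).
- rewrite big_cons gx; congr (_ + _).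
  rewrite mulNr mulr_suml addrC -sumrB big_seq [RHS]big_seq.
  by apply: eq_bigr => z zs; rewrite gE// mulrBr.
- by rewrite /= xs.
- by rewrite inE eqxx.
- by rewrite big_cons gx addrC big_seq (eq_bigr (q x))// -big_seq subrr.
Qed.

(** * The queue as a walk of remaining phases *)

Section queue.
Variables (R : realType) (lam mu : R) (k : nat).
Hypotheses (lam0 : 0 < lam) (mu0 : 0 < mu) (k0 : (0 < k)%N).
Local Notation b := (k%:R * mu).
Local Notation c := (lam + b).
Local Notation q := (queue_rate lam mu (k := k)).

Let b0 : 0 < b. Proof. by rewrite mulr_gt0// ltr0n. Qed.

Definition after_arrival (x : nat * nat) : nat * nat :=
  if x == (0, 0)%N then (1%N, k) else (x.1.+1, x.2).

Lemma valid_after_arrival x : valid_state k x -> valid_state k (after_arrival x).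
Proof.
rewrite /valid_state /after_arrival; case: eqP => [->|_] /=; first by rewrite k0 leqnn.
by case/and3P => _ -> ->.
Qed.

Lemma valid_after_service x : valid_state k x -> valid_state k (after_service k x).
Proof.
rewrite /valid_state /after_service; case: x => n s /=; rewrite -!pair_eqE/=.
case: n => [|n]; case: s => [|[|s]] //=; last by move=> h; exact: ltnW.
by case: n => [|n] //= _; rewrite k0 leqnn.
Qed.

(** The default [x] of [insubd] is never taken, since both updates preserve validity. *)
Definition arrival (x : state k) : state k := insubd x (after_arrival (val x)).
Definition service (x : state k) : state k := insubd x (after_service k (val x)).

Lemma val_arrival x : val (arrival x) = after_arrival (val x).
Proof. by rewrite /arrival val_insubd valid_after_arrival// (valP x). Qed.

Lemma val_service x : val (service x) = after_service k (val x).
Proof. by rewrite /service val_insubd valid_after_service// (valP x). Qed.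

(* Number of service phases left to complete. *)
Definition workload (x : nat * nat) : nat :=
  if x.1 == 0%N then 0%N else (k * x.1.-1 + x.2)%N.

(** Division by [k] with remainders [1, ..., k]: phases cannot compensate for a difference of one
    customer. *)
Lemma workload_valid_inj (x y : nat * nat) : valid_state k x -> valid_state k y ->
  workload x = workload y -> x = y.
Proof.
case: x y => [n s] [n' s']; rewrite /valid_state /workload -!pair_eqE /=.
case: n n' => [|n] [|n'] /=.
- by rewrite !orbF => /eqP -> /eqP ->.
- by move=> _ /andP[s0 _] h; move: h s0; lia.
- by move=> /andP[s0 _] _ h; move: h s0; lia.
move=> /andP[s0 sk] /andP[s0' sk'] h.
have [nn|nn|nn] := ltngtP n n'.
- have : (k * n.+1 <= k * n')%N by rewrite leq_mul2l nn orbT.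
  by rewrite mulnS; lia.
- have : (k * n'.+1 <= k * n)%N by rewrite leq_mul2l nn orbT.
  by rewrite mulnS; lia.
- by subst n'; congr pair; lia.
Qed.

Lemma workload_inj (x y : state k) : workload (val x) = workload (val y) -> x = y.
Proof. by move=> h; apply: val_inj; apply: workload_valid_inj h; exact: valP. Qed.

Lemma workload_after_arrival (x : nat * nat) : valid_state k x ->
  workload (after_arrival x) = (workload x + k)%N.
Proof.
case: x => n s; rewrite /valid_state /after_arrival /workload -!pair_eqE /=.
case: n => [|n] /=; first by case: s => //= _; rewrite muln0.
by move=> _; rewrite mulnS; lia.
Qed.

Lemma workload_after_service (x : nat * nat) : valid_state k x ->
  workload (after_service k x) = (workload x).-1.
Proof.
case: x => n s; rewrite /valid_state /after_service /workload -!pair_eqE /=.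
case: n => [|n]; first by case: s.
case: s => [|[|s]] //= _; last by lia.
by case: n => [|n] /=; rewrite ?mulnS; lia.
Qed.

Lemma workload_arrival (x : state k) :
  workload (val (arrival x)) = (workload (val x) + k)%N.
Proof. by rewrite val_arrival workload_after_arrival// (valP x). Qed.

Lemma workload_service (x : state k) :
  workload (val (service x)) = (workload (val x)).-1.
Proof. by rewrite val_service workload_after_service// (valP x). Qed.

Lemma workload_gt0 (x : state k) : val x != (0, 0)%N -> (0 < workload (val x))%N.
Proof.
rewrite lt0n; apply: contra => /eqP h; apply/eqP/workload_valid_inj => //.
exact: (valP x).
Qed.

Let queue_rateE (x y : state k) : q x y =
  if val x == (0, 0)%N then (if val y == (1%N, k) then lam else 0)
  else if val y == ((val x).1.+1, (val x).2) then lam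
  else if val y == after_service k (val x) then b else 0.
Proof. by []. Qed.

Lemma queue_rate_ge0 x y : 0 <= q x y.
Proof.
rewrite queue_rateE; have := ltW lam0; have := ltW b0.
by do !case: ifP.
Qed.

Lemma queue_rate_arrival x : q x (arrival x) = lam.
Proof.
rewrite queue_rateE val_arrival /after_arrival.
by case: (val x == (0, 0)%N); rewrite eqxx.
Qed.

(** [queue_rate] tests for an arrival first; the two targets differ since an arrival raises the
    workload and a service does not. *)
Lemma queue_rate_service x : val x != (0, 0)%N -> q x (service x) = b.
Proof.
move=> x0; rewrite queue_rateE (negbTE x0) val_service eqxx; case: eqP => // h.
have : val (service x) = val (arrival x).
  by rewrite val_service h val_arrival /after_arrival (negbTE x0).
move=> /val_inj /(congr1 (fun z => workload (val z))).
by rewrite workload_arrival workload_service; lia.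
Qed.

Lemma queue_rate_eq0 x z : z != arrival x -> (val x == (0, 0)%N) || (z != service x) ->
  q x z = 0.
Proof.
move=> /eqP za zs; rewrite queue_rateE; case: ifP => [x0|x0].
  case: eqP => // h; case: za; apply: val_inj.
  by rewrite h val_arrival /after_arrival x0.
case: eqP => h; first by case: za; apply: val_inj; rewrite h val_arrival /after_arrival x0.
case: eqP => // h'; move: zs; rewrite x0 /= => /eqP[].
by apply: val_inj; rewrite h' val_service.
Qed.

(* Both sides are bounded solutions of the backward equation, and the
   homogeneous equation contracts by the factor [c / (c + v)]. *)
Lemma queue_laplaceE (p : R -> state k -> state k -> R) (v : R) (x y : state k) :
  transition_function q p -> 0 < v ->
  transition_laplace p v x y = resolvent lam b v k (workload (val x)) (workload (val y)).
Proof.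
move=> hp v0; set pi := transition_laplace p v.
set res := resolvent lam b v k.
pose D x := pi x y - res (workload (val x)) (workload (val y)).
(* [service] fixes the empty state, so its term is 0 there and one equation covers all states. *)
have piE x' : v * pi x' y = (x' == y)%:R + lam * (pi (arrival x') y - pi x' y)
    + b * (pi (service x') y - pi x' y).
  have ax : x' != arrival x'.
    by apply/eqP => h; have := workload_arrival x'; rewrite -h; lia.
  have [x0|x0] := boolP (val x' == (0, 0)%N).
    rewrite /pi (@transition_laplace_finite _ _ _ _ v [:: arrival x'] x' y hp v0)//.
    - have -> : service x' = x' by apply: val_inj; rewrite val_service (eqP x0).
      by rewrite big_seq1 queue_rate_arrival subrr mulr0 addr0.
    - by rewrite inE.
    - by move=> z; exact: queue_rate_ge0.
    - by move=> z _; rewrite inE => za; rewrite queue_rate_eq0// x0.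
  have w0 := workload_gt0 x0.
  rewrite /pi (@transition_laplace_finite _ _ _ _ v [:: arrival x'; service x'] x' y hp v0)//.
  - by rewrite big_cons big_seq1 queue_rate_arrival queue_rate_service// addrA.
  - rewrite /= inE andbT; apply/eqP => /(congr1 (fun z => workload (val z))).
    by rewrite workload_arrival workload_service; lia.
  - rewrite !inE negb_or ax; apply/eqP => h.
    by have := workload_service x'; rewrite -h; lia.
  - by move=> z; exact: queue_rate_ge0.
  - by move=> z _; rewrite !inE negb_or => /andP[za zs]; rewrite queue_rate_eq0// zs orbT.
have resE x' : v * res x' (workload (val y)) = (x' == workload (val y))%:R +
    lam * (res (x' + k)%N (workload (val y)) - res x' (workload (val y))) +
    b * (res x'.-1 (workload (val y)) - res x' (workload (val y))).
  case: x' => [|x'] /=; last exact: resolventS.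
  by rewrite subrr mulr0 addr0 add0n; exact: resolvent0.
have DE x' : (c + v) * D x' = lam * D (arrival x') + b * D (service x').
  rewrite /D workload_arrival workload_service.
  have := piE x'; have := resE (workload (val x')).
  have -> : (workload (val x') == workload (val y)) = (x' == y).
    by apply/eqP/eqP => [/workload_inj//|->].
  by move=> h1 h2; rewrite mulrDl !mulrBr [v * pi _ _]h2 [v * res _ _]h1; ring.
have [M hM] : exists M, forall x', `|D x'| <= M.
  have [M hM] := resolvent_bounded lam0 b0 v0 k0 (workload (val y)).
  exists (v^-1 + M) => x'; apply: le_trans (ler_normB _ _) _; apply: lerD; last exact: hM.
  by rewrite ger0_norm ?(transition_laplace_ge0 hp)// (transition_laplace_le hp).
have M0 : 0 <= M by apply: le_trans (hM x).
have c0 : 0 < c by rewrite addr_gt0.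
have cv0 : 0 < c + v by rewrite addr_gt0.
pose rho := c / (c + v).
have bound n : forall x', `|D x'| <= rho ^+ n * M.
  elim: n => [|n IH] x'; first by rewrite expr0 mul1r.
  rewrite -(ler_pM2l cv0) exprS.
  have -> : (c + v) * (rho * rho ^+ n * M) = c * (rho ^+ n * M).
    by rewrite /rho; field; rewrite gt_eqF.
  rewrite -[X in X * `|_|](gtr0_norm cv0) -normrM DE.
  apply: le_trans (ler_normD _ _) _.
  rewrite (normrM lam) (normrM b) (gtr0_norm lam0) (gtr0_norm b0) mulrDl.
  have h1 := IH (arrival x'); have h2 := IH (service x').
  by apply: lerD; rewrite ler_pM2l.
have rho1 : `|rho| < 1.
  rewrite ger0_norm ?divr_ge0 ?ltW// ltr_pdivrMr// mul1r; lra.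
have : `|D x| <= 0.
  have h : rho ^+ n * M @[n --> \oo] --> 0 * M.
    by apply: cvgMr_tmp; exact: cvg_expr.
  rewrite mul0r in h; rewrite -(cvg_lim (@norm_hausdorff _ R) h).
  by apply: limr_ge; [apply/cvg_ex; exists 0|apply: nearW => n].
by rewrite normr_le0 subr_eq0 => /eqP.
Qed.

End queue.

(** * The series for the classical queue *)

Lemma nnsumM (R : realType) (I J : countType) (f : I -> R) (g : J -> R) (l l' : R) :
  nnsum f l -> nnsum g l' -> nnsum (fun x : I * J => f x.1 * g x.2) (l * l').
Proof.
move=> hf hg; apply: (@nnsum_pair _ _ _ (fun i j => f i * g j) (fun i => f i * l')).
  by move=> i; apply: nnsumZ => //; have [] := hf.
apply: (@eq_nnsum _ _ (fun i => l' * f i)); first by move=> i; rewrite mulrC.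
by rewrite mulrC; apply: nnsumZ => //; exact: nnsum_ge0 hg.
Qed.

Section coefficients.
Variables (R : realType) (lam mu v : R) (k : nat).
Hypotheses (lam0 : 0 < lam) (mu0 : 0 < mu) (v0 : 0 < v) (k0 : (0 < k)%N).
Local Notation b := (k%:R * mu).
Local Notation c := (lam + b).

Let b0 : 0 < b. Proof. by rewrite mulr_gt0// ltr0n. Qed.
Let cv0 : 0 < c + v. Proof. by rewrite !addr_gt0. Qed.

(** The workload [k (n - 1) + s] cannot be reached from 0 with fewer than [n] up-steps. The Green
    series therefore starts at index [n], and its term [n + j] is the term [j] here. *)
Lemma nnsum_coef_A n s : (0 < n)%N -> (0 < s <= k)%N ->
  nnsum (fun j => coef_A lam mu k n s j * (c + v) ^- idx_a k n s j)
    (green lam b v k 0 (workload k (n, s))).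
Proof.
move=> n0 /andP[s0 sk]; rewrite /workload /= (gtn_eqF n0); set y := (_ + _)%N.
have yE j : (k * (n + j) + 0 - y = k * (j + 1) - s)%N /\ (y <= k * (n + j) + 0)%N.
  rewrite /y; case: n n0 y => // n _ _; rewrite addSn /= mulnS !mulnDr muln1; lia.
have uN j : (j < n)%N -> green_term lam b v k 0 y j = 0.
  move=> jn; rewrite /green_term; case: leqP => // h; exfalso.
  have : (k * j <= k * n.-1)%N by rewrite leq_mul2l; lia.
  by move: h; rewrite /y; lia.
have termE j : green_term lam b v k 0 y (n + j) =
    coef_A lam mu k n s j * (c + v) ^- idx_a k n s j.
  have [h1 h2] := yE j; rewrite /green_term h2 /walk_weight h1 /coef_A /idx_a.
  have -> : (n + j + (k * (j + 1) - s) = n + k + k * j + j - s)%N.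
    by rewrite mulnDr muln1; lia.
  have -> : (n + (j + 1) * (k + 1) - s = (n + k + k * j + j - s).+1)%N.
    by rewrite mulnDl !mulnDr !muln1 mul1n [(j * k)%N]mulnC; lia.
  by [].
have [||l [h _]] := @nnsum_bounded R (fun j => green_term lam b v k 0 y (n + j)) v^-1.
- by move=> j; exact: green_term_ge0.
- move=> N; apply: le_trans (sum_green_term_le lam0 b0 v0 k0 (n + N) 0 y).
  rewrite big_split_ord /= lerDr sumr_ge0// => i _; exact: green_term_ge0.
have hg := nnsum_uniq (nnsum_addn uN h) (greenP lam0 b0 v0 k0 0 y).
by apply: (eq_nnsum termE); rewrite -hg.
Qed.

(** The factor [b] raises the exponent [m + r k - 1] to [m + r k], and binomial symmetry replaces
    the lower index [m + r k] by [r]: row [m] is the series of [passage m]. Row 0 vanishes, which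
    leaves the sum over [m >= 1]. *)
Lemma nnsum_coef_C0 :
  nnsum (fun x : nat * nat => b * coef_C0 lam mu k x.1 x.2 * (c + v) ^- delta0 k x.1 x.2)
    (passage_tail lam b v k 1).
Proof.
apply: (@nnsum_pair _ _ _ (fun m r => b * coef_C0 lam mu k m r * (c + v) ^- delta0 k m r)
  (fun m => if m is m'.+1 then passage lam b v k m else 0)).
- case=> [|m].
    apply: (@eq_nnsum _ _ (fun=> 0)); last by split=> //; rewrite esum1.
    by move=> r; rewrite /coef_C0 !mul0r mulr0 mul0r.
  apply: eq_nnsum (passageP lam0 b0 v0 k0 m.+1) => r.
  rewrite /passage_term /passage_coef /coef_C0 /delta0 /= !addn1 addSn subSS subn0.
  rewrite [b ^+ (_ + _).+1]exprS.
  have -> : 'C((m + r * k.+1).+1, (m + r * k).+1) = 'C((m + r * k.+1).+1, r).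
    rewrite -[LHS]bin_sub; last by rewrite mulnS; lia.
    by congr 'C(_, _); rewrite mulnS; lia.
  by ring.
- rewrite -[passage_tail _ _ _ _ _]add0r.
  apply: (@nnsum_recl _ (fun m => if m is m'.+1 then passage lam b v k m else 0)) => //.
  apply: eq_nnsum (passage_tailP lam0 b0 v0 k0 1) => m.
  by rewrite addn1.
Qed.

Lemma nnsum_coef_B n s : (0 < n)%N -> (0 < s <= k)%N ->
  nnsum (fun x : nat * (nat * nat) => coef_B lam mu k n s x.1 x.2.1 x.2.2 *
      (c + v) ^- idx_b k n s x.1 x.2.1 x.2.2)
    (green lam b v k 0 (workload k (n, s)) * passage_tail lam b v k 1).
Proof.
move=> n0 hs; have := nnsumM (nnsum_coef_A n0 hs) nnsum_coef_C0.
apply: eq_nnsum => x /=; rewrite /coef_B /idx_b exprD invfM; ring.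
Qed.

(** One phase more than [(n, s)] is [(n, s + 1)], or [(n + 1, 1)] if [s = k]; this is the origin of
    the case distinction in [coef_C]. *)
Lemma nnsum_coef_C n s : (0 < n)%N -> (0 < s <= k)%N ->
  nnsum (fun x : nat * (nat * nat) => coef_C lam mu k n s x.1 x.2.1 x.2.2 *
      (c + v) ^- idx_c k n s x.1 x.2.1 x.2.2)
    (green lam b v k 0 (workload k (n, s)).+1 * passage_tail lam b v k 1).
Proof.
move=> n0 /andP[s0 sk].
have [sE|sk'] := eqVneq s k.
  have h : (0 < 1 <= k)%N by [].
  have := nnsumM (nnsum_coef_A (ltn0Sn n) h) nnsum_coef_C0.
  have -> : workload k (n.+1, 1%N) = (workload k (n, s)).+1.
    by rewrite /workload /= (gtn_eqF n0) sE; case: n n0 => // n _; rewrite mulnS; lia.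
  apply: eq_nnsum => x /=; rewrite /coef_C /idx_c sE eqxx /= exprD invfM; ring.
have h : (0 < s.+1 <= k)%N by rewrite /= ltn_neqAle sk' sk.
have := nnsumM (nnsum_coef_A n0 h) nnsum_coef_C0.
have -> : workload k (n, s.+1) = (workload k (n, s)).+1.
  by rewrite /workload /= (gtn_eqF n0) addnS.
apply: eq_nnsum => x /=; rewrite /coef_C /idx_c sk' /= exprD invfM; ring.
Qed.

End coefficients.

(** Indices above 1 correspond to kernels of positive order, which vanish at 0; the identities at
    time 0 rest on this. *)
Lemma idx_a_gt1 k n s j : (0 < n)%N -> (0 < s <= k)%N -> (1 < idx_a k n s j)%N.
Proof.
rewrite /idx_a mulnDl mul1n => n0 /andP[s0 sk].
by move: (j * (k + 1))%N => m; lia.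
Qed.

Lemma idx_b_gt1 k n s j m r : (0 < n)%N -> (0 < s <= k)%N -> (1 < idx_b k n s j m r)%N.
Proof. by move=> n0 hs; have := idx_a_gt1 j n0 hs; rewrite /idx_b; lia. Qed.

Lemma idx_c_gt1 k n s j m r : (0 < n)%N -> (0 < s <= k)%N -> (1 < idx_c k n s j m r)%N.
Proof.
move=> n0 /andP[s0 sk]; rewrite /idx_c; case: eqVneq => [sE|sk'] /=.
  have h : (0 < 1 <= k)%N by rewrite /=; lia.
  by have := idx_a_gt1 j (ltn0Sn n) h; lia.
have h : (0 < s.+1 <= k)%N by rewrite /= ltn_neqAle sk' sk.
by have := idx_a_gt1 j n0 h; lia.
Qed.

Lemma coef_A_ge0 (R : realType) (lam mu : R) k n s j : 0 < lam -> 0 < mu ->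
  0 <= coef_A lam mu k n s j.
Proof.
by move=> l0 m0; rewrite /coef_A !mulr_ge0// exprn_ge0 ?mulr_ge0// ltW.
Qed.

Lemma coef_C0_ge0 (R : realType) (lam mu : R) k m r : 0 < lam -> 0 < mu ->
  0 <= coef_C0 lam mu k m r.
Proof.
by move=> l0 m0; rewrite /coef_C0 !mulr_ge0 ?invr_ge0// exprn_ge0 ?mulr_ge0// ltW.
Qed.

Lemma coef_B_ge0 (R : realType) (lam mu : R) k n s j m r : 0 < lam -> 0 < mu ->
  0 <= coef_B lam mu k n s j m r.
Proof.
move=> l0 m0; rewrite /coef_B mulr_ge0 ?coef_A_ge0// mulr_ge0 ?coef_C0_ge0//.
by rewrite mulr_ge0// ltW.
Qed.

Lemma coef_C_ge0 (R : realType) (lam mu : R) k n s j m r : 0 < lam -> 0 < mu ->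
  0 <= coef_C lam mu k n s j m r.
Proof.
move=> l0 m0; rewrite /coef_C; case: ifP => _.
  by apply: coef_B_ge0.
by apply: (coef_B_ge0 k n.+1 1).
Qed.

Section series.
Variables (R : realType) (lam mu : R) (k n s : nat).
Hypotheses (lam0 : 0 < lam) (mu0 : 0 < mu) (k0 : (0 < k)%N).
Hypotheses (n0 : (0 < n)%N) (hs : (0 < s <= k)%N).
Local Notation b := (k%:R * mu).
Local Notation c := (lam + b).
Local Notation leb := (@lebesgue_measure R).
Local Notation D := (`[0%R, +oo[%classic : set R).

Let b0 : 0 < b. Proof. by rewrite mulr_gt0// ltr0n. Qed.
Let c0 : 0 < c. Proof. by rewrite addr_gt0. Qed.

Definition mixture_A := erlang_mixture c (coef_A lam mu k n s) (fun j => (idx_a k n s j).-1).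

Definition mixture_B := erlang_mixture c
  (fun x : nat * (nat * nat) => coef_B lam mu k n s x.1 x.2.1 x.2.2)
  (fun x => (idx_b k n s x.1 x.2.1 x.2.2).-1).

Definition mixture_C := erlang_mixture c
  (fun x : nat * (nat * nat) => coef_C lam mu k n s x.1 x.2.1 x.2.2)
  (fun x => (idx_c k n s x.1 x.2.1 x.2.2).-1).

Definition laplace_A (v : R) := green lam b v k 0 (workload k (n, s)).

Definition laplace_B (v : R) := laplace_A v * passage_tail lam b v k 1.

Definition laplace_C (v : R) :=
  green lam b v k 0 (workload k (n, s)).+1 * passage_tail lam b v k 1.

Let esum_idx (I : countType) (w : I -> R) (idx : I -> nat) (l v : R) :
  (forall i, (1 < idx i)%N) -> nnsum (fun i => w i * (c + v) ^- idx i) l ->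
  (\esum_(i in [set: I]) (w i * (c + v) ^- ((idx i).-1).+1)%:E = l%:E)%E.
Proof.
move=> idx1 [_ <-]; apply: eq_esum => i _.
by rewrite prednK// (ltn_trans _ (idx1 i)).
Qed.

Lemma laplace_AP v : 0 < v -> (\esum_(j in [set: nat])
  (coef_A lam mu k n s j * (c + v) ^- ((idx_a k n s j).-1).+1)%:E = (laplace_A v)%:E)%E.
Proof.
move=> v0; apply: (@esum_idx _ _ (idx_a k n s)); last exact: nnsum_coef_A.
by move=> j; exact: idx_a_gt1.
Qed.

Lemma laplace_BP v : 0 < v -> (\esum_(x in [set: nat * (nat * nat)])
  (coef_B lam mu k n s x.1 x.2.1 x.2.2 *
    (c + v) ^- ((idx_b k n s x.1 x.2.1 x.2.2).-1).+1)%:E = (laplace_B v)%:E)%E.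
Proof.
move=> v0.
apply: (@esum_idx _ _ (fun x : nat * (nat * nat) => idx_b k n s x.1 x.2.1 x.2.2)).
  by move=> x; exact: idx_b_gt1.
exact: nnsum_coef_B.
Qed.

Lemma laplace_CP v : 0 < v -> (\esum_(x in [set: nat * (nat * nat)])
  (coef_C lam mu k n s x.1 x.2.1 x.2.2 *
    (c + v) ^- ((idx_c k n s x.1 x.2.1 x.2.2).-1).+1)%:E = (laplace_C v)%:E)%E.
Proof.
move=> v0.
apply: (@esum_idx _ _ (fun x : nat * (nat * nat) => idx_c k n s x.1 x.2.1 x.2.2)).
  by move=> x; exact: idx_c_gt1.
exact: nnsum_coef_C.
Qed.

Let wA i : 0 <= coef_A lam mu k n s i. Proof. exact: coef_A_ge0. Qed.
Let wB (x : nat * (nat * nat)) : 0 <= coef_B lam mu k n s x.1 x.2.1 x.2.2.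
Proof. exact: coef_B_ge0. Qed.
Let wC (x : nat * (nat * nat)) : 0 <= coef_C lam mu k n s x.1 x.2.1 x.2.2.
Proof. exact: coef_C_ge0. Qed.

Variable p : R -> state k -> state k -> R.
Hypothesis hp : transition_function (queue_rate lam mu (k := k)) p.
Variables x0 y : state k.
Hypotheses (hx0 : val x0 = (0, 0)%N) (hy : val y = (n, s)).

Let laplace_mixture (I : countType) (w : I -> R) (a : I -> nat) (K : R -> R) :
  (forall i, 0 <= w i) ->
  (forall v, 0 < v ->
    (\esum_(i in [set: I]) (w i * (c + v) ^- (a i).+1)%:E = (K v)%:E)%E) ->
  let f := fun v t : R => expR (- (v * t)) * fine (erlang_mixture c w a t) in
  forall v, 0 < v -> leb.-integrable D (EFin \o f v) /\
    (\int[leb]_(t in D) (f v t)%:E = (K v)%:E)%E.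
Proof.
move=> w0 hK f v v0.
have fE : (\int[leb]_(t in D) (f v t)%:E = (K v)%:E)%E.
  rewrite -(laplace_erlang_mixture c0 w0 hK v0); apply: eq_integral => t.
  rewrite inE /= in_itv/= andbT => t0.
  by rewrite /f EFinM fineK// (erlang_mixture_fin_num c0 w0 hK).
have mU : measurable_fun (setT : set R) (erlang_mixture c w a).
  exact: measurable_erlang_mixture.
have mfine : measurable_fun (setT : set R) (fun t => fine (erlang_mixture c w a t)).
  exact: (measurableT_comp (@fine_measurable R setT measurableT) mU).
split=> //; apply: (ge0_fin_integrable _ _ _ fE) => //.
- apply: measurable_funM; first exact: measurable_expRN.
  apply: measurable_funTS; exact: mfine.
- move=> t _; rewrite mulr_ge0 ?expR_ge0// fine_ge0//.
  exact: erlang_mixture_ge0.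
Qed.

(** For [u > 0] both sides are continuous with equal transforms, by the resolvent formula.
    Injectivity does not reach [u = 0], where both sides vanish: the two states differ and the
    kernels have positive order. *)
Lemma transition_series (u : R) : 0 <= u ->
  transition0 p x0 y u = fine (mixture_A u) + fine (mixture_B u) - fine (mixture_C u).
Proof.
have hA := laplace_mixture wA laplace_AP.
have hB := laplace_mixture wB laplace_BP.
have hC := laplace_mixture wC laplace_CP.
have xy : x0 != y.
  apply/eqP => h; have : val x0 = val y by rewrite h.
  by rewrite hx0 hy => -[h0]; move: n0; rewrite -h0.
rewrite le_eqVlt => /orP[/eqP<-|u0].
  have mix0 (I : countType) (w : I -> R) (idx : I -> nat) : (forall i, (1 < idx i)%N) ->
      fine (erlang_mixture c w (fun i => (idx i).-1) 0) = 0.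
    move=> idx1; rewrite /erlang_mixture esum1// => i _.
    rewrite /erlang normr0 expr0n.
    case: (idx i) (idx1 i) => [|[|m]] //= _; by rewrite mul0r mul0r mulr0.
  rewrite transition0E// (_ : p 0 x0 y = 0); last first.
    by case: hp => _ _ -> _ _; rewrite (negbTE xy).
  rewrite /mixture_A mix0; last by move=> i; exact: idx_a_gt1.
  rewrite /mixture_B (mix0 _ _ (fun x : nat * (nat * nat) => idx_b k n s x.1 x.2.1 x.2.2));
    last by move=> i; exact: idx_b_gt1.
  rewrite /mixture_C (mix0 _ _ (fun x : nat * (nat * nat) => idx_c k n s x.1 x.2.1 x.2.2));
    last by move=> i; exact: idx_c_gt1.
  by rewrite addr0 subr0.
apply/eqP; rewrite -subr_eq0; apply/eqP.
pose gA t : R := fine (mixture_A t); pose gB t : R := fine (mixture_B t).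
pose gC t : R := fine (mixture_C t); pose tr := transition0 p x0 y.
have tcont : continuous tr by exact: (transition0_continuous hp).
have trE v : 0 < v -> leb.-integrable D (EFin \o (fun t => expR (- (v * t)) * tr t)) /\
    (\int[leb]_(t in D) (expR (- (v * t)) * tr t)%:E =
     (resolvent lam b v k 0 (workload k (n, s)))%:E)%E.
  move=> v0; have E := transition_laplaceE hp v0 x0 y.
  split; last first.
    by rewrite E (queue_laplaceE lam0 mu0 k0 x0 y hp v0) hx0 hy.
  apply: (ge0_fin_integrable _ _ _ E) => //.
  - apply: measurable_funM; first exact: measurable_expRN.
    by apply: measurable_funTS; exact: continuous_measurable_fun.
  - by move=> t _; rewrite mulr_ge0 ?expR_ge0// (transition0_ge0 hp).
have split4 v t : expR (- (v * t)) * (tr t - (gA t + gB t - gC t)) =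
  (expR (- (v * t)) * tr t - expR (- (v * t)) * gA t) -
  (expR (- (v * t)) * gB t - expR (- (v * t)) * gC t).
  by rewrite -!mulrBr; congr (_ * _); ring.
have intB (f g : R -> R) : leb.-integrable D (EFin \o f) -> leb.-integrable D (EFin \o g) ->
    leb.-integrable D (EFin \o (fun t : R => f t - g t)).
  by move=> h1 h2; exact: (@integrableB _ _ _ leb D (measurable_itv _) _ _ h1 h2).
apply: (@laplace_continuous_eq0 R (fun t => tr t - (gA t + gB t - gC t)) u _ _ u0).
- move=> v v0; rewrite (funext (split4 v)).
  have [i1 _] := trE v v0; have [i2 _] := hA v v0.
  have [i3 _] := hB v v0; have [i4 _] := hC v v0.
  exact: (intB _ _ (intB _ _ i1 i2) (intB _ _ i3 i4)).
- move=> v v0; transitivity (\int[leb]_(t in D)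
    ((expR (- (v * t)) * tr t - expR (- (v * t)) * gA t) -
    (expR (- (v * t)) * gB t - expR (- (v * t)) * gC t))%:E)%E.
    by apply: eq_integral => t _; rewrite split4.
  have [i1 e1] := trE v v0; have [i2 e2] := hA v v0.
  have [i3 e3] := hB v v0; have [i4 e4] := hC v v0.
  have j1 := intB _ _ i1 i2; have j2 := intB _ _ i3 i4.
  rewrite (integralB_EFin _ j1 j2)// (integralB_EFin _ i1 i2)// (integralB_EFin _ i3 i4)//.
  rewrite e1 e2 e3 e4 -!EFinB; congr EFin.
  by rewrite /resolvent /laplace_B /laplace_C /laplace_A; ring.
- have cA := erlang_mixture_continuous c0 wA laplace_AP u0.
  have cB := erlang_mixture_continuous c0 wB laplace_BP u0.
  have cC := erlang_mixture_continuous c0 wC laplace_CP u0.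
  apply: cvgB; first exact: tcont.
  by apply: cvgB; [apply: cvgD; [exact: cA|exact: cB]|exact: cC].
Qed.

End series.

(** * Independent time change *)

Section process_sigma.
Context (R : realType) (d : measure_display) (T : measurableType d).

Lemma process_sigma_algebra_gen (U : Type) (G : set (set U)) (X : R -> T -> U) t B :
  0 <= t -> G B -> process_sigma_algebra G X (X t @^-1` B).
Proof.
by move=> t0 GB; apply: sub_sigma_algebra; exists t, B.
Qed.

Lemma process_sigma_algebra_measurable (U : Type) (G : set (set U)) (X : R -> T -> U) A :
  measurable_process G X -> process_sigma_algebra G X A -> measurable A.
Proof.
move=> mX; apply: smallest_sub; first exact: sigma_algebra_measurable.
by move=> _ [t [B [t0 GB ->]]]; exact: mX.
Qed.

Variable sigma : R -> T -> R.
Hypothesis smono : forall w s t, 0 <= s -> s <= t -> sigma s w <= sigma t w.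
Local Notation L := (inverse_subordinator sigma).
Local Notation F := (process_sigma_algebra measurable sigma).

Let S : set (set T) :=
  [set A | exists t B, [/\ 0 <= t, measurable B & A = sigma t @^-1` B]].

(** Independence speaks of the sigma-algebra generated by [sigma], so membership in it, stronger
    than measurability, is what has to be shown. *)
Lemma process_sigma_algebra_inverse_subordinator_lt t s : F [set w | L t w < s].
Proof.
have [s0|s0] := leP s 0.
  rewrite (_ : [set _ | _] = set0); first exact: (@measurable0 _ (g_sigma_algebraType S)).
  rewrite -subset0 => w /= h.
  by have := inverse_subordinator_ge0 sigma t w; rewrite leNgt (lt_le_trans h).
have g u (B : set R) : 0 <= u -> measurable B ->
    @measurable _ (g_sigma_algebraType S) (sigma u @^-1` B).
  by move=> u0 mB; exact: process_sigma_algebra_gen.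
suff : @measurable _ (g_sigma_algebraType S) (
   (\bigcup_(q : rat) [set w : T |
      Num.max 0 (ratr q) < s /\ t < sigma (Num.max 0 (ratr q)) w]) `|`
   \bigcap_(n : nat) [set w : T | sigma n%:R w <= t]).
  congr (process_sigma_algebra _ _ _); apply/seteqP; split=> w /=.
    move=> h; apply/inverse_subordinatorltP => //; case: h => [[q _ h]|h]; [left|right].
      by exists q.
    by move=> n; exact: h.
  move/inverse_subordinatorltP => /(_ smono s0)[[q h]|h]; [left|right].
    by exists q.
  by move=> n _; exact: h.
apply: measurableU.
  apply: bigcupT_measurable_rat => q.
  have [qs|qs] := ltP (Num.max 0 (ratr q)) s; last first.
    by rewrite (_ : [set _ | _] = set0)//; apply/seteqP; split=> // z [].
  rewrite (_ : [set _ | _] = sigma (Num.max 0 (ratr q)) @^-1` `]t, +oo[).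
    by apply: g => //; rewrite le_max lexx.
  by apply/seteqP; split=> w /=; rewrite in_itv/= andbT => // -[].
apply: bigcapT_measurable => n.
rewrite (_ : [set _ | _] = sigma n%:R @^-1` `]-oo, t]); first exact: g.
by apply/seteqP; split=> w /=; rewrite in_itv.
Qed.

Lemma process_sigma_algebra_inverse_subordinator_itv t a b :
  F [set w | a <= L t w < b].
Proof.
have -> : [set w | a <= L t w < b] = [set w | L t w < b] `\` [set w | L t w < a].
  apply/seteqP; split=> w /=.
    by move=> /andP[h1 h2]; split=> //; apply/negP; rewrite -leNgt.
  by move=> [h1 /negP]; rewrite -leNgt => ->.
apply: (@measurableD _ (g_sigma_algebraType S)).
  exact: process_sigma_algebra_inverse_subordinator_lt.
exact: process_sigma_algebra_inverse_subordinator_lt.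
Qed.

End process_sigma.

Section time_change.
Context (R : realType) (d : measure_display) (T : measurableType d)
  (P : probability T R) (I : countType) (q : I -> I -> R) (p : R -> I -> I -> R)
  (X : R -> T -> I) (nu : R) (sigma : R -> T -> R).
Hypotheses (mX : measurable_process [set: set I] X)
  (Xright : forall w t, 0 <= t -> \forall s \near t^'+, X s w = X t w)
  (hp : transition_function q p) (hm : markov_property P p X)
  (nu0 : 0 < nu) (hsigma : stable_subordinator P nu sigma)
  (hindep : independent_processes P [set: set I] measurable X sigma).
Local Notation L := (inverse_subordinator sigma).
Local Notation FX := (process_sigma_algebra [set: set I] X).
Local Notation FS := (process_sigma_algebra measurable sigma).

Let smono w s t : 0 <= s -> s <= t -> sigma s w <= sigma t w.
Proof. by case: hsigma => _ [_ h _ _]; exact: h. Qed.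

Let msigma : measurable_process measurable sigma.
Proof. by case: hsigma. Qed.

Variable t : R.

(* Discretisation of [L t] from above along the grid of mesh [1 / n.+1]. *)
Let N n w : nat := Num.trunc (n.+1%:R * L t w).
Let Ln n w : R := (N n w).+1%:R / n.+1%:R.
Let E n j : set T := [set w | N n w = j].

Let NP n w : (N n w)%:R / n.+1%:R <= L t w < (N n w).+1%:R / n.+1%:R.
Proof.
have /truncn_itv/andP[h1 h2] : 0 <= n.+1%:R * L t w.
  by rewrite mulr_ge0// inverse_subordinator_ge0.
by rewrite ler_pdivrMr// ltr_pdivlMr// [L t w * _]mulrC h1 h2.
Qed.

Let EE n j : E n j = [set w | j%:R / n.+1%:R <= L t w < j.+1%:R / n.+1%:R].
Proof.
apply/seteqP; split=> w; first by move=> /= <-; exact: NP.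
by move=> /= h; apply: truncn_def; rewrite ler_pdivrMr// ltr_pdivlMr// mulrC in h.
Qed.

Let FSE n j : FS (E n j).
Proof. by rewrite EE; exact: process_sigma_algebra_inverse_subordinator_itv. Qed.

Let mE n j : measurable (E n j).
Proof. exact: process_sigma_algebra_measurable msigma (FSE n j). Qed.

Let trivE n : trivIset setT (E n).
Proof. by move=> i j _ _ [w [/= <- <-]]. Qed.

Let bigcupE n : \bigcup_j E n j = setT.
Proof. by apply/seteqP; split=> // w _; exists (N n w). Qed.

Let Ln_gt n w : L t w < Ln n w.
Proof. by have /andP[] := NP n w. Qed.

Let Ln_le n w : Ln n w <= L t w + n.+1%:R^-1.
Proof.
have /andP[h _] := NP n w.
by rewrite /Ln -addn1 natrD mulrDl mul1r lerD2r.
Qed.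

Let Ln_cvg w : Ln n w @[n --> \oo] --> L t w.
Proof.
apply: (@squeeze_cvgr _ _ _ _ (fun=> L t w) (fun n => L t w + n.+1%:R^-1)).
- by apply: nearW => n; rewrite ltW//= Ln_le.
- exact: cvg_cst.
- rewrite -[X in _ --> X]addr0; apply: cvgD; first exact: cvg_cst.
  exact: cvg_harmonic.
Qed.

(** The grid times lie strictly above [L t], so right-continuity in the discrete topology makes the
    path eventually constant along them. *)
Let near_X w : \forall n \near \oo, X (Ln n w) w = X (L t w) w.
Proof.
have [r /= r0 hr] := @Xright w (L t w) (inverse_subordinator_ge0 sigma t w).
have := @Ln_cvg w => /cvgrPdist_lt/(_ _ r0); apply: filterS => n hn.
exact: (hr _ hn (Ln_gt n w)).
Qed.

Let Apre y n : set T := [set w | X (Ln n w) w = y].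

Let ApreE y n : Apre y n = \bigcup_j (E n j `&` X (j.+1%:R / n.+1%:R) @^-1` [set y]).
Proof.
apply/seteqP; split=> w /=; first by move=> h; exists (N n w).
by move=> [j _ [/= <-]].
Qed.

Let mXy s y : 0 <= s -> measurable (X s @^-1` [set y]).
Proof. by move=> s0; exact: mX. Qed.

Let measurable_Apre y n : measurable (Apre y n).
Proof.
rewrite ApreE; apply: bigcupT_measurable => j; apply: measurableI => //.
by apply: mXy; rewrite divr_ge0.
Qed.

Lemma measurable_time_change y : measurable [set w | X (L t w) w = y].
Proof.
rewrite (_ : [set _ | _] = \bigcup_m \bigcap_n Apre y (m + n)).
  by apply: bigcupT_measurable => m; apply: bigcapT_measurable => n.
apply/seteqP; split=> w /=.
  move=> h; have [m _ hm'] := near_X w; exists m => // n _.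
  by rewrite /Apre /= hm'//= leq_addr.
move=> [m _ h]; have [m' _ hm'] := near_X w.
have <- := hm' (m + m')%N (leq_addl _ _).
exact: (h m' Logic.I).
Qed.

(** The Markov property for the time sequence [0, s, s, ...] at [m = 0]. *)
Let P_two s x y : 0 <= s ->
  P (X s @^-1` [set y] `&` X 0 @^-1` [set x]) =
  (P (X 0 @^-1` [set x]) * (p s x y)%:E)%E.
Proof.
move=> s0; have := @hm 0%N (fun i => if i == 0%N then 0 else s) (fun i => if i == 0%N then x else y).
rewrite /= subr0 => /(_ (lexx _)).
have h i : (if i == 0%N then 0 else s) <= (if i.+1 == 0%N then 0 else s) by case: ifP.
move=> /(_ h).
have -> : [set w | forall i, (i <= 1)%N ->
   X (if i == 0%N then 0 else s) w = (if i == 0%N then x else y)] =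
   X s @^-1` [set y] `&` X 0 @^-1` [set x].
  apply/seteqP; split=> w /=; first by move=> H; split; [exact: (H 1%N)|exact: (H 0%N)].
  by move=> [h1 h2] [|[|i]].
move=> ->; congr (P _ * _)%E; apply/seteqP; split=> w /=; first by move=> /(_ 0%N); apply.
by move=> H [|i].
Qed.

Let FX_two s x y : 0 <= s -> FX (X s @^-1` [set y] `&` X 0 @^-1` [set x]).
Proof.
move=> s0; pose S := [set A | exists t B, [/\ 0 <= t, [set: set I] B & A = X t @^-1` B]].
by apply: (@measurableI _ (g_sigma_algebraType S)); exact: process_sigma_algebra_gen.
Qed.

Let mpLn x y n : measurable_fun setT (fun w => (transition0 p x y (Ln n w))%:E).
Proof.
move=> _ B mB; rewrite setTI.
rewrite (_ : _ @^-1` B = \bigcup_(j in [set j | B (transition0 p x y (j.+1%:R / n.+1%:R))%:E]) E n j).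
  by apply: bigcup_measurable => j _.
apply/seteqP; split=> w /=; first by move=> h; exists (N n w).
by move=> [j /= h hj]; rewrite /Ln hj.
Qed.

(** On [E n j] the grid time is a constant, so independence factors each piece and the two-time law
    of [X] applies; summing over [j] rebuilds the expectation. *)
Let P_Apre x y n :
  (P (Apre y n `&` X 0 @^-1` [set x]) =
   P (X 0 @^-1` [set x]) * \int[P]_w (transition0 p x y (Ln n w))%:E)%E.
Proof.
have g0 (j : nat) : 0 <= j.+1%:R / n.+1%:R :> R by rewrite divr_ge0.
rewrite ApreE setI_bigcupl.
pose F j := E n j `&` X (j.+1%:R / n.+1%:R) @^-1` [set y] `&` X 0 @^-1` [set x].
have mF j : measurable (F j).
  by apply: measurableI; [apply: measurableI => //; exact: mXy|exact: mXy].
have tF : trivIset setT F.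
  by move=> i j _ _ [w [[[/= <- _] _] [[/= <- _] _]]].
rewrite (measure_semi_bigcup _ mF tF); last exact: bigcupT_measurable.
have -> : (\int[P]_w (transition0 p x y (Ln n w))%:E =
    \sum_(j <oo) ((transition0 p x y (j.+1%:R / n.+1%:R))%:E * P (E n j)))%E.
  rewrite -[X in integral _ X _](bigcupE n) ge0_integral_bigcup//.
  - apply: eq_eseriesr => j _; rewrite -integral_cst//.
    by apply: eq_integral => w; rewrite inE => <-.
  - by rewrite bigcupE; exact: mpLn.
  - by move=> w _; rewrite lee_fin (transition0_ge0 hp).
have PX : P (X 0 @^-1` [set x]) \is a fin_num by apply: fin_num_measure; exact: mXy.
rewrite -(fineK PX) -nneseriesZl; last first.
  by move=> j _; rewrite mule_ge0// lee_fin (transition0_ge0 hp).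
rewrite fineK//; apply: eq_eseriesr => j _.
transitivity (P ((X (j.+1%:R / n.+1%:R) @^-1` [set y] `&` X 0 @^-1` [set x]) `&` E n j)).
  by rewrite setIC setIA.
by rewrite hindep ?FSE ?P_two// ?transition0E ?muleA//; exact: FX_two.
Qed.

(** Dominated convergence in the grid identity: the events on the left stabilise pointwise, and
    [transition0] on the right is continuous. *)
Lemma time_change_expectation x y :
  (P ([set w | X (L t w) w = y] `&` X 0 @^-1` [set x]) =
   P (X 0 @^-1` [set x]) * \int[P]_w (transition0 p x y (L t w))%:E)%E.
Proof.
have i1 : P.-integrable setT (fun=> 1%E : \bar R).
  exact: (finite_measure_integrable_cst P 1).
have mA := measurableI _ _ (measurable_time_change y) (mXy x (lexx 0)).
set A := _ `&` _ in mA *.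
have mAn n : measurable (Apre y n `&` X 0 @^-1` [set x]).
  by apply: measurableI => //; exact: mXy.
have ind1 (B : set T) w : (`|(\1_B w)%:E| <= 1 :> \bar R)%E.
  by rewrite indicE; case: (_ \in _); rewrite ?abse0 ?abse1 ?lee_fin.
have mind (B : set T) : measurable B -> measurable_fun setT (fun w => (\1_B w)%:E : \bar R).
  by move=> mB; apply/measurable_EFinP; exact: measurable_indic.
have ind_cvg : {ae P, forall w, setT w ->
    (\1_(Apre y n `&` X 0 @^-1` [set x]) w)%:E @[n --> \oo] --> ((\1_A w)%:E : \bar R)}.
  apply: aeW => w _; apply: cvg_near_cst; apply: filterS (@near_X w) => n h.
  congr EFin; rewrite !indicE; congr (nat_of_bool _)%:R.
  by apply/idP/idP; rewrite !inE /A /Apre /= h.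
have [_ _ h1] := @dominated_convergence _ T R P setT measurableT
  (fun n w => (\1_(Apre y n `&` X 0 @^-1` [set x]) w)%:E) (fun w => (\1_A w)%:E) (fun=> 1%E)
  (fun n => mind _ (mAn n)) (mind _ mA) ind_cvg i1 (aeW P (fun w n _ => ind1 _ w)).
have tc : continuous (transition0 p x y) by exact: (transition0_continuous hp).
have mp : measurable_fun setT (fun w => (transition0 p x y (L t w))%:E).
  apply/measurable_EFinP; apply: measurableT_comp.
    exact: continuous_measurable_fun.
  exact: (measurable_inverse_subordinator hsigma).
have p1 u : (`|(transition0 p x y u)%:E| <= 1 :> \bar R)%E.
  by rewrite abse_EFin lee_fin ger0_norm ?(transition0_ge0 hp)// (transition0_le1 hp).
have p_cvg : {ae P, forall w, setT w ->
    (transition0 p x y (Ln n w))%:E @[n --> \oo] --> (transition0 p x y (L t w))%:E}.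
  apply: aeW => w _; apply: cvg_EFin; first exact: nearW.
  by apply: continuous_cvg; [exact: tc|exact: Ln_cvg].
have [_ _ h2] := @dominated_convergence _ T R P setT measurableT
  (fun n w => (transition0 p x y (Ln n w))%:E) (fun w => (transition0 p x y (L t w))%:E) (fun=> 1%E)
  (mpLn x y) mp p_cvg i1 (aeW P (fun w n _ => p1 _)).
have PX : P (X 0 @^-1` [set x]) \is a fin_num.
  by apply: fin_num_measure; exact: mXy.
have {}h1 : P (Apre y n `&` X 0 @^-1` [set x]) @[n --> \oo] --> P A.
  move: h1; rewrite integral_indic// setIT; apply: cvg_trans; apply: near_eq_cvg.
  by apply: nearW => n /=; rewrite integral_indic// setIT.
have {}h2 : P (Apre y n `&` X 0 @^-1` [set x]) @[n --> \oo] -->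
    (P (X 0 @^-1` [set x]) * \int[P]_w (transition0 p x y (L t w))%:E)%E.
  rewrite (_ : (fun n => P _) =
    (fun n => P (X 0 @^-1` [set x]) * \int[P]_w (transition0 p x y (Ln n w))%:E)%E).
    by apply: cvgeZl.
  by apply/funext => n; exact: P_Apre.
exact: (cvg_unique (@ereal_hausdorff R) h1 h2).
Qed.

End time_change.

Lemma eq_measure_off_null (R : realType) (d : measure_display) (T : measurableType d)
    (P : {measure set T -> \bar R}) (N A B : set T) :
  measurable N -> P N = 0%E -> measurable A -> measurable B ->
  A `\` N = B `\` N -> P A = P B.
Proof.
move=> mN N0 mA mB AB.
have le C D : measurable C -> measurable D -> C `\` N = D `\` N -> (P C <= P D)%E.
  move=> mC mD CD; apply: (@le_trans _ _ (P (D `|` N))); last first.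
    by apply: le_trans (measureU2 P mD mN) _; rewrite [X in (_ + X)%E](_ : _ = 0%E) ?adde0.
  apply: le_measure; rewrite ?inE//; first exact: measurableU.
  move=> w Cw; have [Nw|Nw] := pselect (N w); first by right.
  by left; have [] : (D `\` N) w by rewrite -CD.
by apply/eqP; rewrite eq_le !le.
Qed.

(** * The fractional queue *)

Section fractional_queue.
Context (R : realType) (d : measure_display) (T : measurableType d)
  (P : probability T R) (lam mu nu : R) (k : nat)
  (Q : R -> T -> state k) (sigma : R -> T -> R) (p : R -> state k -> state k -> R).
Hypotheses (lam0 : 0 < lam) (mu0 : 0 < mu) (k0 : (0 < k)%N) (nu0 : 0 < nu).
Hypotheses (mQ : measurable_process [set: set (state k)] Q)
  (Qright : forall w t, 0 <= t -> \forall s \near t^'+, Q s w = Q t w)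
  (hp : transition_function (queue_rate lam mu (k := k)) p) (hm : markov_property P p Q)
  (hsigma : stable_subordinator P nu sigma)
  (hindep : independent_processes P [set: set (state k)] measurable Q sigma).
Local Notation L := (inverse_subordinator sigma).
Local Notation Qnu := (time_change Q L).
Local Notation b := (k%:R * mu).
Local Notation c := (lam + b).
Local Notation EL f t := (\int[P]_w f (L t w))%E.
Local Notation leb := (@lebesgue_measure R).

Hypothesis hinit : (0 < P [set w | val (Qnu 0 w) = (0, 0)%N])%E.
Variables (n s : nat).
Hypotheses (n0 : (0 < n)%N) (hs : (0 < s <= k)%N).
Variables (x0 y : state k).
Hypotheses (hx0 : val x0 = (0, 0)%N) (hy : val y = (n, s)).

Let b0 : 0 < b. Proof. by rewrite mulr_gt0// ltr0n. Qed.
Let c0 : 0 < c. Proof. by rewrite addr_gt0. Qed.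
Let wA i : 0 <= coef_A lam mu k n s i. Proof. exact: coef_A_ge0. Qed.
Let wB (x : nat * (nat * nat)) : 0 <= coef_B lam mu k n s x.1 x.2.1 x.2.2.
Proof. exact: coef_B_ge0. Qed.
Let wC (x : nat * (nat * nat)) : 0 <= coef_C lam mu k n s x.1 x.2.1 x.2.2.
Proof. exact: coef_C_ge0. Qed.
Let hKA := laplace_AP lam0 mu0 k0 n0 hs.
Let hKB := laplace_BP lam0 mu0 k0 n0 hs.
Let hKC := laplace_CP lam0 mu0 k0 n0 hs.

Let tr : R -> R := transition0 p x0 y.

Let mtr : measurable_fun (setT : set R) (fun u => (tr u)%:E).
Proof.
apply/measurable_EFinP; apply: continuous_measurable_fun.
exact: (transition0_continuous hp).
Qed.

Let tr_ge0 (u : R) : (0 <= (tr u)%:E)%E.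
Proof. by rewrite lee_fin (transition0_ge0 hp). Qed.

Let mL t : measurable_fun setT (L t).
Proof. exact: (measurable_inverse_subordinator hsigma). Qed.

Let Etr_fin t : (EL (fun u => (tr u)%:E) t) \is a fin_num.
Proof.
rewrite ge0_fin_numE; last by apply: integral_ge0 => w _; exact: tr_ge0.
apply: (@le_lt_trans _ _ (\int[P]_w cst 1%E w)%E).
  apply: ge0_le_integral => //.
  - by apply: (measurableT_comp mtr); exact: mL.
  - by move=> w _; rewrite lee_fin (transition0_le1 hp).
by rewrite integral_cst// mul1e; exact: le_lt_trans (probability_le1 _ _) (ltry _).
Qed.

(** The conditioning event concerns [Q (L 0)], equal to [Q 0] off the null event [L 0 != 0]. After
    this replacement the initial probability, positive by [hinit], cancels. *)
Lemma state_prob_expectation t :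
  state_prob P Qnu n s t = fine (EL (fun u => (tr u)%:E) t).
Proof.
rewrite /state_prob /cond_prob.
pose N := [set w | L 0 w != 0].
have N0 : P N = 0%E by exact: (inverse_subordinator0_null nu0 hsigma).
have mN : measurable N.
  rewrite (_ : N = L 0 @^-1` [set~ 0]).
    by rewrite -[X in measurable X]setTI; apply: mL => //; apply: measurableC.
  by apply/seteqP; split=> w /=; [move=> /eqP|move=> h; apply/eqP].
have valE (z : state k) r u : val z = (r, u) ->
    forall t, [set w | val (Qnu t w) = (r, u)] = [set w | Q (L t w) w = z].
  move=> hz t'; apply/seteqP; split=> w /=; rewrite /time_change; last by move=> ->.
  by rewrite -hz => /val_inj.
rewrite (valE _ _ _ hy) (valE _ _ _ hx0).
have P0 := hinit; rewrite (valE _ _ _ hx0) in P0.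
have mB0 : measurable (Q 0 @^-1` [set x0]) by exact: mQ.
have mT t' z : measurable [set w | Q (L t' w) w = z].
  exact: (measurable_time_change mQ Qright hsigma).
have PB : P [set w | Q (L 0 w) w = x0] = P (Q 0 @^-1` [set x0]).
  apply: (eq_measure_off_null mN N0) => //.
  apply/seteqP; split=> w /= [h /negP]; rewrite negbK => /eqP L0; move: h; rewrite L0.
    by move=> h; split=> //; apply/negP; rewrite negbK L0.
  by move=> h; split; [|apply/negP; rewrite negbK L0].
have PAB : P ([set w | Q (L t w) w = y] `&` [set w | Q (L 0 w) w = x0]) =
    P ([set w | Q (L t w) w = y] `&` Q 0 @^-1` [set x0]).
  apply: (eq_measure_off_null mN N0); [exact: measurableI|exact: measurableI|].
  apply/seteqP; split=> w /= [[h1 h2] hN]; split=> //; split=> //; move: hN => /negP.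
    by rewrite negbK => /eqP L0; move: h2; rewrite L0.
  by rewrite negbK => /eqP ->.
rewrite PAB PB (time_change_expectation mQ Qright hp hm hsigma hindep).
rewrite PB in P0.
have f0 : P (Q 0 @^-1` [set x0]) \is a fin_num by exact: fin_num_measure.
rewrite fineM ?Etr_fin// mulrAC divff ?mul1r//.
by rewrite gt_eqF// fine_gt0// P0/= ltey_eq f0.
Qed.

Let mixture_measurable (U : R -> \bar R) t : measurable_fun setT U ->
  measurable_fun setT (fun w => U (L t w)).
Proof. by move=> mU; exact: (measurableT_comp mU (mL t)). Qed.

Lemma state_prob_series t : 0 <= t -> state_prob P Qnu n s t =
  fine (EL (mixture_A lam mu k n s) t) + fine (EL (mixture_B lam mu k n s) t)
  - fine (EL (mixture_C lam mu k n s) t).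
Proof.
move=> t0; rewrite state_prob_expectation.
have fA : EL (mixture_A lam mu k n s) t \is a fin_num.
  exact: (expectation_erlang_mixture_fin_num c0 wA hKA nu0 hsigma).
have fB : EL (mixture_B lam mu k n s) t \is a fin_num.
  exact: (expectation_erlang_mixture_fin_num c0 wB hKB nu0 hsigma).
have fC : EL (mixture_C lam mu k n s) t \is a fin_num.
  exact: (expectation_erlang_mixture_fin_num c0 wC hKC nu0 hsigma).
(* The subtracted mixture is moved to the other side, so that only sums of nonnegative integrands
   are split. *)
apply/eqP; rewrite eq_sym subr_eq eq_sym; apply/eqP.
apply: EFin_inj; rewrite !EFinD !fineK//.
have gA w : (0 <= mixture_A lam mu k n s (L t w))%E by exact: erlang_mixture_ge0.
have gB w : (0 <= mixture_B lam mu k n s (L t w))%E by exact: erlang_mixture_ge0.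
have gC w : (0 <= mixture_C lam mu k n s (L t w))%E by exact: erlang_mixture_ge0.
have mA : measurable_fun setT (fun w => mixture_A lam mu k n s (L t w)).
  by apply: (mixture_measurable (U := mixture_A lam mu k n s)); exact: measurable_erlang_mixture.
have mB : measurable_fun setT (fun w => mixture_B lam mu k n s (L t w)).
  by apply: (mixture_measurable (U := mixture_B lam mu k n s)); exact: measurable_erlang_mixture.
have mC : measurable_fun setT (fun w => mixture_C lam mu k n s (L t w)).
  by apply: (mixture_measurable (U := mixture_C lam mu k n s)); exact: measurable_erlang_mixture.
have mT := mixture_measurable t mtr.
rewrite -!ge0_integralD//.
apply: eq_integral => w _; have L0 := inverse_subordinator_ge0 sigma t w.
rewrite /tr (transition_series lam0 mu0 k0 n0 hs hp hx0 hy L0).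
have uA : mixture_A lam mu k n s (L t w) \is a fin_num by exact: (erlang_mixture_fin_num c0 wA hKA).
have uB : mixture_B lam mu k n s (L t w) \is a fin_num by exact: (erlang_mixture_fin_num c0 wB hKB).
have uC : mixture_C lam mu k n s (L t w) \is a fin_num by exact: (erlang_mixture_fin_num c0 wC hKC).
rewrite -[in RHS](fineK uA) -[in RHS](fineK uB) -[X in (_ + X)%E = _](fineK uC).
by rewrite -!EFinD subrK.
Qed.

Lemma laplace_state_prob v : 0 < v -> laplace (state_prob P Qnu n s) v =
  (v `^ (nu - 1) * laplace_A lam mu k n s (v `^ nu) +
   v `^ (nu - 1) * laplace_B lam mu k n s (v `^ nu) -
   v `^ (nu - 1) * laplace_C lam mu k n s (v `^ nu))%:E.
Proof.
move=> v0; rewrite /laplace.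
transitivity (\int[leb]_(t in `[0%R, +oo[) ((expR (- (v * t)))%:E * EL (fun u => (tr u)%:E) t))%E.
  by apply: eq_integral => t _; rewrite EFinM state_prob_expectation fineK.
rewrite (laplace_inverse_subordinator hsigma v0 mtr tr_ge0).
have vnu0 : 0 < v `^ nu by exact: powR_gt0.
under eq_integral do rewrite -EFinM.
rewrite (transition_laplaceE hp vnu0) (queue_laplaceE lam0 mu0 k0 _ _ hp vnu0) hx0 hy.
rewrite -EFinM; congr EFin; rewrite /resolvent /laplace_B /laplace_C /laplace_A; ring.
Qed.

Let time_term_erlang a t : (1 < a)%N ->
  time_term lam mu nu k a t = t `^ (expo nu (a.-1).+1 - 1) *
    mittag_leffler nu (expo nu (a.-1).+1) (a.-1).+1%:R (- c * t `^ nu).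
Proof. by move=> a1; rewrite /time_term prednK// (ltn_trans _ a1). Qed.

(** The Mittag-Leffler series alternates in sign here; its nonnegativity is visible only through the
    expectation of an Erlang kernel. *)
Let time_term_ge0 a t : 0 <= t -> (1 < a)%N -> 0 <= time_term lam mu nu k a t.
Proof.
move=> t0 a1; rewrite time_term_erlang// -lee_fin.
have a0 : (0 < a.-1)%N by case: a a1 => [|[|a]].
rewrite -(expectation_erlang c0 nu0 hsigma t0 a0).
by apply: integral_ge0 => w _; rewrite lee_fin erlang_ge0.
Qed.

Let idxA j : (1 < idx_a k n s j)%N. Proof. exact: idx_a_gt1. Qed.
Let idxB j m r : (1 < idx_b k n s j m r)%N. Proof. exact: idx_b_gt1. Qed.
Let idxC j m r : (1 < idx_c k n s j m r)%N. Proof. exact: idx_c_gt1. Qed.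

Let pred_gt0 a : (1 < a)%N -> (0 < a.-1)%N.
Proof. by case: a => [|[|a]]. Qed.

Lemma time_A t : 0 <= t ->
  sums_to 0 (fun j => coef_A lam mu k n s j * time_term lam mu nu k (idx_a k n s j) t)
    (fine (EL (mixture_A lam mu k n s) t)).
Proof.
move=> t0; apply: esum_sums_to => [j|].
  by rewrite mulr_ge0// time_term_ge0.
have a0 j : (0 < (idx_a k n s j).-1)%N by exact: pred_gt0.
rewrite fineK; last exact: (expectation_erlang_mixture_fin_num c0 wA hKA nu0 hsigma).
rewrite (expectation_erlang_mixture c0 wA nu0 hsigma a0 t0).
by apply: eq_esum => j _; rewrite time_term_erlang.
Qed.

Lemma time_B t : 0 <= t ->
  sums_to3 (fun j m r => coef_B lam mu k n s j m r *
      time_term lam mu nu k (idx_b k n s j m r) t)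
    (fine (EL (mixture_B lam mu k n s) t)).
Proof.
move=> t0; apply: esum_sums_to3 => [j m r|j r|].
- by rewrite mulr_ge0 ?coef_B_ge0// time_term_ge0.
- by rewrite /coef_B /coef_C0 !mul0r mulr0 !mul0r.
have a0 (x : nat * (nat * nat)) : (0 < (idx_b k n s x.1 x.2.1 x.2.2).-1)%N by exact: pred_gt0.
rewrite fineK; last exact: (expectation_erlang_mixture_fin_num c0 wB hKB nu0 hsigma).
rewrite (expectation_erlang_mixture c0 wB nu0 hsigma a0 t0).
by apply: eq_esum => x _; rewrite time_term_erlang.
Qed.

Lemma time_C t : 0 <= t ->
  sums_to3 (fun j m r => coef_C lam mu k n s j m r *
      time_term lam mu nu k (idx_c k n s j m r) t)
    (fine (EL (mixture_C lam mu k n s) t)).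
Proof.
move=> t0; apply: esum_sums_to3 => [j m r|j r|].
- by rewrite mulr_ge0 ?coef_C_ge0// time_term_ge0.
- by rewrite /coef_C /coef_C0 !mul0r mulr0 !mul0r; case: ifP; rewrite mul0r.
have a0 (x : nat * (nat * nat)) : (0 < (idx_c k n s x.1 x.2.1 x.2.2).-1)%N by exact: pred_gt0.
rewrite fineK; last exact: (expectation_erlang_mixture_fin_num c0 wC hKC nu0 hsigma).
rewrite (expectation_erlang_mixture c0 wC nu0 hsigma a0 t0).
by apply: eq_esum => x _; rewrite time_term_erlang.
Qed.

(** The exponent [nu a - (nu (a - 1) + 1)] equals [nu - 1] for every [a], so all terms share the
    factor by which the transform of the classical queue at [v^nu] is multiplied. *)
Let laplace_termE a v : laplace_term lam mu nu k a v =
  v `^ (nu - 1) * (c + v `^ nu) ^- a.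
Proof. by rewrite /laplace_term /expo; congr (_ `^ _ * _); ring. Qed.

Let termE (w : R) a v : w * laplace_term lam mu nu k a v =
  v `^ (nu - 1) * (w * (c + v `^ nu) ^- a).
Proof. by rewrite laplace_termE mulrCA. Qed.

Lemma laplace_sum_A v : 0 < v ->
  sums_to 0 (fun j => coef_A lam mu k n s j * laplace_term lam mu nu k (idx_a k n s j) v)
    (v `^ (nu - 1) * laplace_A lam mu k n s (v `^ nu)).
Proof.
move=> v0; have vnu0 : 0 < v `^ nu by exact: powR_gt0.
have [h0 h1] := nnsumZ (powR_ge0 v (nu - 1)) (nnsum_coef_A lam0 mu0 vnu0 k0 n0 hs).
by apply: esum_sums_to => [j|]; [|rewrite -h1; apply: eq_esum => j _]; rewrite termE.
Qed.

Lemma laplace_sum_B v : 0 < v ->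
  sums_to3 (fun j m r => coef_B lam mu k n s j m r *
      laplace_term lam mu nu k (idx_b k n s j m r) v)
    (v `^ (nu - 1) * laplace_B lam mu k n s (v `^ nu)).
Proof.
move=> v0; have vnu0 : 0 < v `^ nu by exact: powR_gt0.
have [h0 h1] := nnsumZ (powR_ge0 v (nu - 1)) (nnsum_coef_B lam0 mu0 vnu0 k0 n0 hs).
apply: esum_sums_to3 => [j m r|j r|].
- by rewrite termE; exact: (h0 (j, (m, r))).
- by rewrite /coef_B /coef_C0 !mul0r mulr0 !mul0r.
- by rewrite -h1; apply: eq_esum => x _; rewrite termE.
Qed.

Lemma laplace_sum_C v : 0 < v ->
  sums_to3 (fun j m r => coef_C lam mu k n s j m r *
      laplace_term lam mu nu k (idx_c k n s j m r) v)
    (v `^ (nu - 1) * laplace_C lam mu k n s (v `^ nu)).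
Proof.
move=> v0; have vnu0 : 0 < v `^ nu by exact: powR_gt0.
have [h0 h1] := nnsumZ (powR_ge0 v (nu - 1)) (nnsum_coef_C lam0 mu0 vnu0 k0 n0 hs).
apply: esum_sums_to3 => [j m r|j r|].
- by rewrite termE; exact: (h0 (j, (m, r))).
- by rewrite /coef_C /coef_C0 !mul0r mulr0 !mul0r; case: ifP; rewrite mul0r.
- by rewrite -h1; apply: eq_esum => x _; rewrite termE.
Qed.

End fractional_queue.

Theorem theorem5p5 (R : realType) (d : measure_display) (T : measurableType d)
    (P : probability T R) (lam mu nu : R) (k : nat)
    (Q : R -> T -> state k) (sigma : R -> T -> R) (Qnu : R -> T -> state k)
    (hlam : 0 < lam) (hmu : 0 < mu) (hk : (1 <= k)%N)
    (hnu0 : 0 < nu) (hnu1 : nu < 1)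
    (hQ : markov_chain P (queue_rate lam mu (k := k)) Q)
    (hsigma : stable_subordinator P nu sigma)
    (hindep : independent_processes P [set: set (state k)] measurable Q sigma)
    (hQnu : Qnu = time_change Q (inverse_subordinator sigma))
    (hinit : (0 < P [set w | val (Qnu 0%R w) = (0, 0)%N])%E)
    (n s : nat) (hn : (1 <= n)%N) (hs : (1 <= s <= k)%N) :
  (forall t : R, 0 <= t ->
     exists SA SB SC : R,
       [/\ sums_to 0 (fun j =>
             coef_A lam mu k n s j
               * time_term lam mu nu k (idx_a k n s j) t) SA,
           sums_to3 (fun j m r =>
             coef_B lam mu k n s j m r
               * time_term lam mu nu k (idx_b k n s j m r) t) SB,
           sums_to3 (fun j m r =>
             coef_C lam mu k n s j m r
               * time_term lam mu nu k (idx_c k n s j m r) t) SC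
         & state_prob P Qnu n s t = SA + SB - SC]) /\
  (forall v : R, 0 < v ->
     exists SA SB SC : R,
       [/\ sums_to 0 (fun j =>
             coef_A lam mu k n s j
               * laplace_term lam mu nu k (idx_a k n s j) v) SA,
           sums_to3 (fun j m r =>
             coef_B lam mu k n s j m r
               * laplace_term lam mu nu k (idx_b k n s j m r) v) SB,
           sums_to3 (fun j m r =>
             coef_C lam mu k n s j m r
               * laplace_term lam mu nu k (idx_c k n s j m r) v) SC
         & laplace (state_prob P Qnu n s) v = (SA + SB - SC)%:E]).
Proof.
case: hQ => mQ Qright [p [hp hm]].
have v0 : valid_state k (0, 0)%N by [].
have vy : valid_state k (n, s) by rewrite /valid_state /= hn hs orbT.
pose x0 : state k := exist _ (0, 0)%N v0; pose y : state k := exist _ (n, s) vy.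
have hx0 : val x0 = (0, 0)%N by [].
have hy : val y = (n, s) by [].
rewrite hQnu in hinit *; split=> [t t0|v v0'].
  exists (fine (\int[P]_w mixture_A lam mu k n s (inverse_subordinator sigma t w))%E),
    (fine (\int[P]_w mixture_B lam mu k n s (inverse_subordinator sigma t w))%E),
    (fine (\int[P]_w mixture_C lam mu k n s (inverse_subordinator sigma t w))%E).
  split.
  - exact: (time_A hlam hmu hk hnu0 hsigma hn hs t0).
  - exact: (time_B hlam hmu hk hnu0 hsigma hn hs t0).
  - exact: (time_C hlam hmu hk hnu0 hsigma hn hs t0).
  - exact: (state_prob_series hlam hmu hk hnu0 mQ Qright hp hm hsigma hindep hinit hn hs hx0 hy t0).
exists (v `^ (nu - 1) * laplace_A lam mu k n s (v `^ nu)),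
  (v `^ (nu - 1) * laplace_B lam mu k n s (v `^ nu)),
  (v `^ (nu - 1) * laplace_C lam mu k n s (v `^ nu)).
split.
- exact: laplace_sum_A.
- exact: laplace_sum_B.
- exact: laplace_sum_C.
- exact: (laplace_state_prob hlam hmu hk hnu0 mQ Qright hp hm hsigma hindep hinit hx0 hy v0').
Qed.
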